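(* The $C^*$-algebra $\mathcal{E}(-1)$ is isomorphic to the $C^*$-algebra generated by the two continuous matrix-functions $a_1,a_2: D\to M_4(\mathbb{C})$ which at a point $(r_1,x_1,x_2,e^{i\phi},e^{i\phi_1},e^{i\phi_2})\in D$ are given by $$a_1=\begin{pmatrix}0&e^{i\phi_1}\sqrt{x_1}\\ \sqrt{1-x_1}&0\end{pmatrix}\otimes\begin{pmatrix}1&0\\0&1\end{pmatrix},$$ $$a_2=\sqrt{1-r_1^2}\begin{pmatrix}1&0\\0&-1\end{pmatrix}\otimes\begin{pmatrix}0&e^{i\phi_2}\sqrt{x_2}\\ \sqrt{1-x_2}&0\end{pmatrix}+r_1e^{i\phi}\begin{pmatrix}0&\sqrt{1-x_1}\\-e^{-i\phi_1}\sqrt{x_1}&0\end{pmatrix}\otimes\begin{pmatrix}1&0\\0&1\end{pmatrix}.$$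
   Context: $\mathcal{E}(-1)$ is the enveloping (universal) $C^*$-algebra generated by $a_1,a_2$ with relations $a_i^*a_i+a_ia_i^*=1$ ($i=1,2$), $a_1^*a_2=-a_2a_1^*$ (WCAR with two degrees of freedom). $D=\{(r_1,x_1,x_2): 0\le x_i\le\frac12,\ i=1,2,\ 0\le r_1\le1\}\times\mathbf{T}^3$, where $\mathbf{T}=\{z\in\mathbb{C}:|z|=1\}$; points of $D$ are written $(r_1,x_1,x_2,e^{i\phi},e^{i\phi_1},e^{i\phi_2})$. Matrix tensor products are Kronecker products, $A\otimes B=(a_{ij}B)$. *)

(* Defs.v *)
From HB Require Import structures.
From mathcomp Require Import all_boot all_order all_algebra.
From mathcomp Require Import all_classical all_reals all_analysis.
From mathcomp Require Import complex mxtens.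

Set Implicit Arguments.
Unset Strict Implicit.
Unset Printing Implicit Defensive.

Import Order.TTheory GRing.Theory Num.Theory.
Import numFieldNormedType.Exports.

Local Open Scope classical_set_scope.
Local Open Scope ring_scope.
Local Open Scope complex_scope.

(* Unital C*-algebras over the complex numbers R[i], with their own real-valued
   norm: Hierarchy-Builder cannot join MathComp-Analysis' normed modules with
   noncommutative algebras. Algebras are nonzero in MathComp (1 != 0), so the
   zero C*-algebra is not an instance. *)
HB.mixin Record Algebra_isCStar (R : realType) A of GRing.Algebra R[i] A := {
  star : A -> A;
  cnorm : A -> R;
  starK : involutive star;
  starD : {morph star : x y / x + y};
  starZ : forall (c : R[i]) (x : A), star (c *: x) = c^* *: star x;
  starM : forall x y : A, star (x * y) = star y * star x;
  cnorm_eq0 : forall x : A, cnorm x = 0 -> x = 0;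
  cnormD : forall x y : A, cnorm (x + y) <= cnorm x + cnorm y;
  cnormZ : forall (c : R[i]) (x : A),
    cnorm (c *: x) = ComplexField.Normc.normc c * cnorm x;
  cnormM : forall x y : A, cnorm (x * y) <= cnorm x * cnorm y;
  cnorm_star : forall x : A, cnorm (star x * x) = cnorm x ^+ 2;
  cnorm_complete : forall u : nat -> A,
    (forall e : R, 0 < e -> exists N : nat, forall m n : nat,
      (N <= m)%N -> (N <= n)%N -> cnorm (u m - u n) < e) ->
    exists l : A, (fun n => cnorm (u n - l)) @ \oo --> (0 : R)
}.

#[short(type="cstarAlgType")]
HB.structure Definition CStarAlgebra (R : realType) :=
  {A of GRing.Algebra R[i] A & Algebra_isCStar R A}.

Definition wcar_rel (R : realType) (A : cstarAlgType R) (a1 a2 : A) : Prop :=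
  [/\ star a1 * a1 + a1 * star a1 = 1,
      star a2 * a2 + a2 * star a2 = 1
    & star a1 * a2 = - (a2 * star a1)].

(* (E, e1, e2) is the enveloping C*-algebra of the relations: the relations
   hold, and every pair in a C*-algebra B that satisfies them is the image of
   (e1, e2) under exactly one unital *-homomorphism E -> B. Uniqueness makes
   e1, e2 generators of E as a C*-algebra. *)
Definition is_enveloping_wcar (R : realType) (E : cstarAlgType R) (e1 e2 : E) :
    Prop :=
  wcar_rel e1 e2 /\
  forall (B : cstarAlgType R) (b1 b2 : B), wcar_rel b1 b2 ->
    exists f : {lrmorphism E -> B},
      [/\ {morph f : x / star x}, f e1 = b1, f e2 = b2
        & forall g : {lrmorphism E -> B}, {morph g : x / star x} ->
            g e1 = b1 -> g e2 = b2 -> g =1 f].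

(* Points are tuples (r1, x1, x2, w, w1, w2), with w, w1, w2 standing for
   e^{i phi}, e^{i phi_1}, e^{i phi_2}. *)
Definition domD (R : realType) : set (R * R * R * R[i] * R[i] * R[i]) :=
  [set p | let: (r1, x1, x2, w, w1, w2) := p in
    [/\ 0 <= r1 <= 1, 0 <= x1 <= 2^-1 & 0 <= x2 <= 2^-1] /\
    [/\ `|w| = 1, `|w1| = 1 & `|w2| = 1]].

Arguments domD R : clear implicits.

Definition mx2 (K : Type) (a b c d : K) : 'M[K]_2 :=
  \matrix_(i, j) if i == 0 then (if j == 0 then a else b)
                 else (if j == 0 then c else d).

Definition csqrt (R : realType) (x : R) : R[i] := (Num.sqrt x)%:C.

Definition mat_a1 (R : realType) (p : domD R) : 'M[R[i]]_4 :=
  let: (r1, x1, x2, w, w1, w2) := \val p in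
  mx2 0 (w1 * csqrt x1) (csqrt (1 - x1)) 0 *t (1%:M : 'M[R[i]]_2).

(* e^{- i phi_1} is the conjugate of w1. *)
Definition mat_a2 (R : realType) (p : domD R) : 'M[R[i]]_4 :=
  let: (r1, x1, x2, w, w1, w2) := \val p in
  csqrt (1 - r1 ^+ 2) *:
    (mx2 1 0 0 (-1) *t mx2 0 (w2 * csqrt x2) (csqrt (1 - x2)) 0)
  + (r1%:C * w) *:
    (mx2 0 (csqrt (1 - x1)) (- (w1^* * csqrt x1)) 0 *t (1%:M : 'M[R[i]]_2)).

Arguments mat_a1 R p : clear implicits.
Arguments mat_a2 R p : clear implicits.

Definition mxstar (R : realType) (n : nat) (M : 'M[R[i]]_n) : 'M[R[i]]_n :=
  map_mx conjc M^T.

Definition fstar (R : realType) (T : Type) (n : nat) (f : T -> 'M[R[i]]_n) :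
  T -> 'M[R[i]]_n := fun t => mxstar (f t).

(* The *-subalgebras of T -> M_n(C) (pointwise operations) that are closed for
   uniform convergence. Norms on M_n(C) are equivalent, so the entrywise
   uniform structure of the library is that of the operator norm; R[i]^o
   is the name under which it puts a topology on R[i]. *)
Definition cstar_subalgebra (R : realType) (T : choiceType) (n : nat)
    (S : set (T -> 'M[R[i]]_n)) : Prop :=
  [/\ forall (c : R[i]) f g, S f -> S g -> S (c *: f + g),
      forall f g, S f -> S g -> S (f * g),
      forall f, S f -> S (fstar f)
    & closed (S : set {uniform T -> 'M[R[i]^o]_n})].

Definition cstar_generated (R : realType) (T : choiceType) (n : nat)
    (G : set (T -> 'M[R[i]]_n)) : set (T -> 'M[R[i]]_n) :=
  smallest (@cstar_subalgebra R T n) G.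

(* Main.v *)
(* A pair b1, b2 satisfying the relations generates a Clifford algebra over its
   centre: b1^2, b2^2 and b1 b2 + b2 b1 commute with everything (for the squares
   this needs Fuglede's theorem), so every *-polynomial is a combination of 16
   monomials with central coefficients. Given a *-polynomial P, put Q = P^* P
   and take a character chi of a commutative C*-algebra containing Q and the
   central elements, with |chi Q| = |Q|. Then chi Q is an eigenvalue of the
   16 x 16 matrix of right multiplication by Q, with coefficients evaluated at
   chi. Positivity puts the values of chi on the central elements in the region
   parametrized by D; after shrinking them by 1 - eps the Clifford form is
   nondegenerate, the 16 monomials evaluated at the corresponding point of D are
   linearly independent, and eigenvalues of the 16 x 16 matrix are eigenvalues
   of Q at that point. Letting eps tend to 0, |P(b1, b2)| is at most the supremum
   over D of |P(a1, a2)|, and P(a1, a2) |-> P(b1, b2) extends by continuity to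
   the closure: the C*-algebra of matrix functions is the enveloping one. *)
Require Import Defs.
From HB Require Import structures.
From mathcomp Require Import all_boot all_order all_algebra.
From mathcomp Require Import all_classical all_reals all_analysis.
From mathcomp Require Import complex mxtens.
From mathcomp Require Import ring lra.
Import Order.TTheory GRing.Theory Num.Theory.
Import numFieldNormedType.Exports.
Local Open Scope classical_set_scope.
Local Open Scope ring_scope.
Local Open Scope complex_scope.

Set Implicit Arguments.
Unset Strict Implicit.
Unset Printing Implicit Defensive.

(** A character is carried by a seminorm [q] on the whole C*-algebra, not only by a functional on
    the commutative subalgebra: the eigenvector equation relates noncommuting monomials, and [q] has
    to measure them. A minimal seminorm that retains the norm of a chosen self-adjoint element is
    multiplicative on the subalgebra, and an Ostrowski argument then shows that every element of the
    subalgebra is a scalar modulo the kernel of [q]. The same construction proves that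
    *-homomorphisms are contractive, on which uniqueness in the universal property rests.

    The map from D to the values of b1^2, b2^2 and b1 b2 + b2 b1 is inverted one coordinate at a
    time: b1^2 gives x1 and its phase, the anticommutator divided by 1 - 2 x1 gives r1 and its
    phase, and a Schur complement leaves the same half-disc problem for x2. The divisions require x1
    < 1/2 and r1 < 1, and the monomials are shown to be independent where also x2 < 1/2; shrinking
    by 1 - eps provides all three strict inequalities. *)

Local Notation normc := ComplexField.Normc.normc.

(** * C*-algebras and characters *)

Section CStarBasics.
Variables (R : realType) (A : cstarAlgType R).
Implicit Types x y : A.

Lemma normc_real (r : R) : normc r%:C = `|r|.
Proof. by rewrite /normc /= expr0n /= addr0 sqrtr_sqr. Qed.

Lemma normc_ge0 (c : R[i]) : 0 <= normc c.
Proof. by case: c => a b; exact: sqrtr_ge0. Qed.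

Lemma normc_normE (c : R[i]) : `|c| = (normc c)%:C.
Proof. by []. Qed.

Lemma conjcM (c d : R[i]) : conjc (c * d) = conjc c * conjc d.
Proof. exact: rmorphM. Qed.

Lemma conjcD (c d : R[i]) : conjc (c + d) = conjc c + conjc d.
Proof. exact: rmorphD. Qed.

Lemma conjcN (c : R[i]) : conjc (- c) = - conjc c.
Proof. exact: rmorphN. Qed.

Lemma conjci : conjc 'i%C = - 'i%C :> R[i].
Proof. by apply/eqP; rewrite eq_complex /= oppr0 !eqxx. Qed.

Lemma cnorm0 : cnorm (0 : A) = 0.
Proof.
by rewrite -(scale0r (0 : A)) cnormZ ComplexField.Normc.normc0 mul0r.
Qed.

Lemma cnormN x : cnorm (- x) = cnorm x.
Proof.
rewrite -scaleN1r cnormZ.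
have -> : (-1 : R[i]) = (-1)%:C by rewrite rmorphN1.
by rewrite normc_real normrN1 mul1r.
Qed.

Lemma cnormB x y : cnorm (x - y) <= cnorm x + cnorm y.
Proof. by rewrite -(cnormN y) cnormD. Qed.

Lemma cdistC x y : cnorm (x - y) = cnorm (y - x).
Proof. by rewrite -cnormN opprB. Qed.

Lemma cnorm_ge0 x : 0 <= cnorm x.
Proof.
have := cnormB x x; rewrite subrr cnorm0 -mulr2n.
by rewrite pmulrn_lge0.
Qed.

Lemma starZc (c : R[i]) x : star (c *: x) = conjc c *: star x.
Proof. exact: starZ. Qed.

Lemma star1 : star (1 : A) = 1.
Proof. by rewrite -[LHS]mulr1 -{2}[1]starK -starM mulr1 starK. Qed.

Lemma star0 : star (0 : A) = 0.
Proof. by apply: (addrI (star 0)); rewrite -starD !addr0. Qed.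

Lemma starN x : star (- x) = - star x.
Proof. by apply: (addrI (star x)); rewrite -starD !subrr star0. Qed.

Lemma starB x y : star (x - y) = star x - star y.
Proof. by rewrite starD starN. Qed.

Lemma starX x n : star (x ^+ n) = star x ^+ n.
Proof.
elim: n => [|n IH]; first by rewrite !expr0 star1.
by rewrite exprS starM IH -exprSr.
Qed.

Lemma cnorm_neq0 x : x != 0 -> 0 < cnorm x.
Proof.
move=> x0; rewrite lt_neqAle cnorm_ge0 andbT eq_sym.
by apply: contra x0 => /eqP /cnorm_eq0 ->.
Qed.

Lemma cnorm1 : cnorm (1 : A) = 1.
Proof.
have n0 := cnorm_neq0 (oner_neq0 A).
have := cnorm_star (1 : A); rewrite star1 mulr1 expr2 => e.
by apply: (mulfI (lt0r_neq0 n0)); rewrite mulr1 -e.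
Qed.

Lemma cnormS x : cnorm (star x) = cnorm x.
Proof.
have le y : cnorm y <= cnorm (star y).
  have [->|y0] := eqVneq y 0; first by rewrite star0.
  have := cnormM (star y) y; rewrite cnorm_star expr2.
  by rewrite ler_pM2r // cnorm_neq0.
by apply/eqP; rewrite eq_le le -{2}(starK x) le.
Qed.

Lemma cnormX x n : cnorm (x ^+ n) <= cnorm x ^+ n.
Proof.
elim: n => [|n IH]; first by rewrite !expr0 cnorm1.
by rewrite !exprS (le_trans (cnormM _ _)) // ler_wpM2l ?cnorm_ge0.
Qed.

End CStarBasics.

(** * Minimal seminorms and characters *)

Section Fibers.
Variables (R : realType) (A : cstarAlgType R) (S : set A).
Implicit Types (x y : A) (q : A -> R).

Record comm_star_subalg : Prop := CommStarSubalg {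
  css1 : S 1;
  cssD : forall x y, S x -> S y -> S (x + y);
  cssZ : forall (c : R[i]) x, S x -> S (c *: x);
  cssM : forall x y, S x -> S y -> S (x * y);
  cssS : forall x, S x -> S (star x);
  cssC : forall x y, S x -> S y -> x * y = y * x
}.

(** The laws of a quotient norm modulo a left ideal: left multiplication is bounded by the norm of
    [A], while nothing is asked of right multiplication. *)
Record lseminorm q : Prop := LSeminorm {
  lsnD : forall x y, q (x + y) <= q x + q y;
  lsnZ : forall (c : R[i]) x, q (c *: x) = normc c * q x;
  lsnM : forall x y, q (x * y) <= cnorm x * q y;
  lsn1 : q 1 = 1
}.

(* [q] restricts to a C*-seminorm on the commutative algebra [S], and turns
   [A] modulo its kernel into a left module on which [S] acts on the right. *)
Record cfiber q : Prop := CFiber {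
  cf_lsn : lseminorm q;
  cfM : forall x s, S s -> q (x * s) <= q x * q s;
  cf_star : forall x, S (star x * x) -> q (star x * x) = q x ^+ 2
}.

(** At x = 1 this says that [q] keeps the norm of [w]. The form with all x is the one that passes to
    infima and localizations. *)
Definition peaks_at w q := forall x, q (x * w) = cnorm w * q x.

Section LSeminormTheory.
Variables (q : A -> R) (hq : lseminorm q).

Lemma lsn0 : q 0 = 0.
Proof.
by rewrite -(scale0r (0 : A)) (lsnZ hq) ComplexField.Normc.normc0 mul0r.
Qed.

Lemma lsnN x : q (- x) = q x.
Proof.
rewrite -scaleN1r (lsnZ hq).
have -> : (-1 : R[i]) = (-1)%:C by rewrite rmorphN1.
by rewrite normc_real normrN1 mul1r.
Qed.

Lemma lsnB x y : q (x - y) <= q x + q y.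
Proof. by rewrite -(lsnN y) (lsnD hq). Qed.

Lemma lsn_ge0 x : 0 <= q x.
Proof. by have := lsnB x x; rewrite subrr lsn0 -mulr2n pmulrn_lge0. Qed.

Lemma lsn_scal (c : R[i]) : q c%:A = normc c.
Proof. by rewrite (lsnZ hq) (lsn1 hq) mulr1. Qed.

End LSeminormTheory.

Section InfFiber.
Variable F : set (A -> R).
Hypothesis F0 : F !=set0.
Hypothesis F_lsn : forall q, F q -> lseminorm q.
Hypothesis F_dir : forall q1 q2, F q1 -> F q2 ->
  exists q3, [/\ F q3, forall x, q3 x <= q1 x & forall x, q3 x <= q2 x].

(** Serves two families: the decreasing sequence that defines a localization, and a chain in Zorn's
    lemma. Directedness allows a product of two infima to be estimated on a single member. *)
Definition inf_fiber x : R := inf [set q x | q in F].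

Lemma inf_fiber_le q x : F q -> inf_fiber x <= q x.
Proof.
move=> Fq; apply: ge_inf; last by exists q.
by exists 0 => _ [q' Fq' <-]; exact: lsn_ge0 (F_lsn Fq') _.
Qed.

Lemma inf_fiber_ge (k a : R) x : 0 <= k ->
  (forall q, F q -> a <= k * q x) -> a <= k * inf_fiber x.
Proof.
rewrite le_eqVlt => /predU1P[<-|k0] h.
  by case: F0 => q Fq; have := h _ Fq; rewrite !mul0r.
rewrite -ler_pdivrMl //; apply: lb_le_inf.
  by case: F0 => q Fq; exists (q x), q.
by move=> _ [q Fq <-]; rewrite ler_pdivrMl // h.
Qed.

Lemma inf_fiber_ge1 (a : R) x :
  (forall q, F q -> a <= q x) -> a <= inf_fiber x.
Proof.
move=> h; rewrite -[leRHS]mul1r; apply: inf_fiber_ge => // q Fq.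
by rewrite mul1r h.
Qed.

Lemma inf_fiber_ge0 x : 0 <= inf_fiber x.
Proof. by apply: inf_fiber_ge1 => q /F_lsn /lsn_ge0. Qed.

Lemma inf_fiber_geM (a : R) x y :
  (forall q, F q -> a <= q x * q y) -> a <= inf_fiber x * inf_fiber y.
Proof.
move=> h; apply: inf_fiber_ge; first exact: inf_fiber_ge0.
move=> q1 F1; rewrite mulrC; apply: inf_fiber_ge.
  exact: lsn_ge0 (F_lsn F1) _.
move=> q2 F2; have [q3 [F3 le1 le2]] := F_dir F1 F2.
have q30 z : 0 <= q3 z by exact: lsn_ge0 (F_lsn F3) _.
by rewrite mulrC; apply: le_trans (h _ F3) _; apply: ler_pM.
Qed.

Lemma inf_fiber_lsn : lseminorm inf_fiber.
Proof.
split.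
- move=> x y; rewrite -lerBlDr; apply: inf_fiber_ge1 => q1 F1.
  rewrite lerBlDr -lerBlDl; apply: inf_fiber_ge1 => q2 F2.
  rewrite lerBlDl; have [q3 [F3 le1 le2]] := F_dir F1 F2.
  apply: le_trans (inf_fiber_le _ F3) _.
  by apply: le_trans (lsnD (F_lsn F3) _ _) _; exact: lerD.
- have le c x : inf_fiber (c *: x) <= normc c * inf_fiber x.
    apply: inf_fiber_ge; first exact: normc_ge0.
    by move=> q Fq; rewrite -(lsnZ (F_lsn Fq)) inf_fiber_le.
  move=> c x; apply/eqP; rewrite eq_le le /=.
  have [->|c0] := eqVneq c 0.
    by rewrite ComplexField.Normc.normc0 mul0r inf_fiber_ge0.
  have := le c^-1 (c *: x); rewrite scalerA mulVf // scale1r.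
  rewrite ComplexField.Normc.normcV ler_pdivlMl // lt_neqAle normc_ge0 andbT.
  by rewrite eq_sym; apply: contra c0 => /eqP/ComplexField.Normc.eq0_normc->.
- move=> x y; apply: inf_fiber_ge; first exact: cnorm_ge0.
  move=> q Fq; apply: le_trans (inf_fiber_le _ Fq) _.
  exact: lsnM (F_lsn Fq) _ _.
- case: F0 => q Fq; apply/eqP; rewrite eq_le; apply/andP; split.
    by apply: le_trans (inf_fiber_le 1 Fq) _; rewrite (lsn1 (F_lsn Fq)).
  by apply: inf_fiber_ge1 => q' /F_lsn /lsn1 ->.
Qed.

(** The members of [F] need not be fibers: each law may hold only after passing to another member,
    as for localizations, where a product bounded by two terms of index n is controlled at index n +
    n. *)
Lemma inf_fiber_cfiber :
  (forall q x s, F q -> S s ->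
     exists2 q', F q' & q' (x * s) <= q x * q s) ->
  (forall q x, F q -> S (star x * x) ->
     exists2 q', F q' & q' (star x * x) <= q x ^+ 2) ->
  (forall q x, F q -> S (star x * x) ->
     exists2 q', F q' & q' x ^+ 2 <= q (star x * x)) ->
  cfiber inf_fiber.
Proof.
move=> hM hS1 hS2; split; first exact: inf_fiber_lsn.
  move=> x s Ss; apply: inf_fiber_geM => q Fq.
  have [q' Fq' le] := hM _ x _ Fq Ss.
  exact: le_trans (inf_fiber_le _ Fq') le.
move=> x Sx; apply/eqP; rewrite eq_le; apply/andP; split.
  rewrite expr2; apply: inf_fiber_geM => q Fq.
  have [q' Fq' le] := hS1 _ _ Fq Sx.
  exact: le_trans (inf_fiber_le _ Fq') le.
apply: inf_fiber_ge1 => q Fq; have [q' Fq' le] := hS2 _ _ Fq Sx.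
apply: le_trans le; rewrite ler_sqr ?nnegrE ?inf_fiber_ge0 //.
  exact: inf_fiber_le.
exact: lsn_ge0 (F_lsn Fq') _.
Qed.

Lemma inf_fiber_peaks w : (forall q, F q -> peaks_at w q) ->
  peaks_at w inf_fiber.
Proof.
move=> h x; apply/eqP; rewrite eq_le; apply/andP; split.
  apply: inf_fiber_ge; first exact: cnorm_ge0.
  by move=> q Fq; rewrite -(h _ Fq) inf_fiber_le.
apply: inf_fiber_ge1 => q Fq; rewrite (h _ Fq).
by rewrite ler_wpM2l ?cnorm_ge0 ?inf_fiber_le.
Qed.

End InfFiber.

Hypothesis Scss : comm_star_subalg.

Lemma cssX x n : S x -> S (x ^+ n).
Proof.
move=> Sx; elim: n => [|n IH]; first by rewrite expr0; exact: css1.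
by rewrite exprS; exact: cssM.
Qed.

Lemma cnorm_cfiber : cfiber (@cnorm R A).
Proof.
split; last by move=> x _; exact: cnorm_star.
  by split; [exact: cnormD|exact: cnormZ|exact: cnormM|exact: cnorm1].
by move=> x s _; exact: cnormM.
Qed.

Section Localization.
Variables (q : A -> R) (g : A).
Hypotheses (hq : cfiber q) (Sg : S g) (gS : star g = g) (qg0 : 0 < q g).

(** Localization at [g]. The terms decrease with n because q (g ^+ m) = q g ^+ m, and shifting n by
    one shows that right multiplication by [g] scales the limit by exactly [q g]. *)
Definition loc_term n x := q (x * g ^+ n) / q g ^+ n.
Definition loc := inf_fiber [set loc_term n | n in setT].

Lemma cfX_le n : q (g ^+ n) <= q g ^+ n.
Proof.
elim: n => [|n IH]; first by rewrite !expr0 (lsn1 (cf_lsn hq)).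
rewrite !exprSr (le_trans (cfM hq _ Sg)) // ler_wpM2r //.
exact: ltW.
Qed.

(** The C*-identity for the self-adjoint [g] gives the exponents 2 ^ n; submultiplicativity carries
    the equality down to n <= 2 ^ n. *)
Lemma cfX n : q (g ^+ n) = q g ^+ n.
Proof.
have pow2 k : q (g ^+ (2 ^ k)) = q g ^+ (2 ^ k).
  elim: k => [|k IH]; first by rewrite expn0 !expr1.
  have e : g ^+ (2 ^ k.+1) = star (g ^+ (2 ^ k)) * g ^+ (2 ^ k).
    by rewrite starX gS -exprD addnn -mul2n expnS.
  rewrite e (cf_star hq) -?e; last exact: cssX.
  by rewrite IH -exprM mulnC expnS.
apply/eqP; rewrite eq_le cfX_le /=.
have nk : (n <= 2 ^ n)%N by exact/ltnW/ltn_expl.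
rewrite -(ler_pM2r (exprn_gt0 (2 ^ n - n)%N qg0)) -exprD subnKC //.
rewrite -pow2 -{1}(subnKC nk) exprD.
apply: le_trans (cfM hq _ (cssX _ Sg)) _.
by rewrite ler_wpM2l ?cfX_le // (lsn_ge0 (cf_lsn hq)).
Qed.

Lemma loc_term_lsn n : lseminorm (loc_term n).
Proof.
have qn0 : 0 < q g ^+ n by exact: exprn_gt0.
split; rewrite /loc_term.
- move=> x y; rewrite -mulrDl ler_pM2r ?invr_gt0 // mulrDl.
  exact: lsnD (cf_lsn hq) _ _.
- by move=> c x; rewrite -scalerAl (lsnZ (cf_lsn hq)) mulrA.
- move=> x y; rewrite mulrA ler_pM2r ?invr_gt0 // -mulrA.
  exact: lsnM (cf_lsn hq) _ _.
- by rewrite mul1r cfX divff // lt0r_neq0.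
Qed.

Lemma loc_term_le n m x : loc_term (n + m) x <= loc_term n x.
Proof.
rewrite /loc_term ler_pdivrMr ?exprn_gt0 // (exprD (q g)) mulrA.
rewrite divfK ?lt0r_neq0 ?exprn_gt0 // exprD mulrA.
apply: le_trans (cfM hq _ (cssX _ Sg)) _.
by rewrite ler_wpM2l ?cfX_le // (lsn_ge0 (cf_lsn hq)).
Qed.

Let F : set (A -> R) := [set loc_term n | n in setT].

Let F0 : F !=set0. Proof. by exists (loc_term 0), 0. Qed.

Let F_lsn p : F p -> lseminorm p.
Proof. by case=> n _ <-; exact: loc_term_lsn. Qed.

Let F_dir p1 p2 : F p1 -> F p2 ->
  exists p3, [/\ F p3, forall x, p3 x <= p1 x & forall x, p3 x <= p2 x].
Proof.
move=> [n _ <-] [m _ <-]; exists (loc_term (n + m)); split.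
- by exists (n + m)%N.
- exact: loc_term_le.
- by move=> x; rewrite addnC loc_term_le.
Qed.

Lemma loc_le x : loc x <= q x.
Proof.
have -> : q x = loc_term 0 x by rewrite /loc_term !expr0 mulr1 divr1.
by apply: inf_fiber_le => //; exists 0.
Qed.

Lemma loc_square n x : S (star x * x) ->
  loc_term n x ^+ 2 = loc_term (n + n) (star x * x).
Proof.
move=> Sx; rewrite /loc_term expr_div_n -exprM muln2 -addnn; congr (_ / _).
have e : star x * x * g ^+ (n + n) = star (x * g ^+ n) * (x * g ^+ n).
  rewrite starM starX gS exprD !mulrA; congr (_ * _).
  by rewrite -!mulrA mulrA; apply: cssC => //; exact: cssX.
rewrite e (cf_star hq) // -e; apply: cssM => //; exact: cssX.
Qed.

Lemma loc_cfiber : cfiber loc.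
Proof.
apply: inf_fiber_cfiber => //.
- move=> _ x s [n _ <-] Ss; exists (loc_term (n + n)); first by exists (n + n)%N.
  rewrite /loc_term mulrACA -invfM -exprD ler_pM2r ?invr_gt0 ?exprn_gt0 //.
  have -> : x * s * g ^+ (n + n) = x * g ^+ n * (s * g ^+ n).
    rewrite exprD -!mulrA; congr (_ * _); rewrite !mulrA; congr (_ * _).
    by apply: cssC => //; exact: cssX.
  by apply: cfM => //; apply: cssM => //; exact: cssX.
- move=> _ x [n _ <-] Sx; exists (loc_term (n + n)); first by exists (n + n)%N.
  by rewrite loc_square.
- move=> _ x [n _ <-] Sx; exists (loc_term n); first by exists n.
  by rewrite loc_square // loc_term_le.
Qed.

Lemma loc_mul x : loc (x * g) = q g * loc x.
Proof.
have e n : loc_term n (x * g) = q g * loc_term n.+1 x.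
  rewrite /loc_term -mulrA -exprS [q g ^+ n.+1]exprS invfM mulrCA; congr (_ * _).
  by rewrite mulrA divff ?mul1r // lt0r_neq0.
apply/eqP; rewrite eq_le; apply/andP; split.
  apply: inf_fiber_ge => //; first exact: ltW.
  move=> _ [n _ <-]; apply: (@le_trans _ _ (loc_term n (x * g))).
    by apply: inf_fiber_le => //; exists n.
  by rewrite e ler_wpM2l ?(ltW qg0) // -addn1 loc_term_le.
apply: inf_fiber_ge1 => // _ [n _ <-]; rewrite e ler_wpM2l ?(ltW qg0) //.
by apply: inf_fiber_le => //; exists n.+1.
Qed.

Lemma loc_peaks w : S w -> peaks_at w q -> peaks_at w loc.
Proof.
move=> Sw qw; apply: inf_fiber_peaks => // _ [n _ <-] x.
rewrite /loc_term -mulrA (cssC Scss Sw (cssX _ Sg)) mulrA qw mulrA.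
by [].
Qed.

End Localization.

Lemma exists_peak w : S w -> star w = w -> exists2 q, cfiber q & peaks_at w q.
Proof.
move=> Sw wS; have [w0|w0] := eqVneq w 0.
  exists (@cnorm R A); first exact: cnorm_cfiber.
  by move=> x; rewrite w0 mulr0 cnorm0 mul0r.
have w1 := cnorm_neq0 w0.
exists (loc (@cnorm R A) w); first exact: loc_cfiber cnorm_cfiber Sw wS w1.
exact: loc_mul cnorm_cfiber Sw wS w1.
Qed.

(** Among the fibers that peak at [w], Zorn's lemma gives a minimal one. Localizing it at a
    self-adjoint [g] gives a smaller such fiber, hence the same one, and a localized seminorm is
    multiplicative in [g]. *)
Lemma exists_multiplicative_peak w : S w -> star w = w ->
  exists q, [/\ cfiber q, peaks_at w q &
    forall g x, S g -> star g = g -> q (x * g) = q x * q g].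
Proof.
move=> Sw wS; have [q0 q0f q0w] := exists_peak Sw wS.
pose T := {q : A -> R | cfiber q /\ peaks_at w q}.
pose mkT q (h1 : cfiber q) (h2 : peaks_at w q) : T :=
  exist (fun q => cfiber q /\ peaks_at w q) q (conj h1 h2).
(* The order is reversed, so that a maximal element is a minimal seminorm. *)
pose le (q1 q2 : T) : bool := `[< forall x, sval q2 x <= sval q1 x >].
have [||C Ctot|[q [qf qw]] qmin] := @ZL_preorder T (mkT _ q0f q0w) le.
- by move=> t; apply/asboolP => x.
- move=> r s t /asboolP sr /asboolP rt; apply/asboolP => x.
  exact: le_trans (rt x) (sr x).
- have [[c Cc]|C0] := pselect (C !=set0); last first.
    exists (mkT _ q0f q0w) => s Cs.
    by exfalso; apply: C0; exists s.
  pose F := [set sval t | t in C].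
  have F0 : F !=set0 by exists (sval c), c.
  have Fl p : F p -> lseminorm p by case=> t _ <-; exact: cf_lsn (svalP t).1.
  have Fd p1 p2 : F p1 -> F p2 ->
      exists p3, [/\ F p3, forall x, p3 x <= p1 x & forall x, p3 x <= p2 x].
    move=> [t1 C1 <-] [t2 C2 <-]; have [] := Ctot _ _ C1 C2.
      by move=> /asboolP h; exists (sval t2); split=> [|x|x]; [exists t2|exact: h|exact: lexx].
    by move=> /asboolP h; exists (sval t1); split=> [|x|x]; [exists t1|exact: lexx|exact: h].
  have pf : cfiber (inf_fiber F).
    apply: inf_fiber_cfiber => //.
    + move=> _ x s [t Ct <-] Ss; exists (sval t); first by exists t.
      exact: cfM (svalP t).1 _ _ Ss.
    + move=> _ x [t Ct <-] Sx; exists (sval t); first by exists t.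
      by rewrite (cf_star (svalP t).1).
    + move=> _ x [t Ct <-] Sx; exists (sval t); first by exists t.
      by rewrite (cf_star (svalP t).1).
  have pw : peaks_at w (inf_fiber F).
    by apply: (inf_fiber_peaks F0 Fl) => _ [t _ <-]; case: (svalP t).
  exists (mkT _ pf pw) => s Cs; apply/asboolP => x /=.
  by apply: (@inf_fiber_le F Fl); exists s.
exists q; split=> // g x Sg gS.
have q0' y : 0 <= q y by exact: lsn_ge0 (cf_lsn qf) y.
have [qg0|] := ltrP 0 (q g); last first.
  rewrite le_eqVlt ltNge q0' orbF => /eqP e.
  apply/eqP; rewrite eq_le (cfM qf) // e mulr0 q0' //.
have lf := loc_cfiber qf Sg gS qg0.
have lw := loc_peaks qf Sg gS qg0 Sw qw.
have hle : le (exist _ q (conj qf qw)) (mkT _ lf lw).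
  by apply/asboolP => y /=; exact: loc_le.
have h : forall x, q x <= loc q g x by exact/asboolP/(qmin _ hle).
have e y : loc q g y = q y.
  by apply/eqP; rewrite eq_le h andbT; exact: loc_le.
by rewrite -[LHS]e loc_mul // e mulrC.
Qed.

Lemma subr_sqr_scal y (a : R[i]) :
  y * y - (a * a)%:A = (y - a%:A) * (y - (- a)%:A).
Proof.
rewrite scaleNr opprK mulrDr !mulrBl !mulr_algl mulr_algr scalerA.
by rewrite addrA subrK.
Qed.

Section MultiplicativeFiber.
Variable q : A -> R.
Hypotheses (hq : cfiber q)
  (qM : forall g x, S g -> star g = g -> q (x * g) = q x * q g).
Let hl := cf_lsn hq.

(** The self-adjoint elements s* s and t* t are already covered by [qM]; the C*-identity then takes
    the square root. *)
Lemma mfM s t : S s -> S t -> q (s * t) = q s * q t.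
Proof.
move=> Ss St; have SsS := cssS Scss Ss; have StS := cssS Scss St.
have e : star (s * t) * (s * t) = star s * s * (star t * t).
  rewrite starM -!mulrA (cssC Scss StS); last by do !apply: cssM.
  by rewrite -!mulrA (cssC Scss StS St).
have Sss : S (star s * s) by exact: cssM.
have Stt : S (star t * t) by exact: cssM.
have := cf_star hq (x := s * t); rewrite e => /(_ (cssM Scss Sss Stt)).
rewrite qM ?starM ?starK // !(cf_star hq) // -exprMn => /eqP.
by rewrite eqrXn2 ?mulr_ge0 ?(lsn_ge0 hl) // => /eqP.
Qed.

Lemma mf_star s : S s -> q (star s) = q s.
Proof.
move=> Ss; have SsS := cssS Scss Ss; apply/eqP.
rewrite -(eqrXn2 (n := 2)) ?(lsn_ge0 hl) //.
rewrite -!(cf_star hq) ?starK ?(cssC Scss SsS Ss) //; last exact: cssM.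
by rewrite -(cssC Scss SsS Ss); exact: cssM.
Qed.

Lemma mfX s n : S s -> q (s ^+ n) = q s ^+ n.
Proof.
move=> Ss; elim: n => [|n IH]; first by rewrite !expr0 (lsn1 hl).
by rewrite !exprS mfM ?IH //; exact: cssX.
Qed.

Lemma cssB x y : S x -> S y -> S (x - y).
Proof. by move=> Sx Sy; rewrite -scaleN1r; apply: cssD => //; exact: cssZ. Qed.

Lemma css_scal (c : R[i]) : S c%:A.
Proof. by apply: cssZ => //; exact: css1. Qed.

(* The polynomial [h^(2^k) - (m/2)^(2^k)] is a product of factors [h - c], each
   of seminorm at least [m], one of which is [h - m/2]. *)
Lemma mf_half h (m : R) : S h -> star h = h -> 0 < m -> q h = m ->
  (forall t : R, m <= q (h - t%:C%:A)) -> q (h - (m / 2)%:C%:A) = m.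
Proof.
move=> Sh hS m0 qh hm; apply/eqP; rewrite eq_le hm andbT.
have hmc (c : R[i]) : m <= q (h - c%:A).
  have Sx : S (h - c%:A) by apply: cssB => //; exact: css_scal.
  apply: le_trans (hm (complex.Re c)) _.
  (* The self-adjoint part of h - c is h minus the real part of c, and averaging with the star does
     not increase [q]. *)
  have e : (h - c%:A) + star (h - c%:A) = (2 : R)%:C *: (h - (complex.Re c)%:C%:A).
    rewrite starB starZc star1 hS addrACA -opprD -scalerDl addcJ scalerBr.
    by rewrite scalerA rmorph_nat scaler_nat mulr2n.
  have := lsnD hl (h - c%:A) (star (h - c%:A)).
  rewrite e (lsnZ hl) normc_real ger0_norm // mf_star // -mulr2n -[leRHS]mulr_natl.
  by rewrite ler_pM2l.
have hmk k (c : R[i]) : m ^+ (2 ^ k) <= q (h ^+ (2 ^ k) - c%:A).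
  elim: k c => [|k IH] c; first by rewrite expn0 !expr1.
  have -> : h ^+ (2 ^ k.+1) - c%:A =
      (h ^+ (2 ^ k) - (sqrtc c)%:A) * (h ^+ (2 ^ k) - (- sqrtc c)%:A).
    by rewrite -subr_sqr_scal -[sqrtc c * _]expr2 sqr_sqrtc -exprD addnn -mul2n expnS.
  rewrite mfM; [|apply: cssB; [exact: cssX|exact: css_scal]..].
  by rewrite expnS mul2n -addnn exprD ler_pM ?exprn_ge0 ?(ltW m0).
pose u : R[i] := (m / 2)%:C.
have hk k : q (h - u%:A) * m ^+ (2 ^ k) <= m * q (h ^+ (2 ^ k) - (u ^+ (2 ^ k))%:A).
  elim: k => [|k IH]; first by rewrite expn0 !expr1 mulrC.
  have -> : h ^+ (2 ^ k.+1) - (u ^+ (2 ^ k.+1))%:A =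
      (h ^+ (2 ^ k) - (u ^+ (2 ^ k))%:A) * (h ^+ (2 ^ k) - (- u ^+ (2 ^ k))%:A).
    by rewrite -subr_sqr_scal -!exprD addnn -mul2n expnS.
  rewrite mfM; [|apply: cssB; [exact: cssX|exact: css_scal]..].
  rewrite expnS mul2n -addnn exprD !mulrA.
  by apply: ler_pM; rewrite ?mulr_ge0 ?exprn_ge0 ?(lsn_ge0 hl) ?(ltW m0).
have m20 : 0 <= m / 2 by rewrite divr_ge0 ?(ltW m0).
have hb k : q (h - u%:A) <= m * (1 + 2^-1 ^+ k).
  have mk : 0 < m ^+ (2 ^ k) by exact: exprn_gt0.
  rewrite -(ler_pM2r mk); apply: le_trans (hk k) _.
  rewrite -mulrA ler_pM2l //.
  apply: le_trans (lsnB hl _ _) _; rewrite (lsn_scal hl) mfX // qh mulrDl mul1r.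
  rewrite lerD2l -rmorphXn normc_real ger0_norm ?exprn_ge0 // exprMn mulrC.
  rewrite ler_pM2r // ler_wiXn2l ?invr_ge0 ?invf_le1 ?ler1n //.
  exact/ltnW/ltn_expl.
apply/ler_addgt0Pr => e e0.
have [k ke] : exists k, m * 2^-1 ^+ k < e.
  have := @cvg_geometric R m 2^-1.
  rewrite ger0_norm ?invr_ge0 // invf_lt1 // ltr1n => /(_ isT).
  move=> /cvgrPdist_lt /(_ _ e0) [k _ /(_ k (leqnn k))] /=.
  by rewrite sub0r normrN ger0_norm ?mulr_ge0 ?exprn_ge0 ?invr_ge0 ?(ltW m0) // => ?; exists k.
by apply: le_trans (hb k) _; rewrite mulrDr mulr1 lerD2l ltW.
Qed.

(* Ostrowski's argument: if the distance [m] from [h] to the scalars were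
   positive, it would also be attained along an unbounded set of scalars. *)
Lemma mf_selfadj h : S h -> star h = h -> exists l : R, q (h - l%:C%:A) = 0.
Proof.
move=> Sh hS; pose f (t : R) := q (h - t%:C%:A).
have lip a b : f a <= f b + `|b - a|.
  rewrite -normc_real -(lsn_scal hl) /f; apply: le_trans (lsnD hl _ _).
  by rewrite rmorphB scalerBl addrA subrK.
have far t s : `|s| <= f t + f (t + s).
  rewrite -normc_real -(lsn_scal hl) /f; apply: le_trans (lsnB hl _ _).
  by rewrite opprB addrC addrA subrK rmorphD scalerDl addrAC subrr add0r.
have Sf t : S (h - t%:C%:A) by apply: cssB => //; exact: css_scal.
have fS t : star (h - t%:C%:A) = h - t%:C%:A.
  by rewrite starB starZc star1 conjc_real hS.
have fc : continuous f.
  move=> x; apply/cvgrPdist_lt => e e0.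
  apply: filterS ((@cvgrPdist_lt _ _ _ _ _ id x).1 cvg_id e e0) => y /=.
  apply: le_lt_trans.
  by rewrite ler_norml lerNl opprB !lerBlDl [`|x - y|]distrC lip distrC lip.
pose K := 2 * q h.
have qh0 : 0 <= q h by exact: lsn_ge0.
have K0 : 0 <= K by exact: mulr_ge0.
have KK : - K <= K by apply: (le_trans _ K0); rewrite oppr_le0.
have [c _ cmin] := EVT_min KK (@continuous_subspaceT _ _ _ _ fc).
have cmin2 t : f c <= f t.
  have [tK|] := boolP (t \in `[- K, K]%R); first exact: cmin.
  rewrite in_itv /= -ler_norml -ltNge => Kt.
  have f0 : f 0 = q h by rewrite /f scale0r subr0.
  have c0 : f c <= f 0 by apply: cmin; rewrite in_itv /= -ler_norml normr0 mulr_ge0.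
  apply: le_trans c0 _; rewrite f0 -(lerD2l (q h)) -mulr2n -mulr_natl.
  by apply: le_trans (ltW Kt) _; have := far 0 t; rewrite f0 add0r.
exists c; apply/eqP; apply: contraT => fc0.
have m0 : 0 < f c by rewrite lt_neqAle eq_sym fc0 (lsn_ge0 hl).
have fj j : f (c + j%:R * (f c / 2)) = f c.
  elim: j => [|j IH]; first by rewrite mul0r addr0.
  have e t u : f (t + u) = q (h - t%:C%:A - u%:C%:A).
    by rewrite /f rmorphD scalerDl opprD addrA.
  rewrite -natr1 mulrDl mul1r addrA e.
  by apply: mf_half => // t; rewrite -e.
(* Five steps of length f c / 2 reach a scalar 5/2 f c away, yet two scalars at distance f c from
   [h] are at most 2 f c apart. *)
have := far c (5%:R * (f c / 2)); by rewrite fj ger0_norm; lra.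
Qed.

Lemma mf_character s : S s -> exists c : R[i], q (s - c%:A) = 0.
Proof.
move=> Ss; have SsS := cssS Scss Ss.
have two : (2 : R[i]) != 0 by rewrite pnatr_eq0.
pose a := 2^-1 *: (s + star s); pose b := (2^-1 * - 'i%C) *: (s - star s).
have e : s = a + 'i%C *: b.
  rewrite /a /b scalerA mulrCA mulrN -expr2 sqr_i opprK mulr1 -scalerDr.
  by rewrite addrACA subrr addr0 -mulr2n -[s *+ 2]scaler_nat scalerA mulVf ?scale1r.
have cj2 : conjc (2^-1 : R[i]) = 2^-1 by rewrite conjc_inv conjc_nat.
have Sa : S a by apply: cssZ => //; exact: cssD.
have Sb : S b by apply: cssZ => //; exact: cssB.
have aS : star a = a by rewrite starZc starD starK addrC cj2.
have bS : star b = b.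
  rewrite starZc starB starK conjcM conjcN cj2 conjci opprK.
  by rewrite -opprB scalerN -scaleNr -mulrN.
have [a0 ha] := mf_selfadj Sa aS; have [b0 hb] := mf_selfadj Sb bS.
exists (a0%:C + 'i%C * b0%:C); apply/eqP; rewrite eq_le (lsn_ge0 hl) andbT.
rewrite {1}e scalerDl opprD addrACA -scalerA -scalerBr.
by apply: le_trans (lsnD hl _ _) _; rewrite ha (lsnZ hl) hb mulr0 addr0.
Qed.

End MultiplicativeFiber.

Lemma cf_scal_unique q s (c d : R[i]) : cfiber q ->
  q (s - c%:A) = 0 -> q (s - d%:A) = 0 -> c = d.
Proof.
move=> /cf_lsn hl sc sd.
apply/eqP; rewrite -subr_eq0; apply/eqP/ComplexField.Normc.eq0_normc/eqP.
rewrite eq_le normc_ge0 andbT -(lsn_scal hl).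
have -> : (c - d)%:A = (s - d%:A) - (s - c%:A).
  by rewrite scalerBl opprB [RHS]addrC addrA subrK.
by apply: le_trans (lsnB hl _ _) _; rewrite sc sd addr0.
Qed.

(** Here [v] may lie outside [S]; this is why [cf_star] ranges over all x with x* x in [S]. If r = -
    s^2 < 0, then v - i s and v + i s both have x* x = v^2 - r, so [q] kills both and [v] would
    equal two different scalars. *)
Lemma cf_sqr_ge0 q v (r : R) : cfiber q -> star v = v -> S (v * v) ->
  q (v * v - r%:C%:A) = 0 -> 0 <= r.
Proof.
move=> hq vS Svv qv; have hl := cf_lsn hq; rewrite leNgt; apply/negP => r0.
pose s := Num.sqrt (- r).
have ss : s * s = - r by rewrite -expr2 sqr_sqrtr // oppr_ge0 ltW.
have s0 : 0 < s by rewrite sqrtr_gt0 oppr_gt0.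
have qi (u : R) : u * u = - r -> q (v - (0 +i* u)%:A) = 0.
  move=> uu; set x := v - _.
  have xx : star x * x = v * v - r%:C%:A.
    have -> : star x = v - (- (0 +i* u))%:A.
      rewrite /x starB starZc vS star1; congr (_ - _ *: _).
      by apply/eqP; rewrite eq_complex /= oppr0 !eqxx.
    have -> : r%:C = (0 +i* u) * (0 +i* u).
      by apply/eqP; rewrite eq_complex /= !mul0r !mulr0 uu addr0 sub0r opprK !eqxx.
    by rewrite -[(0 +i* u) * _]mulrNN subr_sqr_scal opprK.
  have Sx : S (star x * x) by rewrite xx; apply: cssB => //; exact: css_scal.
  by have := cf_star hq Sx; rewrite xx qv => /esym/eqP; rewrite sqrf_eq0 => /eqP.
have := cf_scal_unique hq (qi _ ss) (qi (- s) _); rewrite mulrNN => /(_ ss).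
by move=> [] sN; move: s0; lra.
Qed.

Theorem exists_character w : S w -> star w = w ->
  exists q (chi : A -> R[i]), [/\ cfiber q,
    forall s, S s -> q (s - (chi s)%:A) = 0 & normc (chi w) = cnorm w].
Proof.
move=> Sw wS; have [q [hq qw qM]] := exists_multiplicative_peak Sw wS.
have hl := cf_lsn hq.
have [|chi hchi] := @choice _ _ (fun s c => S s -> q (s - c%:A) = 0).
  move=> s; have [Ss|nSs] := pselect (S s); last by exists 0.
  by have [c qc] := mf_character hq qM Ss; exists c.
exists q, chi; split=> //.
have <- : q w = cnorm w by have := qw 1; rewrite mul1r (lsn1 hl) mulr1.
rewrite -(lsn_scal hl); apply/eqP; rewrite eq_le; apply/andP; split.
  rewrite -{1}(subKr w (chi w)%:A); apply: le_trans (lsnB hl _ _) _.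
  by rewrite hchi // addr0.
rewrite -{1}(subrK (chi w)%:A w); apply: le_trans (lsnD hl _ _) _.
by rewrite hchi // add0r.
Qed.

Lemma cf_kerM q x s : cfiber q -> S s -> q s = 0 -> q (x * s) = 0.
Proof.
move=> hq Ss s0; apply/eqP; rewrite eq_le (lsn_ge0 (cf_lsn hq)) andbT.
by apply: le_trans (cfM hq _ Ss) _; rewrite s0 mulr0.
Qed.

End Fibers.

Section DoubleCommutant.
Variables (R : realType) (A : cstarAlgType R) (T : set A).

(** A commuting star-closed set lies in its own commutant, so its bicommutant is a commutative
    star-subalgebra. This gives one containing [T] without describing the algebra that [T]
    generates. *)
Definition bicommutant : set A :=
  [set x | forall y, (forall u, T u -> u * y = y * u) -> x * y = y * x].

Lemma sub_bicommutant : T `<=` bicommutant.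
Proof. by move=> x Tx y; exact. Qed.

Lemma bicommutant_css :
  (forall x, T x -> T (star x)) -> (forall x y, T x -> T y -> x * y = y * x) ->
  comm_star_subalg bicommutant.
Proof.
move=> TS TC; split.
- by move=> y _; rewrite mul1r mulr1.
- by move=> x x' Bx Bx' y Ty; rewrite mulrDl mulrDr Bx // Bx'.
- by move=> c x Bx y Ty; rewrite -scalerAl -scalerAr Bx.
- by move=> x x' Bx Bx' y Ty; rewrite -mulrA Bx' // mulrA Bx // mulrA.
- move=> x Bx y Ty; apply: (can_inj (@starK _ A)).
  rewrite !starM starK Bx // => u Tu; apply: (can_inj (@starK _ A)).
  by rewrite !starM starK Ty //; exact: TS.
- move=> x y Bx By; apply: (Bx y) => u Tu.
  by rewrite By // => v Tv; exact: TC.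
Qed.

End DoubleCommutant.

(** * Neumann series and contractivity of *-homomorphisms *)

Section Neumann.
Variables (R : realType) (A : cstarAlgType R).

Lemma exists_left_inverse (x : A) : cnorm x < 1 -> exists y, y * (1 - x) = 1.
Proof.
set r := cnorm x => r1.
have r0 : 0 <= r by exact: cnorm_ge0.
pose u n := \sum_(k < n) x ^+ k.
have ux n : u n * (1 - x) = 1 - x ^+ n.
  elim: n => [|n IH]; first by rewrite /u big_ord0 mul0r expr0 subrr.
  rewrite /u big_ord_recr /= mulrDl -/(u n) IH mulrBr mulr1 -exprSr.
  by rewrite addrA subrK.
have rX e : 0 < e -> exists N, forall n, (N <= n)%N -> r ^+ n < e.
  move=> e0; have := @cvg_geometric R 1 r.
  rewrite ger0_norm // => /(_ r1) /cvgrPdist_lt /(_ _ e0) [N _ hN].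
  exists N => n Nn; have := hN n Nn => /=.
  by rewrite mul1r sub0r normrN ger0_norm ?exprn_ge0.
have uu m k : cnorm (u (m + k)%N - u m) * (1 - r) <= r ^+ m - r ^+ (m + k).
  elim: k => [|k IH]; first by rewrite addn0 !subrr cnorm0 mul0r.
  rewrite addnS /u big_ord_recr /= -/(u (m + k)%N) addrAC.
  have r10 : 0 <= 1 - r by rewrite subr_ge0 ltW.
  apply: le_trans (ler_wpM2r r10 (cnormD _ _)) _.
  rewrite mulrDl; apply: le_trans (lerD IH (ler_wpM2r r10 (cnormX _ _))) _.
  by rewrite mulrBr mulr1 -exprSr addrA subrK.
have [|l hl] := @cnorm_complete R A u.
  move=> e e0; have e1 : 0 < e * (1 - r) by rewrite mulr_gt0 ?subr_gt0.
  have [N hN] := rX _ e1; exists N.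
  suff h m n : (N <= m)%N -> (m <= n)%N -> cnorm (u n - u m) < e.
    move=> m n Nm Nn; have [/h|/ltnW/h] := leqP n m; first exact.
    by rewrite cdistC; exact.
  move=> Nm mn; rewrite -(ltr_pM2r (x := 1 - r)) ?subr_gt0 //.
  rewrite -(subnKC mn); apply: le_lt_trans (uu _ _) _.
  by apply: le_lt_trans (hN _ Nm); rewrite lerBlDr lerDl exprn_ge0.
exists l; apply/eqP; rewrite -subr_eq0; apply/eqP/cnorm_eq0/eqP.
rewrite eq_le cnorm_ge0 andbT; apply/ler_addgt0Pr => e e0; rewrite add0r.
pose C := cnorm (1 - x) + 1.
have C0 : 0 < C by rewrite ltr_wpDl ?cnorm_ge0.
have e2 : 0 < e / (C + 1) by rewrite divr_gt0 // addr_gt0.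
have [N1 h1] := rX _ e2.
move/cvgrPdist_lt : hl => /(_ _ e2) [N2 _ h2].
pose n := maxn N1 N2.
have e1 : l * (1 - x) - 1 = - ((u n - l) * (1 - x)) - x ^+ n.
  by rewrite mulrBl ux !opprB addrA [RHS]addrAC addrK.
rewrite e1; apply: le_trans (cnormB _ _) _; rewrite cnormN.
apply: le_trans (lerD (cnormM _ _) (cnormX _ _)) _.
have := h1 n (leq_maxl _ _); have := h2 n (leq_maxr _ _) => /=.
rewrite sub0r normrN ger0_norm ?cnorm_ge0 // => a1 a2.
apply: (@le_trans _ _ (e / (C + 1) * C + e / (C + 1))).
  apply: lerD; last exact: ltW.
  apply: ler_pM; rewrite ?cnorm_ge0 ?(ltW a1) //.
  by rewrite /C lerDl.
by rewrite -[X in _ + X]mulr1 -mulrDr divfK // gt_eqF // addr_gt0.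
Qed.

(** Otherwise some character has |chi w| > |a* a| at w = f (a* a). Then 1 - a* a / chi w has a left
    inverse y, so f y times 1 - w / chi w equals 1, although [q] kills the right factor. A left
    inverse suffices because [q] is bounded under left multiplication. *)
Lemma star_hom_contractive (B : cstarAlgType R) (f : {lrmorphism A -> B}) :
  {morph f : x / star x} -> forall a, cnorm (f a) <= cnorm a.
Proof.
move=> fS a; rewrite -(ler_pXn2r (n := 2)) ?nnegrE ?cnorm_ge0 //.
rewrite -!cnorm_star -fS -rmorphM leNgt; apply/negP => lt.
set w := f (star a * a) in lt.
have wS : star w = w by rewrite -fS starM starK.
have Tcss : comm_star_subalg (bicommutant [set w]).
  by apply: bicommutant_css => [x ->|x y -> ->].
have [|q [chi [hq hchi chiw]]] := exists_character Tcss _ wS.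
  exact: sub_bicommutant.
have hl := cf_lsn hq.
have n0 : 0 < normc (chi w).
  by rewrite chiw; apply: le_lt_trans lt; exact: cnorm_ge0.
have c0 : chi w != 0.
  by apply: contraTneq n0 => ->; rewrite ComplexField.Normc.normc0 ltxx.
have fZ c x : f (c *: x) = c *: f x by exact: linearZ.
have [|y hy] := @exists_left_inverse ((chi w)^-1 *: (star a * a)).
  by rewrite cnormZ ComplexField.Normc.normcV ltr_pdivrMl // mulr1 chiw.
have := congr1 q (congr1 f hy); rewrite rmorphM rmorphB !rmorph1 /= fZ -/w.
have -> : 1 - (chi w)^-1 *: w = - (chi w)^-1 *: (w - (chi w)%:A).
  by rewrite scaleNr scalerBr scalerA mulVf // scale1r opprB.
rewrite (lsn1 hl) => e; have := lsnM hl (f y) (- (chi w)^-1 *: (w - (chi w)%:A)).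
rewrite (lsnZ hl) hchi ?mulr0 ?e ?ler10 //.
exact: sub_bicommutant.
Qed.

End Neumann.

(** * Fuglede's theorem *)

Section Fuglede.
Variables (R : realType) (A : cstarAlgType R).

Lemma cnormX_le (x : A) (r : R) n : cnorm x <= r -> cnorm (x ^+ n) <= r ^+ n.
Proof.
move=> xr; apply: le_trans (cnormX _ _) _.
by apply: lerXn2r; rewrite ?nnegrE ?(le_trans (cnorm_ge0 x)) ?cnorm_ge0.
Qed.

Lemma sum_ord_double (V : zmodType) (f : nat -> V) n :
  \sum_(i < n.*2) f i = \sum_(i < n) f i.*2 + \sum_(i < n) f i.*2.+1.
Proof.
elim: n => [|n IH]; first by rewrite !big_ord0 addr0.
by rewrite doubleS !big_ord_recr /= IH -!addrA; congr (_ + _); rewrite addrCA.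
Qed.

Definition psum (a : nat -> A) k (c : R[i]) := \sum_(i < 2 ^ k) c ^+ i *: a i.

(* Averaging over [c] and [- c] halves the degree; iterating isolates a
   coefficient, which replaces Cauchy's estimate. *)
Lemma psum_parity a k c :
  psum a k.+1 c + psum a k.+1 (- c) = 2 *: psum (fun i => a i.*2) k (c ^+ 2) /\
  psum a k.+1 c - psum a k.+1 (- c) =
    (2 * c) *: psum (fun i => a i.*2.+1) k (c ^+ 2).
Proof.
rewrite /psum expnS mul2n.
rewrite (sum_ord_double (fun i => c ^+ i *: a i)).
rewrite (sum_ord_double (fun i => (- c) ^+ i *: a i)).
have -> : \sum_(i < 2 ^ k) (- c) ^+ i.*2 *: a i.*2 =
    \sum_(i < 2 ^ k) (c ^+ 2) ^+ i *: a i.*2.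
  by apply: eq_bigr => i _; rewrite -mul2n exprM sqrrN.
have -> : \sum_(i < 2 ^ k) c ^+ i.*2 *: a i.*2 =
    \sum_(i < 2 ^ k) (c ^+ 2) ^+ i *: a i.*2.
  by apply: eq_bigr => i _; rewrite -mul2n exprM.
have -> : \sum_(i < 2 ^ k) c ^+ i.*2.+1 *: a i.*2.+1 =
    c *: \sum_(i < 2 ^ k) (c ^+ 2) ^+ i *: a i.*2.+1.
  rewrite scaler_sumr; apply: eq_bigr => i _.
  by rewrite scalerA exprS -mul2n exprM.
have -> : \sum_(i < 2 ^ k) (- c) ^+ i.*2.+1 *: a i.*2.+1 =
    - (c *: \sum_(i < 2 ^ k) (c ^+ 2) ^+ i *: a i.*2.+1).
  rewrite scaler_sumr -sumrN; apply: eq_bigr => i _.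
  by rewrite scalerA exprS -mul2n exprM sqrrN mulNr scaleNr.
split; first by rewrite addrACA subrr addr0 -mulr2n scaler_nat.
by rewrite opprD opprK addrACA subrr add0r -mulr2n -scalerA scaler_nat.
Qed.

Lemma normc2 : normc (2 : R[i]) = 2.
Proof.
have <- : (2 : R)%:C = 2 :> R[i] by rewrite rmorph_nat.
by rewrite normc_real ger0_norm.
Qed.

Lemma normc_sqrtc_unit (d : R[i]) : normc d = 1 -> normc (sqrtc d) = 1.
Proof.
move=> d1; apply/eqP; rewrite -(eqrXn2 (n := 2)) ?normc_ge0 // expr1n.
by rewrite expr2 -ComplexField.Normc.normcM -expr2 sqr_sqrtc d1.
Qed.

Lemma psum0_le a k M : (forall c, normc c = 1 -> cnorm (psum a k c) <= M) ->
  cnorm (a 0) <= M.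
Proof.
elim: k a => [|k IH] a h.
  have := h 1 (ComplexField.Normc.normc1 _).
  by rewrite /psum expn0 big_ord1 expr0 scale1r.
rewrite -[a 0]/((fun i => a i.*2) 0); apply: IH => d d1.
rewrite -(sqr_sqrtc d) -(ler_pM2l (ltr0n _ 2)) -{1}normc2 -cnormZ.
have [<- _] := psum_parity a k (sqrtc d).
have c1 := normc_sqrtc_unit d1.
apply: le_trans (cnormD _ _) _; rewrite mulr_natl mulr2n lerD ?h //.
by rewrite normcN.
Qed.

Lemma psum1_le a k M : (forall c, normc c = 1 -> cnorm (psum a k.+1 c) <= M) ->
  cnorm (a 1) <= M.
Proof.
move=> h; rewrite -[a 1]/((fun i => a i.*2.+1) 0).
apply: (@psum0_le _ k) => d d1.
have c1 := normc_sqrtc_unit d1.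
have e : 2 = normc (2 * sqrtc d).
  by rewrite ComplexField.Normc.normcM normc2 c1 mulr1.
rewrite -(sqr_sqrtc d) -(ler_pM2l (ltr0n _ 2)) {1}e -cnormZ.
have [_ <-] := psum_parity a k (sqrtc d).
apply: le_trans (cnormB _ _) _; rewrite mulr_natl mulr2n lerD ?h //.
by rewrite normcN.
Qed.

(** Cauchy's estimate on the unit circle. Padding the coefficients to a length that is a power of
    two makes repeated halving applicable. *)
Lemma coef1_le (p : {poly A}) M :
  (forall c : R[i], normc c = 1 -> cnorm p.[c%:A] <= M) -> cnorm p`_1 <= M.
Proof.
move=> h; apply: (@psum1_le (fun i => p`_i) (size p)) => c c1.
have le : (size p <= 2 ^ (size p).+1)%N.
  by apply: ltnW; apply: ltn_trans (ltn_expl _ (ltnSn 1)).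
apply: le_trans (h c c1); rewrite (horner_coef_wide _ le) /psum.
rewrite le_eqVlt; apply/orP; left; apply/eqP; congr cnorm.
by apply: eq_bigr => i _; rewrite exprZn expr1n mulr_algr.
Qed.

Lemma coef0M (p q : {poly A}) : (p * q)`_0 = p`_0 * q`_0.
Proof. by rewrite coefM big_ord1. Qed.

Lemma coef1M (p q : {poly A}) : (p * q)`_1 = p`_0 * q`_1 + p`_1 * q`_0.
Proof. by rewrite coefM big_ord_recl big_ord1. Qed.

Lemma coef_exp1 (p : {poly A}) n : p`_0 = 1 ->
  (p ^+ n)`_0 = 1 /\ (p ^+ n)`_1 = p`_1 *+ n.
Proof.
move=> p0; elim: n => [|n [IH0 IH1]]; first by rewrite expr0 !coef1.
by rewrite exprS coef0M coef1M p0 IH0 IH1 !mul1r mulr1 mulrSr.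
Qed.

Lemma cnorm_subX1 (x : A) n : cnorm ((1 - x) ^+ n - 1) <= (1 + cnorm x) ^+ n - 1.
Proof.
have x1 : 1 <= 1 + cnorm x by rewrite lerDl cnorm_ge0.
elim: n => [|n IH]; first by rewrite !expr0 !subrr cnorm0.
have -> : (1 - x) ^+ n.+1 - 1 = (1 - x) * ((1 - x) ^+ n - 1) - x.
  by rewrite exprS mulrBr mulr1 opprB addrA [RHS]addrAC addrK.
apply: le_trans (cnormB _ _) _; rewrite exprS.
have h : cnorm (1 - x) <= 1 + cnorm x.
  by apply: le_trans (cnormB _ _) _; rewrite cnorm1.
apply: le_trans (lerD (cnormM _ _) (lexx _)) _.
apply: (@le_trans _ _ ((1 + cnorm x) * ((1 + cnorm x) ^+ n - 1) + cnorm x)).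
  by rewrite lerD2r; apply: ler_pM => //; exact: cnorm_ge0.
by rewrite mulrBr mulr1 opprD addrA subrK.
Qed.

Lemma bernoulli_up (d : R) n : 0 <= d <= 1 ->
  (1 + d) ^+ n <= 1 + 2 ^+ n * d.
Proof.
move=> /andP[d0 d1].
suff : (1 + d) ^+ n <= 1 + (2 ^+ n - 1) * d.
  by move=> h; apply: le_trans h _; rewrite lerD2l ler_wpM2r // gerBl.
elim: n => [|n IH]; first by rewrite !expr0 subrr mul0r addr0.
have d10 : 0 <= 1 + d by lra.
rewrite !exprS; apply: le_trans (ler_wpM2l d10 IH) _.
have p0 : 1 <= (2 : R) ^+ n by rewrite exprn_ege1 // ler1n.
have := mulr_ge0 (mulr_ge0 (_ : 0 <= 2 ^+ n - 1) d0) (_ : 0 <= 1 - d).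
by rewrite !subr_ge0 => /(_ p0 d1); nra.
Qed.

Section FugledeEstimate.
Variables (N T : A) (c : R[i]) (n m : nat).
Hypotheses (NN : N * star N = star N * N) (TN : T * star N = star N * T).
Hypotheses (c1 : normc c = 1) (N2 : cnorm N <= 2^-1).
Let a : A := 1 + c *: N.
Let j : A := \sum_(k < m) (- c *: N) ^+ k.

Let cN_le : cnorm (- c *: N) <= 2^-1.
Proof. by rewrite cnormZ normcN c1 mul1r. Qed.

Let aj : a * j = 1 - (- c *: N) ^+ m.
Proof.
rewrite /j; elim: m => [|k IH]; first by rewrite big_ord0 mulr0 expr0 subrr.
rewrite big_ord_recr /= mulrDr IH {1}/a -(opprK (c *: N)) -scaleNr mulrBl mul1r.
by rewrite -exprS addrA subrK.
Qed.

Let comm_a (x : A) : GRing.comm x N -> GRing.comm x a.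
Proof.
move=> xN; apply: commrD; first exact: commr1.
by rewrite /GRing.comm -scalerAr -scalerAl xN.
Qed.

Let comm_j (x : A) : GRing.comm x N -> GRing.comm x j.
Proof.
move=> xN; apply: commr_sum => k _; apply: commrX.
by rewrite /GRing.comm -scalerAr -scalerAl xN.
Qed.

Let starcomm (x y : A) : GRing.comm (star x) y -> GRing.comm x (star y).
Proof. by move=> h; apply: (can_inj (@starK _ A)); rewrite !starM starK h. Qed.

Let d : R := 2^-1 ^+ m.

Let d01 : 0 <= d <= 1.
Proof. by rewrite /d exprn_ge0 ?invr_ge0 // exprn_ile1 ?invr_ge0 // invf_le1 // ler1n. Qed.

(* [j] is a truncated Neumann series, an approximate inverse of [a], and
   [u = a * star j] is nearly unitary because [N] is normal; [T] commutes with
   [star a] and [star j], so [a^n T j^n] is close to [u^n T (star u)^n]. *)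
Lemma fuglede_estimate :
  cnorm (a ^+ n * T * j ^+ n) <= cnorm T * (1 + (4 ^+ n + 8 ^+ n) * d).
Proof.
have [d0 d1] := andP d01.
have a2 : cnorm a <= 2.
  apply: le_trans (cnormD _ _) _; rewrite cnorm1 cnormZ c1 mul1r.
  by apply: le_trans (lerD (lexx 1) N2) _; lra.
have j2 : cnorm j <= 2.
  suff : cnorm j <= 2 - 2 * d by lra.
  rewrite /j /d; elim: m => [|k IH].
    by rewrite big_ord0 cnorm0 expr0 mulr1 subrr.
  rewrite big_ord_recr /=; apply: le_trans (cnormD _ _) _.
  by apply: le_trans (lerD IH (cnormX_le _ cN_le)) _; rewrite exprS; lra.
have e_le : cnorm ((- c *: N) ^+ m) <= d.
  exact: cnormX_le.
have aj_le : cnorm (a * j) <= 1 + d.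
  by rewrite aj; apply: le_trans (cnormB _ _) _; rewrite cnorm1 lerD2l.
have Sc : comm_star_subalg (bicommutant [set N; star N]).
  apply: bicommutant_css => [x [->|->]|x y [->|->] [->|->]] //=.
  - by right.
  - by left; rewrite starK.
have SN : bicommutant [set N; star N] N by apply: sub_bicommutant; left.
have Sa : bicommutant [set N; star N] a.
  by apply: (cssD Sc); [exact: css1 Sc|exact: cssZ Sc _ _ SN].
have Sj : bicommutant [set N; star N] j.
  rewrite /j; elim: m => [|k IH].
    by rewrite big_ord0 -(scale0r 1); apply: (cssZ Sc); exact: css1 Sc.
  by rewrite big_ord_recr; apply: (cssD Sc IH); apply: (cssX Sc); exact: (cssZ Sc).
have Ssa := cssS Sc Sa; have Ssj := cssS Sc Sj.
pose u := a * star j.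
have su : star u = star a * j by rewrite starM starK (cssC Sc Ssa Sj).
have uu : star u * u = star (star (a * j)) * star (a * j).
  rewrite su /u starK starM -!mulrA; rewrite (cssC Sc Ssa (cssM Sc Sj (cssM Sc Sa Ssj))).
  by rewrite !mulrA (cssC Sc Sj Sa).
have u_le : cnorm u <= 1 + d.
  rewrite -(ler_pXn2r (n := 2)) ?nnegrE ?cnorm_ge0 ?addr_ge0 //.
  rewrite -cnorm_star uu cnorm_star cnormS lerXn2r ?nnegrE ?cnorm_ge0 ?addr_ge0 //.
have su_le : cnorm (star u) <= 1 + d by rewrite cnormS.
have sTN : GRing.comm (star T) N.
  by apply: (can_inj (@starK _ A)); rewrite !starM starK TN.
have Ta : GRing.comm T (star a) by apply/starcomm/comm_a.
have Tj : GRing.comm T (star j) by apply/starcomm/comm_j.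
have e : a ^+ n * T * j ^+ n =
    u ^+ n * T * star u ^+ n - a ^+ n * T * (star (a * j) ^+ n - 1) * j ^+ n.
  rewrite mulrBr mulr1 mulrBl opprB addrCA -[LHS]addr0; congr (_ + _).
  apply/esym/eqP; rewrite subr_eq0; apply/eqP.
  have -> : u ^+ n = a ^+ n * star j ^+ n.
    by rewrite exprMn_comm //; exact: (cssC Sc Sa Ssj).
  have -> : star u ^+ n = star a ^+ n * j ^+ n.
    by rewrite su exprMn_comm //; exact: (cssC Sc Ssa Sj).
  have -> : star (a * j) ^+ n = star j ^+ n * star a ^+ n.
    by rewrite starM exprMn_comm //; exact: (cssC Sc Ssj Ssa).
  rewrite !mulrA; congr (_ * _ * _); rewrite -!mulrA; congr (_ * _).
  by apply/esym/commrX.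
(* The 2 n factors [u] and [star u] give (1 + d) ^+ (2 n) <= 1 + 4 ^+ n * d. In the correction [p2],
   the powers of [a] and [j] and the difference from 1 contribute 2 ^+ n each, hence 8 ^+ n. *)
have p1 : cnorm (u ^+ n * T * star u ^+ n) <= cnorm T * (1 + 4 ^+ n * d).
  apply: le_trans (cnormM _ _) _.
  apply: le_trans (ler_pM (cnorm_ge0 _) (cnorm_ge0 _) (cnormM _ _) (cnormX _ _)) _.
  rewrite mulrAC [_ * cnorm T]mulrC ler_wpM2l ?cnorm_ge0 //.
  apply: (@le_trans _ _ ((1 + d) ^+ n * (1 + d) ^+ n)).
    apply: ler_pM; rewrite ?exprn_ge0 ?cnorm_ge0 ?cnormX_le //.
    by apply: lerXn2r; rewrite ?nnegrE ?cnorm_ge0 ?addr_ge0.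
  rewrite -exprD addnn -mul2n; apply: le_trans (bernoulli_up _ d01) _.
  by rewrite exprM (_ : 2 ^+ 2 = 4) //; lra.
have p2 : cnorm (a ^+ n * T * (star (a * j) ^+ n - 1) * j ^+ n) <=
    cnorm T * (8 ^+ n * d).
  apply: le_trans (cnormM _ _) _.
  apply: le_trans (ler_pM (cnorm_ge0 _) (cnorm_ge0 _) (cnormM _ _) (cnormX _ _)) _.
  have q1 : cnorm (a ^+ n * T) <= 2 ^+ n * cnorm T.
    apply: le_trans (cnormM _ _) _; rewrite ler_wpM2r ?cnorm_ge0 //.
    exact: cnormX_le.
  have q2 : cnorm (star (a * j) ^+ n - 1) <= 2 ^+ n * d.
    rewrite aj starB star1; apply: le_trans (cnorm_subX1 _ _) _.
    rewrite cnormS lerBlDl; apply: le_trans (bernoulli_up _ d01).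
    by apply: lerXn2r; rewrite ?nnegrE ?addr_ge0 ?cnorm_ge0 // lerD2l.
  have q3 : cnorm j ^+ n <= 2 ^+ n.
    by apply: lerXn2r; rewrite ?nnegrE ?cnorm_ge0.
  apply: (@le_trans _ _ (2 ^+ n * cnorm T * (2 ^+ n * d) * 2 ^+ n)).
    by do 2?apply: ler_pM; rewrite ?mulr_ge0 ?exprn_ge0 ?cnorm_ge0.
  rewrite le_eqVlt; apply/orP; left; apply/eqP.
  have -> : 8 ^+ n = 2 ^+ n * 2 ^+ n * 2 ^+ n :> R by rewrite -!exprMn; congr (_ ^+ _); ring.
  by ring.
rewrite e; apply: le_trans (cnormB _ _) _; apply: le_trans (lerD p1 p2) _.
by rewrite -mulrDr mulrDl addrA.
Qed.

End FugledeEstimate.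


(** The usual proof applies Liouville's theorem to exp(c N) T exp(- c N). Here (1 + c N)^n T j^n is
    a polynomial in c whose first coefficient is n times the commutator. On the unit circle it is
    bounded by |T| up to an error that vanishes with growing truncation order, so n |N T - T N| <=
    |T| for every n. *)
Lemma fuglede_small (N T : A) : N * star N = star N * N ->
  T * star N = star N * T -> cnorm N <= 2^-1 -> T * N = N * T.
Proof.
move=> NN TN N2; pose y := N * T - T * N.
suff y0 : cnorm y = 0 by apply/esym/eqP; rewrite -subr_eq0; apply/eqP/cnorm_eq0.
have hn n : cnorm y * n%:R <= cnorm T.
  have h m : cnorm y * n%:R <= cnorm T * (1 + (4 ^+ n + 8 ^+ n) * 2^-1 ^+ m.+2).
    pose pa : {poly A} := 1 + N *: 'X.
    (* With at least two terms the first coefficient is - N, as for the full Neumann series. *)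
    pose pj : {poly A} := \sum_(k < m.+2) ((- N) *: 'X) ^+ k.
    pose p := pa ^+ n * T%:P * pj ^+ n.
    have pa0 : pa`_0 = 1 by rewrite /pa coefD coef1 coefZ coefX mulr0 addr0.
    have pa1 : pa`_1 = N by rewrite /pa coefD coef1 coefZ coefX mulr1 add0r.
    have pj0 : pj`_0 = 1.
      rewrite /pj big_ord_recl expr0 coefD coef1 coef_sum big1 ?addr0 // => k _.
      by rewrite exprS coef0M coefZ coefX mulr0 mul0r.
    have pj1 : pj`_1 = - N.
      rewrite /pj !big_ord_recl expr0 /bump /= expr1 !coefD coef1 add0r coefZ coefX.
      rewrite mulr1 coef_sum big1 ?addr0 // => k _.
      by rewrite !exprS coef1M coef0M !coefZ !coefX /= !mulr0 !mul0r mulr0 addr0.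
    have [pan0 pan1] := coef_exp1 n pa0; have [pjn0 pjn1] := coef_exp1 n pj0.
    have -> : cnorm y * n%:R = cnorm p`_1.
      have -> : p`_1 = y *+ n.
        rewrite /p coef1M coef0M coef1M pan0 pan1 pjn0 pjn1 pa1 pj1 !coefC /=.
        by rewrite mulr0 add0r mul1r mulr1 mulNrn mulrN mulrnAr mulrnAl addrC -mulrnBl.
      rewrite -[y *+ n]scaler_nat cnormZ mulrC; congr (_ * _).
      have <- : (n%:R : R)%:C = n%:R :> R[i] by rewrite rmorph_nat.
      by rewrite normc_real ger0_norm.
    apply: coef1_le => c c1.
    have cc (x : A) : GRing.comm x c%:A by rewrite /GRing.comm mulr_algr mulr_algl.
    have cp (q : {poly A}) : comm_poly q (c%:A : A).
      by rewrite /comm_poly; move: (cc q.[c%:A]); rewrite /GRing.comm.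
    have pac : pa.[c%:A] = 1 + c *: N.
      by rewrite /pa hornerD hornerC hornerZ hornerX mulr_algr.
    have pjc : pj.[c%:A] = \sum_(k < m.+2) (- c *: N) ^+ k.
      rewrite /pj horner_sum; apply: eq_bigr => k _.
      rewrite horner_exp_comm ?hornerZ ?hornerX; last exact: cp.
      by rewrite mulr_algr scalerN scaleNr.
    rewrite /p !hornerM_comm ?horner_exp_comm ?hornerC ?pac ?pjc; try exact: cp.
    exact: fuglede_estimate.
  apply/ler_addgt0Pr => e e0.
  pose C := cnorm T * (4 ^+ n + 8 ^+ n).
  have := @cvg_geometric R C 2^-1.
  rewrite ger0_norm ?invr_ge0 // invf_lt1 // ltr1n => /(_ isT).
  move=> /cvgrPdist_lt /(_ _ e0) [k _ /(_ k.+2 (leqW (leqnSn k)))] /=.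
  rewrite sub0r normrN => /(le_lt_trans (ler_norm _)) ke.
  apply: le_trans (h k) _; rewrite mulrDr mulr1 lerD2l mulrA -/C.
  exact: ltW.
apply/eqP; apply: contraT => y0.
have yp : 0 < cnorm y by rewrite lt_neqAle eq_sym y0 cnorm_ge0.
pose n := (Num.truncn (cnorm T / cnorm y)).+1.
have := hn n; rewrite leNgt => /negP; case.
by rewrite mulrC -ltr_pdivrMr // /n truncnS_gt.
Qed.

Theorem fuglede (N T : A) : N * star N = star N * N ->
  T * star N = star N * T -> T * N = N * T.
Proof.
move=> NN TN.
have N1 : 0 < cnorm N + 1 by rewrite ltr_wpDl ?cnorm_ge0.
pose r : R := (2 * (cnorm N + 1))^-1.
have r0 : 0 < r by rewrite invr_gt0 mulr_gt0.
have rC0 : r%:C != 0 :> R[i] by rewrite eq_complex /= eqxx andbT gt_eqF.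
have rr : conjc r%:C = r%:C by exact: conjc_real.
apply: (scalerI rC0); rewrite scalerAr scalerAl; apply: fuglede_small.
- by rewrite starZc rr -!scalerAl -!scalerAr NN.
- by rewrite starZc rr -scalerAl -scalerAr TN.
- rewrite cnormZ normc_real gtr0_norm // mulrC /r invfM mulrCA -[leRHS]mulr1.
  by rewrite ler_pM2l ?invr_gt0 // ler_pdivrMr // mul1r lerDl.
Qed.

End Fuglede.

(** * The Clifford structure *)

Section WTerms.
Variable C : Type.

(* [WGen i s] stands for [a1] or [a2] ([i = false], [true]), adjoined when
   [s = true]. *)
Inductive wterm :=
  | WConst of C
  | WGen of bool & bool
  | WAdd of wterm & wterm
  | WMul of wterm & wterm.

(** The same term is evaluated in a C*-algebra, in the 4 x 4 matrices at a point of D, and in 16 x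
    16 matrices over the complex numbers and over polynomials in the shrinking parameter; norm
    bounds travel between these values. *)
Fixpoint weval (A : pzRingType) (k : C -> A) (g : bool -> bool -> A) t : A :=
  match t with
  | WConst c => k c
  | WGen i s => g i s
  | WAdd x y => weval k g x + weval k g y
  | WMul x y => weval k g x * weval k g y
  end.

End WTerms.

Lemma weval_morph C (A B : pzRingType) (f : {rmorphism A -> B}) (k : C -> A)
    (k' : C -> B) g g' (t : wterm C) :
  (forall c, f (k c) = k' c) -> (forall i s, f (g i s) = g' i s) ->
  f (weval k g t) = weval k' g' t.
Proof.
move=> hk hg; elim: t => //= x <- y <-; first by rewrite rmorphD.
by rewrite rmorphM.
Qed.

Lemma weval_comm C (A : pzRingType) (k : C -> A) g x :
  (forall c, GRing.comm x (k c)) -> (forall i s, GRing.comm x (g i s)) ->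
  forall t, GRing.comm x (weval k g t).
Proof.
move=> hk hg; elim=> //= u hu v hv; first exact: commrD.
exact: commrM.
Qed.

Fixpoint wstar (R : realType) (t : wterm R[i]) : wterm R[i] :=
  match t with
  | WConst c => WConst (conjc c)
  | WGen i s => WGen _ i (~~ s)
  | WAdd x y => WAdd (wstar x) (wstar y)
  | WMul x y => WMul (wstar y) (wstar x)
  end.

Section WcarAlgebra.
Variables (R : realType) (A : algType R[i]) (g : bool -> bool -> A).
Local Notation C := R[i].

Definition wsqr i s := g i s * g i s.
Definition wmix s := g false s * g true s + g true s * g false s.

(** A star-free form of the relations, with centrality built in. It holds in a C*-algebra by
    Fuglede's theorem and in the matrix model by computation, so the Clifford calculus is done once
    for both. *)
Record wcar_central : Prop := WcarCentral {
  wc_pair : forall i, g i false * g i true + g i true * g i false = 1;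
  wc_cross : forall s, g false s * g true (~~ s) + g true (~~ s) * g false s = 0;
  wc_sqr : forall i s j r, GRing.comm (wsqr i s) (g j r);
  wc_mix : forall s j r, GRing.comm (wmix s) (g j r)
}.

End WcarAlgebra.

Section Monomials.
Variable A : pzRingType.

Definition mono (x x' : A) (k : 'I_4) : A := nth 0 [:: 1; x; x'; x * x'] k.

End Monomials.

Definition mat4 (K : pzRingType) (s : seq (seq int)) : 'M[K]_4 :=
  \matrix_(i, j) (nth 0 (nth [::] s i) j)%:~R.

(* On the basis [1; x; x'; x x'] of the algebra with relations [x x' + x' x = 1],
   [x x = z], [x' x' = z'], right multiplication by [x] is [rmul0 + z rmul1] for
   [s = false], and right multiplication by [x'] is [rmul0 + z' rmul1] for
   [s = true]. *)
Definition rmul0 (K : pzRingType) s : 'M[K]_4 := mat4 K (if s then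
  [:: [:: 0; 0; 1; 0]; [:: 0; 0; 0; 1]; [:: 0; 0; 0; 0]; [:: 0; 0; 0; 0]]
  else [:: [:: 0; 1; 0; 0]; [:: 0; 0; 0; 0]; [:: 1; 0; 0; -1]; [:: 0; 1; 0; 0]]).
Definition rmul1 (K : pzRingType) s : 'M[K]_4 := mat4 K (if s then
  [:: [:: 0; 0; 0; 0]; [:: 0; 0; 0; 0]; [:: 1; 0; 0; 0]; [:: 0; 1; 0; 0]]
  else [:: [:: 0; 0; 0; 0]; [:: 1; 0; 0; 0]; [:: 0; 0; 0; 0]; [:: 0; 0; -1; 0]]).
(* Moving [y] (or [y']) to the left across the basis: the sign, and the terms
   created by the central anticommutator of [x] and [y]. *)
Definition rsign (K : pzRingType) : 'M[K]_4 := mat4 K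
  [:: [:: 1; 0; 0; 0]; [:: 0; -1; 0; 0]; [:: 0; 0; -1; 0]; [:: 0; 0; 0; 1]].
Definition rder (K : pzRingType) s : 'M[K]_4 := mat4 K (if s then
  [:: [:: 0; 0; 0; 0]; [:: 0; 0; 0; 0]; [:: 1; 0; 0; 0]; [:: 0; 1; 0; 0]]
  else [:: [:: 0; 0; 0; 0]; [:: 1; 0; 0; 0]; [:: 0; 0; 0; 0]; [:: 0; 0; -1; 0]]).

(** The first tensor factor indexes monomials in the second pair, the second factor those in the
    first pair. A generator of the second pair has to cross the monomial of the first pair before it
    multiplies its own: hence [rsign] and [rder]. The values of the central squares and
    anticommutators are [z] and [t]. *)
Definition rgen (K : pzRingType) (z : bool -> bool -> K) (t : bool -> K) i s :
    'M[K]_(4 * 4) :=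
  if i then rmul0 K s *t rsign K + z true s *: (rmul1 K s *t rsign K)
            + t s *: (1%:M *t rder K s)
  else 1%:M *t rmul0 K s + z false s *: (1%:M *t rmul1 K s).

(** * Right multiplication on the sixteen monomials *)

Section RightMultiplication.
Variables (R : realType) (A : algType R[i]) (g : bool -> bool -> A).
Hypothesis gW : wcar_central g.
Local Notation C := R[i].

Definition mono1 := mono (g false false) (g false true).
Definition mono2 := mono (g true false) (g true true).
Definition monos (I : 'I_(4 * 4)) : A :=
  mono2 (mxtens_unindex I).1 * mono1 (mxtens_unindex I).2.

Definition rowsum n (e : 'I_n -> A) (M : 'M[C]_n) i := \sum_j M i j *: e j.

Lemma rowsum_tens (P Q : 'M[C]_4) I :
  rowsum monos (P *t Q) I =
  rowsum mono2 P (mxtens_unindex I).1 * rowsum mono1 Q (mxtens_unindex I).2.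
Proof.
rewrite /rowsum mulr_sum; apply: eq_bigr => J _.
by rewrite mxE -scalerAl -scalerAr scalerA.
Qed.

Lemma rowsum1 n (e : 'I_n -> A) i : rowsum e 1%:M i = e i.
Proof.
rewrite /rowsum (bigD1 i) //= mxE eqxx scale1r big1 ?addr0 // => j ji.
by rewrite mxE eq_sym (negbTE ji) scale0r.
Qed.

Lemma rowsumD n (e : 'I_n -> A) (M N : 'M[C]_n) i :
  rowsum e (M + N) i = rowsum e M i + rowsum e N i.
Proof. by rewrite -big_split; apply: eq_bigr => j _; rewrite mxE scalerDl. Qed.

Lemma rowsumZ n (e : 'I_n -> A) (c : C) (M : 'M[C]_n) i :
  rowsum e (c *: M) i = c *: rowsum e M i.
Proof.
by rewrite /rowsum scaler_sumr; apply: eq_bigr => j _; rewrite mxE scalerA.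
Qed.

Lemma mono_rmul i s k :
  mono (g i false) (g i true) k * g i s =
  rowsum (mono (g i false) (g i true)) (rmul0 C s) k
  + wsqr g i s * rowsum (mono (g i false) (g i true)) (rmul1 C s) k.
Proof.
have e := wc_pair gW i; have c := wc_sqr gW i.
rewrite /rowsum !big_ord_recl !big_ord0 !mxE /mono.
case: k => -[|[|[|[|//]]]] h; case: s => /=;
  rewrite ?scale0r ?scale1r ?scaleN1r ?add0r ?addr0 ?mulr0 ?mul1r ?mulr1 //.
all: rewrite ?addr0 //.
- by rewrite -e [_ + g i true * _]addrC addrK.
- by rewrite -mulrA; exact/esym/(c true i false).
- rewrite -mulrA; have -> : g i true * g i false = 1 - g i false * g i true.
    by rewrite -e [_ + g i true * _]addrC addrK.
  by rewrite mulrBr mulr1 mulrA mulrN.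
Qed.

Lemma mono1_pass s k :
  mono1 k * g true s =
  g true s * rowsum mono1 (rsign C) k + wmix g s * rowsum mono1 (rder C s) k.
Proof.
have x0 := wc_cross gW false; have x1 := wc_cross gW true.
rewrite /= in x0 x1.
have t0 : g false s * g true s = wmix g s - g true s * g false s.
  by rewrite /wmix addrK.
have tc := wc_mix gW s.
have cr : g false (~~ s) * g true s = - (g true s * g false (~~ s)).
  by apply/eqP; rewrite -addr_eq0; apply/eqP; have := wc_cross gW (~~ s); rewrite negbK.
rewrite /rowsum !big_ord_recl !big_ord0 !mxE /mono1 /mono.
case: k => -[|[|[|[|//]]]] h; case: s t0 tc cr => t0 tc cr /=;
  rewrite ?scale0r ?scale1r ?scaleN1r ?add0r ?addr0 ?mulr0 ?mul1r ?mulr1 //.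
all: rewrite ?addr0 ?mulr0 ?mulr1 //.
- by rewrite mulrN; exact: cr.
- by rewrite mulrN addrC; exact: t0.
- by rewrite mulrN addrC; exact: t0.
- by rewrite mulrN; exact: cr.
- rewrite -mulrA t0 mulrBr !mulrA -[X in X - _](tc false false) addrC.
  by congr (_ + _); rewrite cr mulNr opprK.
- by rewrite -mulrA cr mulrN mulrA t0 mulrBl opprB mulrN -!mulrA.
Qed.

Lemma mono_comm i x : (forall j r, GRing.comm x (g j r)) ->
  forall k, GRing.comm x (mono (g i false) (g i true) k).
Proof.
move=> cx; case=> -[|[|[|[|//]]]] h; rewrite /mono /=.
- exact: commr1.
- exact: cx.
- exact: cx.
- by apply: commrM; exact: cx.
Qed.

Lemma monos_comm x : (forall j r, GRing.comm x (g j r)) ->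
  forall I, GRing.comm x (monos I).
Proof. by move=> cx I; apply: commrM; exact: mono_comm. Qed.

Lemma monos_rmul i s I :
  monos I * g i s =
  match i with
  | true => rowsum monos (rmul0 C s *t rsign C) I
     + wsqr g true s * rowsum monos (rmul1 C s *t rsign C) I
     + wmix g s * rowsum monos (1%:M *t rder C s) I
  | false => rowsum monos (1%:M *t rmul0 C s) I
     + wsqr g false s * rowsum monos (1%:M *t rmul1 C s) I
  end.
Proof.
have c2 := mono_comm true.
rewrite /monos; case: i; rewrite !rowsum_tens ?rowsum1 -mulrA.
  rewrite mono1_pass mulrDr mulrA mono_rmul mulrDl; congr (_ + _ + _).
    by rewrite -!mulrA.
  by rewrite mulrA -(c2 (wmix g s) (wc_mix gW s)) ?mulrA.
rewrite mono_rmul mulrDr; congr (_ + _).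
by rewrite mulrA -(c2 (wsqr g false s) (wc_sqr gW false s)) ?mulrA.
Qed.

End RightMultiplication.

(** * Central elements in a C*-algebra with the relations *)

Section WcarElements.
Variables (R : realType) (B : cstarAlgType R) (b1 b2 : B).
Hypothesis bW : wcar_rel b1 b2.

Definition wgens i s : B :=
  let b := if i then b2 else b1 in if s then star b else b.

Lemma wgens_star i s : star (wgens i s) = wgens i (~~ s).
Proof. by rewrite /wgens; case: s; rewrite //= starK. Qed.

Lemma wcar_rel_sym (A : cstarAlgType R) (a1 a2 : A) :
  wcar_rel a1 a2 -> wcar_rel a2 a1.
Proof.
case=> h1 h2 h3; split=> //.
by have := congr1 star h3; rewrite starN !starM !starK.
Qed.

Lemma wcar_sqr_starC (A : cstarAlgType R) (a1 a2 : A) : wcar_rel a1 a2 ->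
  a1 * a1 * star a1 = star a1 * (a1 * a1).
Proof.
case=> h _ _; have e : a1 * star a1 = 1 - star a1 * a1 by rewrite -h addrAC subrr add0r.
by rewrite -mulrA e mulrBr mulr1 !mulrA e mulrBl mul1r opprB addrC subrK.
Qed.

(** The relations make a2 anticommute with a1*, so it commutes with the adjoint of a1^2. That square
    is normal, and Fuglede's theorem removes the adjoint. *)
Lemma wcar_sqrC (A : cstarAlgType R) (a1 a2 : A) : wcar_rel a1 a2 ->
  a1 * a1 * a2 = a2 * (a1 * a1).
Proof.
move=> W; have [h1 h2 h3] := W; apply/esym/fuglede.
  have e := wcar_sqr_starC W.
  by rewrite starM [LHS]mulrA e -[LHS]mulrA e [LHS]mulrA.
rewrite starM -[RHS]mulrA h3 mulrN [star a1 * (a2 * _)]mulrA h3 mulNr opprK.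
by rewrite mulrA.
Qed.

Lemma wcar_sqr_starC2 (A : cstarAlgType R) (a1 a2 : A) : wcar_rel a1 a2 ->
  a1 * a1 * star a2 = star a2 * (a1 * a1).
Proof.
move=> /wcar_rel_sym [_ _ h3].
have e : a1 * star a2 = - (star a2 * a1) by rewrite h3 opprK.
by rewrite -mulrA e mulrN [a1 * (star a2 * _)]mulrA e mulNr opprK -mulrA.
Qed.

Lemma wcar_mixC (A : cstarAlgType R) (a1 a2 : A) : wcar_rel a1 a2 ->
  (a1 * a2 + a2 * a1) * a1 = a1 * (a1 * a2 + a2 * a1).
Proof.
move=> W; rewrite mulrDl mulrDr -[a2 * a1 * a1]mulrA -(wcar_sqrC W).
by rewrite [LHS]addrC !mulrA.
Qed.

Lemma wcar_mix_starC (A : cstarAlgType R) (a1 a2 : A) : wcar_rel a1 a2 ->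
  (a1 * a2 + a2 * a1) * star a1 = star a1 * (a1 * a2 + a2 * a1).
Proof.
case=> h _ h3.
have e : star a1 * a1 = 1 - a1 * star a1 by rewrite -h addrK.
have e2 : a2 * star a1 = - (star a1 * a2) by rewrite h3 opprK.
have l1 : a1 * a2 * star a1 = - (a1 * star a1 * a2) by rewrite -mulrA e2 mulrN mulrA.
have r1 : star a1 * (a1 * a2) = a2 - a1 * star a1 * a2.
  by rewrite mulrA e mulrBl mul1r.
have r2 : star a1 * (a2 * a1) = a2 * a1 * star a1 - a2.
  by rewrite [LHS]mulrA h3 mulNr -[a2 * star a1 * _]mulrA e mulrBr mulr1 opprB mulrA.
by rewrite mulrDl mulrDr l1 r1 r2 [RHS]addrC addrA subrK addrC.
Qed.

Lemma wcar_gens_central : wcar_central wgens.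
Proof.
have W := bW; have W' := wcar_rel_sym W; have [h1 h2 h3] := W; have [_ _ h4] := W'.
have starC (x : B) : (forall j r, GRing.comm x (wgens j r)) ->
    forall j r, GRing.comm (star x) (wgens j r).
  move=> cx j r; apply: (can_inj (@starK _ B)).
  by rewrite !starM starK wgens_star; exact/esym/cx.
have wsS i : wsqr wgens i true = star (wsqr wgens i false).
  by rewrite /wsqr starM !wgens_star.
have wmS : wmix wgens true = star (wmix wgens false).
  by rewrite /wmix starD !starM !wgens_star addrC.
have wsC i : forall j r, GRing.comm (wsqr wgens i false) (wgens j r).
  case: i => -[] []; rewrite /wsqr /wgens /=.
  - exact: (wcar_sqr_starC W').
  - by rewrite /GRing.comm mulrA.
  - exact: (wcar_sqr_starC2 W').
  - exact: (wcar_sqrC W').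
  - exact: (wcar_sqr_starC2 W).
  - exact: (wcar_sqrC W).
  - exact: (wcar_sqr_starC W).
  - by rewrite /GRing.comm mulrA.
have wmC : forall j r, GRing.comm (wmix wgens false) (wgens j r).
  case=> [] []; rewrite /wmix /wgens /=.
  - by rewrite addrC; exact: (wcar_mix_starC W').
  - by rewrite addrC; exact: (wcar_mixC W').
  - exact: (wcar_mix_starC W).
  - exact: (wcar_mixC W).
split.
- by case; rewrite /wgens /= addrC.
- case; rewrite /wgens /=.
    by rewrite h3 addNr.
  by rewrite h4 subrr.
- by move=> i []; [rewrite wsS; apply: starC|]; exact: wsC.
- by case; [rewrite wmS; apply: starC|]; exact: wmC.
Qed.

End WcarElements.

(** The expression is the value of the square of the self-adjoint element al b1 + be b2 + (al b1 +
    be b2)^*, when b1^2, b2^2 and b1 b2 + b2 b1 take the values [z1], [z2] and [t]. *)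
Definition wcar_psd (R : realType) (z1 z2 t : R[i]) : Prop :=
  forall al be : R[i], 0 <= normc al ^+ 2 + normc be ^+ 2
    + 2 * complex.Re (al ^+ 2 * z1 + be ^+ 2 * z2 + al * be * t).

Lemma normc_sqr (R : realType) (c : R[i]) :
  normc c ^+ 2 = complex.Re c ^+ 2 + complex.Im c ^+ 2.
Proof. by case: c => a b /=; rewrite sqr_sqrtr // addr_ge0 ?sqr_ge0. Qed.

Lemma wcar_psd_value (R : realType) (al be z1 z2 t : R[i]) :
  (normc al ^+ 2 + normc be ^+ 2
    + 2 * complex.Re (al ^+ 2 * z1 + be ^+ 2 * z2 + al * be * t))%:C =
  al ^+ 2 * z1 + conjc al ^+ 2 * conjc z1 + al * conjc al
  + (be ^+ 2 * z2 + conjc be ^+ 2 * conjc z2 + be * conjc be)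
  + (al * be * t + conjc al * conjc be * conjc t).
Proof.
rewrite !normc_sqr; case: al be z1 z2 t => [a1 a2] [c1 c2] [u1 u2] [v1 v2] [w1 w2].
by rewrite !expr2; apply/eqP; rewrite eq_complex /=; apply/andP; split; apply/eqP; ring.
Qed.

Definition reval (C : Type) (K : pzRingType) (k : C -> K)
    (z : bool -> bool -> K) (t : bool -> K) (x : wterm C) : 'M[K]_(4 * 4) :=
  weval (fun c => (k c)%:M) (rgen z t) x.

(** * Characters of the centre and eigenvalues of right multiplication *)

Section FiberEigenvalue.
Variables (R : realType) (B : cstarAlgType R) (b1 b2 : B).
Hypothesis bW : wcar_rel b1 b2.
Local Notation C := R[i].
Let g := wgens b1 b2.
Let gC : wcar_central g := wcar_gens_central bW.

Definition ev (t : wterm C) : B := weval (fun c => c%:A) (wgens b1 b2) t.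

Lemma ev_star t : star (ev t) = ev (wstar t).
Proof.
elim: t => [c|i s|x IHx y IHy|x IHx y IHy] /=.
- by rewrite /ev /= starZc star1.
- exact: wgens_star.
- by rewrite /ev /= starD [star _]IHx [X in _ + X]IHy.
- by rewrite /ev /= starM [star _]IHy [X in _ * X]IHx.
Qed.

Lemma ev_comm x : (forall i s, GRing.comm x (g i s)) ->
  forall t, GRing.comm x (ev t).
Proof.
move=> h; apply: weval_comm => // c.
by rewrite /GRing.comm mulr_algl mulr_algr.
Qed.

Lemma sqr_comb2 (x x' : B) (a : C) : x * x' + x' * x = 1 ->
  (a *: x + conjc a *: x') * (a *: x + conjc a *: x') =
  a ^+ 2 *: (x * x) + (conjc a) ^+ 2 *: (x' * x') + (a * conjc a)%:A.
Proof.
move=> <-; rewrite mulrDl !mulrDr -!scalerAl -!scalerAr !scalerA -!expr2.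
by rewrite [conjc a * a]mulrC scalerDr [LHS](AC (2*2) (1*4*(2*3)))%AC.
Qed.

Lemma mix_comb2 (x x' y y' : B) (a b : C) :
  x' * y + y * x' = 0 -> x * y' + y' * x = 0 ->
  (a *: x + conjc a *: x') * (b *: y + conjc b *: y') +
  (b *: y + conjc b *: y') * (a *: x + conjc a *: x') =
  (a * b) *: (x * y + y * x) + (conjc a * conjc b) *: (x' * y' + y' * x').
Proof.
move=> h1 h2; rewrite !mulrDl !mulrDr -!scalerAl -!scalerAr !scalerA !scalerDr.
have e1 : y * x' = - (x' * y) by apply/eqP; rewrite -addr_eq0 addrC h1.
have e2 : y' * x = - (x * y') by apply/eqP; rewrite -addr_eq0 addrC h2.
rewrite e1 e2 !scalerN [b * a]mulrC [conjc b * conjc a]mulrC.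
rewrite [b * conjc a]mulrC [conjc b * a]mulrC.
rewrite [LHS](AC ((2*2)*(2*2)) ((1*5)*(4*8)*(3*6)*(2*7)))%AC.
by rewrite /= !subrr !addr0.
Qed.

(* The images of [monos] in the left module defined by the seminorm [q] form an
   eigenvector of right multiplication by [Q], with eigenvalue [chi (ev Q)]; it
   is nonzero since one of the monomials is [1]. *)
Theorem exists_fiber (Q : wterm C) : star (ev Q) = ev Q ->
  exists (z : bool -> bool -> C) (t : bool -> C) (mu : C),
  [/\ normc mu = cnorm (ev Q),
      (forall i, z i true = conjc (z i false)) /\ t true = conjc (t false),
      wcar_psd (z false false) (z true false) (t false)
    & \det (reval id z t Q - mu%:M) = 0].
Proof.
move=> QS.
(* Every member is a value of [ev], so the central members commute with all the others; as [ev Q] is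
   self-adjoint, [T] is also closed under the star. *)
pose T : set B := [set u | exists2 x, u = ev x &
  u = ev Q \/ forall i s, GRing.comm u (g i s)].
have gS i s : star (g i s) = g i (~~ s) by exact: wgens_star.
have starC u : (forall i s, GRing.comm u (g i s)) ->
    forall i s, GRing.comm (star u) (g i s).
  move=> h i s; apply: (can_inj (@starK _ B)).
  by rewrite !starM starK gS; exact/esym/h.
have Scss : comm_star_subalg (bicommutant T).
  apply: bicommutant_css => [_ [x -> hx]|u v [x -> hx] [y -> hy]].
    exists (wstar x); first exact: ev_star.
    case: hx => [->|hx]; [by left|right]; exact: starC.
  case: hx hy => [->|hx] [->|hy] //; last exact: ev_comm.
    exact/esym/ev_comm.
  exact: ev_comm.
have ST u : T u -> bicommutant T u by exact: sub_bicommutant.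
have SQ : bicommutant T (ev Q) by apply: ST; exists Q => //; left.
have [q [chi [hq hchi chiQ]]] := exists_character Scss SQ QS.
have hl := cf_lsn hq.
pose z i s := chi (wsqr g i s); pose t s := chi (wmix g s).
have Tz i s : T (wsqr g i s).
  by exists (WMul (WGen _ i s) (WGen _ i s)) => //; right; exact: wc_sqr.
have Tt s : T (wmix g s).
  exists (WAdd (WMul (WGen _ false s) (WGen _ true s))
               (WMul (WGen _ true s) (WGen _ false s))) => //.
  by right; exact: wc_mix.
have qz i s : q (wsqr g i s - (z i s)%:A) = 0 by apply: hchi; exact: ST.
have qt s : q (wmix g s - (t s)%:A) = 0 by apply: hchi; exact: ST.
(* By uniqueness of the scalar it suffices that [q] kills the adjoint of u - chi u, which follows
   from the C*-identity. *)
have chiS u : bicommutant T u -> chi (star u) = conjc (chi u).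
  move=> Su; apply: (cf_scal_unique hq (hchi _ (cssS Scss Su))).
  have -> : star u - (conjc (chi u))%:A = star (u - (chi u)%:A).
    by rewrite starB starZc star1.
  set v := u - _; have Sv : bicommutant T v.
    by apply: (cssB Scss Su); exact: (css_scal Scss).
  have SvS := cssS Scss Sv.
  have Svv : bicommutant T (star (star v) * star v).
    by apply: (cssM Scss) => //; rewrite starK.
  apply/eqP; rewrite -sqrf_eq0 -(cf_star hq Svv) starK (cssC Scss Sv SvS).
  rewrite eq_le (lsn_ge0 hl) andbT; apply: le_trans (cfM hq _ Sv) _.
  by rewrite hchi // mulr0.
have zS i : z i true = conjc (z i false).
  rewrite -(chiS _ (ST _ (Tz i false))) /z; congr chi.
  by rewrite /wsqr starM !gS.
have tS : t true = conjc (t false).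
  rewrite -(chiS _ (ST _ (Tt false))) /t; congr chi.
  by rewrite /wmix starD !starM !gS addrC.
exists z, t, (chi (ev Q)); split=> //.
  (* [sim u c] says that u is the scalar c in the fiber. Expanding the square of the self-adjoint
     element x + y into central terms gives its scalar, which [cf_sqr_ge0] shows to be
     nonnegative. *)
  move=> al be; pose sim u (c : C) := bicommutant T u /\ q (u - c%:A) = 0.
  have simD u v c d : sim u c -> sim v d -> sim (u + v) (c + d).
    move=> [Su qu] [Sv qv]; split; first exact: (cssD Scss).
    rewrite scalerDl opprD addrACA; apply/eqP; rewrite eq_le (lsn_ge0 hl) andbT.
    by apply: le_trans (lsnD hl _ _) _; rewrite qu qv addr0.
  have simZ u c d : sim u c -> sim (d *: u) (d * c).
    move=> [Su qu]; split; first exact: (cssZ Scss).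
    by rewrite -scalerA -scalerBr (lsnZ hl) qu mulr0.
  have sim1 d : sim d%:A d.
    by split; [exact: (css_scal Scss)|rewrite subrr (lsn0 hl)].
  have simz i s : sim (wsqr g i s) (z i s) by split; [exact: ST|].
  have simt s : sim (wmix g s) (t s) by split; [exact: ST|].
  pose x := al *: g false false + conjc al *: g false true.
  pose y := be *: g true false + conjc be *: g true true.
  have xy : (x + y) * (x + y) = x * x + y * y + (x * y + y * x).
    by rewrite mulrDl !mulrDr [LHS](AC (2*2) (1*4*(2*3)))%AC.
  have [wp0 wp1] := (wc_pair gC false, wc_pair gC true).
  have [wx0 wx1] := (wc_cross gC false, wc_cross gC true).
  rewrite /x /y (sqr_comb2 _ wp0) (sqr_comb2 _ wp1) (mix_comb2 _ _ wx1 wx0) in xy.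
  have := simD _ _ _ _ (simD _ _ _ _
    (simD _ _ _ _ (simD _ _ _ _ (simZ _ _ (al ^+ 2) (simz false false))
                                 (simZ _ _ (conjc al ^+ 2) (simz false true)))
                  (sim1 (al * conjc al)))
    (simD _ _ _ _ (simD _ _ _ _ (simZ _ _ (be ^+ 2) (simz true false))
                                 (simZ _ _ (conjc be ^+ 2) (simz true true)))
                  (sim1 (be * conjc be))))
    (simD _ _ _ _ (simZ _ _ (al * be) (simt false))
                  (simZ _ _ (conjc al * conjc be) (simt true))).
  rewrite /wsqr /wmix -xy => -[Sxy qxy].
  set r := _ + 2 * _; apply: (cf_sqr_ge0 Scss hq (v := x + y)) => //.
    rewrite /x /y !starD !starZc !conjcK !gS /=.
    by rewrite [conjc al *: _ + _]addrC [conjc be *: _ + _]addrC.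
  rewrite -qxy; congr (q (_ - _ *: _)).
  by rewrite /r wcar_psd_value !zS tS.
have qD0 x y : q x = 0 -> q y = 0 -> q (x + y) = 0.
  move=> hx hy; apply/eqP; rewrite eq_le (lsn_ge0 hl) andbT.
  by apply: le_trans (lsnD hl _ _) _; rewrite hx hy addr0.
(* The kernel of [q] is only a left ideal, so the induction over products needs the extra right
   factor [ev u]. It is harmless: the error is a multiple of v - c with v central, and this factor
   can be moved to the far right. *)
have keyR : forall (x : wterm C) I u,
    q ((monos g I * ev x - rowsum (monos g) (reval id z t x) I) * ev u) = 0.
  elim=> [c|i s|x IHx y IHy|x IHx y IHy] I u; rewrite /reval /ev /=.
  - rewrite /rowsum (bigD1 I) //= mxE eqxx mulr1n big1 ?addr0.
      by rewrite mulr_algr subrr mul0r (lsn0 hl).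
    by move=> j jI; rewrite mxE eq_sym (negbTE jI) mulr0n scale0r.
  - rewrite -/g (monos_rmul gC).
    have qc v c M : T v -> (forall j r, GRing.comm v (g j r)) ->
        q (v - c%:A) = 0 ->
        q ((v * rowsum (monos g) M I - c *: rowsum (monos g) M I) * ev u) = 0.
      move=> Tv vg qv; set y := rowsum _ _ _.
      have vy : v * (y * ev u) = y * ev u * v.
        apply: commrM; last exact: ev_comm.
        apply: commr_sum => J _; rewrite /GRing.comm -scalerAl -scalerAr.
        by congr (_ *: _); exact: monos_comm.
      have -> : (v * y - c *: y) * ev u = y * ev u * (v - c%:A).
        by rewrite mulrBr mulr_algr mulrBl -scalerAl -mulrA vy.
      apply: (cf_kerM _ hq _ qv).
      by apply: (cssB Scss); [exact: ST|exact: (css_scal Scss)].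
    rewrite /rgen; case: i; rewrite !rowsumD !rowsumZ.
      rewrite opprD addrACA opprD [X in X + _]addrACA subrr add0r mulrDl.
      by apply: qD0; apply: qc => //; [exact: wc_sqr|exact: wc_mix].
    rewrite opprD addrACA subrr add0r.
    by apply: qc => //; exact: wc_sqr.
  - rewrite -/(ev x) -/(ev y) -/(reval id z t x) -/(reval id z t y).
    by rewrite rowsumD mulrDr opprD addrACA mulrDl; exact: qD0.
  - rewrite -/(ev x) -/(ev y) -/(reval id z t x) -/(reval id z t y).
    rewrite mulrA; set X := reval _ _ _ x; set Y := reval _ _ _ y.
    have -> : rowsum (monos g) (X * Y) I = \sum_J X I J *: rowsum (monos g) Y J.
      rewrite /rowsum; under [RHS]eq_bigr do rewrite scaler_sumr.
      rewrite exchange_big; apply: eq_bigr => K _ /=.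
      by rewrite mxE scaler_suml; apply: eq_bigr => J _; rewrite scalerA.
    have -> : (monos g I * ev x * ev y - \sum_J X I J *: rowsum (monos g) Y J) * ev u
      = (monos g I * ev x - rowsum (monos g) X I) * ev (WMul y u)
        + \sum_J X I J *: ((monos g J * ev y - rowsum (monos g) Y J) * ev u).
      have -> : \sum_J X I J *: ((monos g J * ev y - rowsum (monos g) Y J) * ev u)
          = (rowsum (monos g) X I * ev y - \sum_J X I J *: rowsum (monos g) Y J) * ev u.
        rewrite /rowsum mulr_suml -sumrB mulr_suml; apply: eq_bigr => J _.
        by rewrite -!scalerAl -scalerBr -scalerAl.
      rewrite [ev (WMul y u)]/(ev y * ev u) [X in _ = X + _]mulrA -mulrDl.
      by congr (_ * _); rewrite mulrBl addrA subrK.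
    apply: (qD0 _ _ (IHx _ _)).
    apply: (big_ind (fun v => q v = 0)); [exact: (lsn0 hl)|exact: qD0|].
    by move=> J _; rewrite (lsnZ hl) IHy mulr0.
have hQ I : q (\sum_J (reval id z t Q - (chi (ev Q))%:M) I J *: monos g J) = 0.
  have h1 := keyR Q I (WConst 1).
  have h2 : q (monos g I * (ev Q - (chi (ev Q))%:A)) = 0.
    apply: (cf_kerM _ hq _ (hchi _ SQ)).
    by apply: (cssB Scss) => //; exact: (css_scal Scss).
  have -> : \sum_J (reval id z t Q - (chi (ev Q))%:M) I J *: monos g J =
      monos g I * (ev Q - (chi (ev Q))%:A)
      - (monos g I * ev Q - rowsum (monos g) (reval id z t Q) I) * ev (WConst 1).
    have -> : ev (WConst 1) = 1 by rewrite /ev /= scale1r.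
    rewrite mulr1 mulrBr mulr_algr opprB.
    rewrite [RHS]addrC addrA subrK -/(rowsum (monos g) _ I) rowsumD; congr (_ + _).
    by rewrite -[- _%:M]scaleN1r rowsumZ -scalemx1 rowsumZ rowsum1 scaleN1r.
  apply/eqP; rewrite eq_le (lsn_ge0 hl) andbT.
  by apply: le_trans (lsnB hl _ _) _; rewrite h1 h2 addr0.
set M := _ - _ in hQ *.
(* Cramer's rule: row 0 of the adjugate combines the equations into det M times the monomial 1,
   whose seminorm is the modulus of det M. *)
have hdet : q (\sum_I (\adj M 0 I) *: \sum_J M I J *: monos g J) = 0.
  apply: (big_ind (fun v => q v = 0)); [exact: (lsn0 hl)|exact: qD0|].
  by move=> J _; rewrite (lsnZ hl) hQ mulr0.
have e : \sum_I (\adj M 0 I) *: (\sum_J M I J *: monos g J) = (\det M)%:A.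
  transitivity (rowsum (monos g) (\adj M *m M) 0).
    under eq_bigr do rewrite scaler_sumr.
    rewrite exchange_big; apply: eq_bigr => J _ /=.
    by rewrite mxE scaler_suml; apply: eq_bigr => I _; rewrite scalerA.
  rewrite mul_adj_mx -scalemx1 rowsumZ rowsum1; congr (_ *: _).
  by rewrite /monos /mono2 /mono1 /mono /= mulr1.
apply: ComplexField.Normc.eq0_normc.
by rewrite -(lsn_scal hl) -e.
Qed.

End FiberEigenvalue.

(** * The matrix model *)

Section Matrices2.
Variable K : comPzRingType.
Implicit Types (a b c d : K).

Lemma mx2M a b c d a' b' c' d' : mx2 a b c d * mx2 a' b' c' d' =
  mx2 (a * a' + b * c') (a * b' + b * d') (c * a' + d * c') (c * b' + d * d').
Proof.
apply/matrixP => i j; rewrite !mxE big_ord_recl big_ord1 !mxE /=.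
by case: i => -[|[|//]] hi; case: j => -[|[|//]] hj.
Qed.

Lemma mx2D a b c d a' b' c' d' : mx2 a b c d + mx2 a' b' c' d' =
  mx2 (a + a') (b + b') (c + c') (d + d').
Proof.
apply/matrixP => i j; rewrite !mxE.
by case: i => -[|[|//]] hi; case: j => -[|[|//]] hj.
Qed.

Lemma mx2Z k a b c d : k *: mx2 a b c d = mx2 (k * a) (k * b) (k * c) (k * d).
Proof.
apply/matrixP => i j; rewrite !mxE.
by case: i => -[|[|//]] hi; case: j => -[|[|//]] hj.
Qed.

Lemma mx2_scalar a : mx2 a 0 0 a = a%:M.
Proof.
apply/matrixP => i j; rewrite !mxE.
by case: i => -[|[|//]] hi; case: j => -[|[|//]] hj.
Qed.

Lemma mx2_eta (M : 'M[K]_2) : M = mx2 (M 0 0) (M 0 1) (M 1 0) (M 1 1).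
Proof.
apply/matrixP => i j; rewrite !mxE.
case: i => -[|[|//]] hi; case: j => -[|[|//]] hj; congr (M _ _); exact: val_inj.
Qed.

Definition tl (M : 'M[K]_2) : 'M[K]_(2 * 2) := M *t (1%:M : 'M[K]_2).
Definition tr (M : 'M[K]_2) : 'M[K]_(2 * 2) := (1%:M : 'M[K]_2) *t M.

Lemma tlM M N : tl (M * N) = tl M * tl N.
Proof. by rewrite /tl -[RHS]/(_ *m _) tensmx_mul mulmx1. Qed.

Lemma trM M N : tr (M * N) = tr M * tr N.
Proof. by rewrite /tr -[RHS]/(_ *m _) tensmx_mul mulmx1. Qed.

Lemma tlD M N : tl (M + N) = tl M + tl N.
Proof. by apply/matrixP => i j; rewrite !mxE mulrDl. Qed.

Lemma trD M N : tr (M + N) = tr M + tr N.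
Proof. by apply/matrixP => i j; rewrite !mxE mulrDr. Qed.

Lemma tlZ k M : tl (k *: M) = k *: tl M.
Proof. by apply/matrixP => i j; rewrite !mxE mulrA. Qed.

Lemma trZ k M : tr (k *: M) = k *: tr M.
Proof. by apply/matrixP => i j; rewrite !mxE mulrCA. Qed.

Lemma tl1 : tl 1 = 1.
Proof.
apply/matrixP => i j; case: (mxtens_indexP i) => i1 i2.
case: (mxtens_indexP j) => j1 j2; rewrite tensmxE !mxE -natrM mulnb.
by rewrite (can_eq (@mxtens_indexK 2 2)) xpair_eqE.
Qed.

Lemma tr1 : tr 1 = 1. Proof. exact: tl1. Qed.

Lemma tens_tltr M N : (M *t N : 'M[K]_(2 * 2)) = tl M * tr N.
Proof. exact: tensmx_decr. Qed.

Lemma tltrC M N : tl M * tr N = tr N * tl M.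
Proof. by rewrite -tens_tltr [LHS]tensmx_decl. Qed.

End Matrices2.

Section ExactRightMultiplication.
Variables (R : realType) (A : algType R[i]) (g : bool -> bool -> A).
Hypothesis gW : wcar_central g.
Variables (z : bool -> bool -> R[i]) (t : bool -> R[i]).
Hypotheses (gz : forall i s, wsqr g i s = (z i s)%:A)
  (gt : forall s, wmix g s = (t s)%:A).

Lemma monos_reval (x : wterm R[i]) I :
  monos g I * weval (fun c => c%:A) g x = rowsum (monos g) (reval id z t x) I.
Proof.
elim: x I => [c|i s|x IHx y IHy|x IHx y IHy] I; rewrite /reval /=.
- by rewrite -scalemx1 rowsumZ rowsum1 mulr_algr.
- rewrite (monos_rmul gW) !gz !gt /rgen !mulr_algl; case: i.
    by rewrite !rowsumD !rowsumZ.
  by rewrite rowsumD rowsumZ.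
- by rewrite rowsumD mulrDr IHx IHy.
- rewrite mulrA IHx /rowsum mulr_suml.
  under eq_bigr => J _ do rewrite -scalerAl IHy /rowsum scaler_sumr.
  rewrite exchange_big; apply: eq_bigr => K _ /=.
  by rewrite mxE scaler_suml; apply: eq_bigr => J _; rewrite scalerA.
Qed.

End ExactRightMultiplication.

Section MatrixModel.
Variables (R : realType) (al be al2 be2 s rho : R[i]).
Local Notation C := R[i].
Hypotheses (alR : conjc al = al) (al2R : conjc al2 = al2) (sR : conjc s = s).
Hypotheses (ab1 : al ^+ 2 + be * conjc be = 1)
  (ab2 : al2 ^+ 2 + be2 * conjc be2 = 1) (sr : s ^+ 2 + rho * conjc rho = 1).

(** On D, [al] and [al2] are the roots of 1 - x1 and 1 - x2, [be] and [be2] are the phases times the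
    roots of x1 and x2, [s] is the root of 1 - r1^2 and [rho] is r1 e^(i phi). In these letters the
    matrix identities are polynomial. *)
Definition model_a1 : 'M[C]_4 := mx2 0 be al 0 *t (1%:M : 'M[C]_2).
Definition model_a2 : 'M[C]_4 :=
  s *: (mx2 1 0 0 (-1) *t mx2 0 be2 al2 0)
  + rho *: (mx2 0 al (- conjc be) 0 *t (1%:M : 'M[C]_2)).

Lemma mxstar_tens (M N : 'M[C]_2) :
  mxstar (M *t N : 'M[C]_4) = mxstar M *t mxstar N.
Proof. by apply/matrixP => i j; rewrite !mxE conjcM. Qed.

Lemma mxstarD n (M N : 'M[C]_n) : mxstar (M + N) = mxstar M + mxstar N.
Proof. by apply/matrixP => i j; rewrite !mxE conjcD. Qed.

Lemma mxstarZ n c (M : 'M[C]_n) : mxstar (c *: M) = conjc c *: mxstar M.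
Proof. by apply/matrixP => i j; rewrite !mxE conjcM. Qed.

Lemma mxstar_mx2 (a b c d : C) :
  mxstar (mx2 a b c d) = mx2 (conjc a) (conjc c) (conjc b) (conjc d).
Proof.
apply/matrixP => i j; rewrite !mxE.
by case: i => -[|[|//]] hi; case: j => -[|[|//]] hj.
Qed.

Lemma mxstar1 n : mxstar (1%:M : 'M[C]_n) = 1%:M.
Proof. by apply/matrixP => i j; rewrite !mxE eq_sym conjc_nat. Qed.

Definition model (i st : bool) : 'M[C]_4 :=
  let a := if i then model_a2 else model_a1 in if st then mxstar a else a.

(** The Jordan-Wigner sign: [S] anticommutes with the off-diagonal [u] and [c], so S tensor v
    anticommutes with u tensor 1 and c tensor 1. *)
Let S : 'M[C]_2 := mx2 1 0 0 (-1).
Let u st := if st then mx2 0 al (conjc be) 0 else mx2 0 be al 0 : 'M[C]_2.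
Let v st := if st then mx2 0 al2 (conjc be2) 0 else mx2 0 be2 al2 0 : 'M[C]_2.
Let c st := if st then mx2 0 (- be) al 0 else mx2 0 al (- conjc be) 0 : 'M[C]_2.
Let rh st := if st then conjc rho else rho.

Let mx2E := (mx2M, mx2D, mx2Z, mul0r, mulr0, add0r, addr0).

Lemma model1E st : model false st = tl (u st).
Proof.
rewrite /model; case: st => //; rewrite mxstar_tens mxstar1 mxstar_mx2.
by rewrite conjc0 alR.
Qed.

Lemma model2E st : model true st = s *: (tl S * tr (v st)) + rh st *: tl (c st).
Proof.
rewrite -tens_tltr /model; case: st => //.
rewrite mxstarD !mxstarZ !mxstar_tens mxstar1 !mxstar_mx2 !conjcN !conjcK.
by rewrite conjc0 conjc1 alR al2R sR.
Qed.

Let SS : S * S = 1.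
Proof. by rewrite /S !mx2E mulrNN !mulr1 mx2_scalar. Qed.

Let Su st : u st * S = - (S * u st).
Proof.
rewrite -scaleN1r /S /u; case: st; rewrite !mx2E; congr mx2; ring.
Qed.

Let Sc st : c st * S = - (S * c st).
Proof.
rewrite -scaleN1r /S /c; case: st; rewrite !mx2E; congr mx2; ring.
Qed.

Let uu st : u st * u st = (if st then al * conjc be else al * be)%:M.
Proof. by rewrite -mx2_scalar /u; case: st; rewrite !mx2E; congr mx2; ring. Qed.

Let vv st : v st * v st = (if st then al2 * conjc be2 else al2 * be2)%:M.
Proof. by rewrite -mx2_scalar /v; case: st; rewrite !mx2E; congr mx2; ring. Qed.

Let cc st : c st * c st = (if st then - (al * be) else - (al * conjc be))%:M.
Proof. by rewrite -mx2_scalar /c; case: st; rewrite !mx2E; congr mx2; ring. Qed.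

Let upair : u false * u true + u true * u false = 1.
Proof.
by rewrite -[1]mx2_scalar -ab1 /u !mx2E; congr mx2; ring.
Qed.

Let vpair : v false * v true + v true * v false = 1.
Proof.
by rewrite -[1]mx2_scalar -ab2 /v !mx2E; congr mx2; ring.
Qed.

Let cpair : c false * c true + c true * c false = 1.
Proof.
by rewrite -[1]mx2_scalar -ab1 /c !mx2E; congr mx2; ring.
Qed.

Let ucross st : u st * c (~~ st) + c (~~ st) * u st = 0.
Proof.
rewrite -(scale0r (1%:M : 'M[C]_2)) -mx2_scalar /u /c; case: st; rewrite !mx2E; congr mx2; ring.
Qed.

Let umix st : u st * c st + c st * u st = (al ^+ 2 - be * conjc be)%:M.
Proof.
by rewrite -mx2_scalar /u /c; case: st; rewrite !mx2E; congr mx2; ring.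
Qed.

Lemma anticomm_comb (A : algType C) (a b a' b' : C) (x y x' y' : A) :
  x * y' + y' * x = 0 -> y * x' + x' * y = 0 ->
  (a *: x + b *: y) * (a' *: x' + b' *: y')
  + (a' *: x' + b' *: y') * (a *: x + b *: y) =
  (a * a') *: (x * x' + x' * x) + (b * b') *: (y * y' + y' * y).
Proof.
move=> h1 h2; rewrite !mulrDl !mulrDr -!scalerAl -!scalerAr !scalerA !scalerDr.
rewrite [a' * a]mulrC [b' * b]mulrC [a' * b]mulrC [b' * a]mulrC.
rewrite [LHS](AC ((2*2)*(2*2)) ((1*5)*(4*8)*((2*7)*(3*6))))%AC /= -!scalerDr.
by rewrite h1 h2 !scaler0 !addr0.
Qed.

Let SvSv st st' : tl S * tr (v st) * (tl S * tr (v st')) = tr (v st * v st').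
Proof.
by rewrite -mulrA [tr _ * (tl _ * _)]mulrA -tltrC !mulrA -tlM SS tl1 mul1r trM.
Qed.

Let Sv_tl (M : 'M[C]_2) st : M * S = - (S * M) ->
  tl S * tr (v st) * tl M + tl M * (tl S * tr (v st)) = 0.
Proof.
move=> h; rewrite -mulrA -tltrC !mulrA -!tlM h -mulrDl -tlD subrr.
by rewrite -(scale0r 0) tlZ scale0r mul0r.
Qed.

Let model22 st st' :
  model true st * model true st' + model true st' * model true st =
  (s * s) *: tr (v st * v st' + v st' * v st)
  + (rh st * rh st') *: tl (c st * c st' + c st' * c st).
Proof.
rewrite !model2E anticomm_comb ?Sv_tl ?Sc //.
  by rewrite !SvSv trD tlD !tlM.
by rewrite addrC Sv_tl ?Sc.
Qed.

Let model12 st st' :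
  model false st * model true st' + model true st' * model false st =
  rh st' *: tl (u st * c st' + c st' * u st).
Proof.
rewrite model1E model2E -[tl (u st)]scale1r -[1 *: _]add0r -(scale0r 0).
rewrite anticomm_comb ?mul0r ?mulr0 ?addr0 //; last by rewrite addrC Sv_tl ?Su.
by rewrite scaler0 add0r mul1r tlD !tlM.
Qed.

(** Squares are read off from the anticommutator of an element with itself, which is twice the
    square. *)
Let half_eq (x y : 'M[C]_4) : x + x = y + y -> x = y.
Proof.
have e (w : 'M[C]_4) : w = 2^-1 *: (w + w).
  by rewrite -mulr2n -[w *+ 2]scaler_nat scalerA mulVf ?pnatr_eq0 // scale1r.
by move=> h; rewrite [x]e h -e.
Qed.

Let tl_scal (k : C) : tl k%:M = k%:M.
Proof. by rewrite -scalemx1 tlZ tl1 scalemx1. Qed.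

Let tr_scal (k : C) : tr k%:M = k%:M.
Proof. by rewrite -scalemx1 trZ tr1 scalemx1. Qed.

Definition model_z i st : C :=
  if i then if st then s * s * (al2 * conjc be2) - conjc rho * conjc rho * (al * be)
            else s * s * (al2 * be2) - rho * rho * (al * conjc be)
  else if st then al * conjc be else al * be.

Definition model_t st : C := (if st then conjc rho else rho) * (al ^+ 2 - be * conjc be).

Lemma model_sqr i st : wsqr model i st = (model_z i st)%:M.
Proof.
rewrite /wsqr /model_z; case: i; last by rewrite model1E -tlM uu tl_scal.
apply: half_eq; rewrite model22 vv cc -!raddfD /= tr_scal tl_scal.
rewrite !scale_scalar_mx -!raddfD; congr (_%:M).
by case: st; rewrite /rh /=; ring.
Qed.

Lemma model_mix st : wmix model st = (model_t st)%:M.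
Proof.
by rewrite /wmix model12 umix tl_scal scale_scalar_mx.
Qed.

Lemma model_wcar : wcar_central model.
Proof.
split.
- case.
    rewrite model22 vpair cpair /rh tr1 tl1 -scalerDl.
    by rewrite -[s * s]expr2 sr scale1r.
  by rewrite !model1E -!tlM -tlD upair tl1.
- by move=> st; rewrite model12 ucross -(scale0r 0) tlZ scale0r scaler0.
- by move=> i st j r; rewrite model_sqr -scalemx1 /GRing.comm mulr_algl mulr_algr.
- by move=> st j r; rewrite model_mix -scalemx1 /GRing.comm mulr_algl mulr_algr.
Qed.

(** On D these conditions read x1 < 1/2, x2 < 1/2 and r1 < 1. *)
Hypotheses (nd1 : al ^+ 2 != be * conjc be) (nd2 : al2 ^+ 2 != be2 * conjc be2)
  (nd3 : s != 0).

Let sp (X : 'M[C]_4) := exists t, X = weval (fun c => c%:A) model t.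

Let spM X Y : sp X -> sp Y -> sp (X * Y).
Proof. by move=> [t ->] [t' ->]; exists (WMul t t'). Qed.

Let spD X Y : sp X -> sp Y -> sp (X + Y).
Proof. by move=> [t ->] [t' ->]; exists (WAdd t t'). Qed.

Let spZ k X : sp X -> sp (k *: X).
Proof. by move=> [t ->]; exists (WMul (WConst k) t) => /=; rewrite mulr_algl. Qed.

Let spB X Y : sp X -> sp Y -> sp (X - Y).
Proof. by move=> sX sY; apply: spD => //; rewrite -scaleN1r; exact: spZ. Qed.

Let sp_g i st : sp (model i st). Proof. by exists (WGen _ i st). Qed.

(* From [(0, be; al, 0)] and its adjoint one recovers the matrix units. *)
Let units_of (f : 'M[C]_2 -> 'M[C]_4) (a b : C) :
  (forall M N, f (M + N) = f M + f N) -> (forall k M, f (k *: M) = k *: f M) ->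
  (forall M N, f (M * N) = f M * f N) ->
  a ^+ 2 != b * conjc b ->
  sp (f (mx2 0 b a 0)) -> sp (f (mx2 0 a (conjc b) 0)) -> forall M, sp (f M).
Proof.
move=> fD fZ fM nd h1 h2.
have nd' : a ^+ 2 - b * conjc b != 0 by rewrite subr_eq0.
have e12 : sp (f (mx2 0 1 0 0)).
  have -> : mx2 0 1 0 0 = (a ^+ 2 - b * conjc b)^-1 *:
      (a *: mx2 0 a (conjc b) 0 + (- conjc b) *: mx2 0 b a 0) :> 'M[C]_2.
    by rewrite !mx2E; congr mx2; field.
  by rewrite fZ fD !fZ; do 2 apply: spZ || apply: spD; exact: spZ.
have e21 : sp (f (mx2 0 0 1 0)).
  have -> : mx2 0 0 1 0 = (a ^+ 2 - b * conjc b)^-1 *: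
      (a *: mx2 0 b a 0 + (- b) *: mx2 0 a (conjc b) 0) :> 'M[C]_2.
    by rewrite !mx2E; congr mx2; field.
  by rewrite fZ fD !fZ; do 2 apply: spZ || apply: spD; exact: spZ.
move=> M; rewrite (mx2_eta M).
have -> : mx2 (M 0 0) (M 0 1) (M 1 0) (M 1 1) =
    M 0 0 *: (mx2 0 1 0 0 * mx2 0 0 1 0) + M 0 1 *: mx2 0 1 0 0
    + M 1 0 *: mx2 0 0 1 0 + M 1 1 *: (mx2 0 0 1 0 * mx2 0 1 0 0) :> 'M[C]_2.
  by rewrite !mx2E; congr mx2; ring.
rewrite !fD !fZ !fM; do 3 (apply: spD; last by apply: spZ => //; exact: spM).
by apply: spZ; exact: spM.
Qed.

(** The first generator and its adjoint yield all M tensor 1. Subtracting the [c] part of the second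
    generator and cancelling S tensor 1 leaves 1 tensor v, which yields all 1 tensor M. *)
Lemma model_span (X : 'M[C]_4) : exists t, X = weval (fun c => c%:A) model t.
Proof.
have hl : forall M, sp (tl M).
  apply: (units_of (@tlD C) (@tlZ C) (@tlM C) nd1).
    by have := sp_g false false; rewrite model1E.
  by have := sp_g false true; rewrite model1E.
have hv st : sp (tr (v st)).
  have -> : tr (v st) = s^-1 *: (tl S * (model true st - rh st *: tl (c st))).
    rewrite model2E addrK -scalerAr scalerA mulVf // scale1r mulrA -tlM SS.
    by rewrite tl1 mul1r.
  by apply: spZ; apply: spM => //; apply: spB => //; exact: spZ.
have hr : forall M, sp (tr M).
  by apply: (units_of (@trD C) (@trZ C) (@trM C) nd2); [exact: (hv false)|exact: (hv true)].
rewrite [X]matrix_sum_delta.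
apply: (big_ind sp); [|exact: spD|move=> i _].
  by exists (WConst 0) => /=; rewrite scale0r.
apply: (big_ind sp); [|exact: spD|move=> j _].
  by exists (WConst 0) => /=; rewrite scale0r.
apply: spZ.
case: (@mxtens_indexP 2 2 i) => i1 i2; case: (@mxtens_indexP 2 2 j) => j1 j2.
have -> : delta_mx (mxtens_index (i1, i2)) (mxtens_index (j1, j2)) =
    delta_mx i1 j1 *t delta_mx i2 j2 :> 'M[C]_(2 * 2).
  apply/matrixP => k l; case: (mxtens_indexP k) => k1 k2.
  case: (mxtens_indexP l) => l1 l2; rewrite tensmxE !mxE -natrM mulnb.
  by rewrite !(can_eq (@mxtens_indexK 2 2)) !xpair_eqE andbACA.
by rewrite tens_tltr; exact: spM.
Qed.

(** Sixteen monomials span a space of dimension sixteen, so they are independent. A null row of the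
    16 x 16 matrix thus gives a nonzero Y with Y Q = mu Y, and any nonzero row of Y is an
    eigenvector. *)
Lemma model_eigenvalue (x : wterm C) (mu : C) :
  \det (reval id model_z model_t x - mu%:M) = 0 ->
  exists2 y : 'rV[C]_4, y != 0 &
    y *m weval (fun c => c%:A) model x = mu *: y.
Proof.
move=> det0.
have hz i st : wsqr model i st = (model_z i st)%:A by rewrite model_sqr scalemx1.
have ht st : wmix model st = (model_t st)%:A by rewrite model_mix scalemx1.
have ex := monos_reval model_wcar hz ht.
set e := monos model in ex.
have span X : exists k, X = \sum_J k J *: e J.
  have [t ->] := model_span X; exists (reval id model_z model_t t 0).
  by rewrite -[RHS]/(rowsum e _ 0) -ex /e /monos /mono2 /mono1 /mono /= !mul1r.
pose W : 'M[C]_(4 * 4) := \matrix_I mxvec (e I).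
have Wfull : row_full W.
  rewrite -sub1mx; apply/row_subP => i.
  rewrite -[row i _]vec_mxK; have [k ->] := span (vec_mx (row i 1%:M)).
  rewrite linear_sum; apply: summx_sub => J _; rewrite linearZ /=.
  by apply: scalemx_sub; rewrite -(rowK (fun I => mxvec (e I)) J); exact: row_sub.
have Wfree : row_free W by move: Wfull; rewrite /row_full /row_free.
have /det0P [k k0 kM] : \det (reval id model_z model_t x - mu%:M) == 0 by apply/eqP.
pose Y := \sum_J k 0 J *: e J.
have Y0 : Y != 0.
  apply: contra k0 => /eqP Y0; rewrite -(mulmx_free_eq0 _ Wfree).
  have -> : k *m W = mxvec Y.
    rewrite mulmx_sum_row linear_sum; apply: eq_bigr => J _.
    by rewrite linearZ rowK.
  by rewrite Y0 linear0.
have YX : Y *m weval (fun c => c%:A) model x = mu *: Y.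
  have kR J : \sum_I k 0 I * reval id model_z model_t x I J = mu * k 0 J.
    move/eqP : kM; rewrite mulmxBr mul_mx_scalar subr_eq0 => /eqP /matrixP /(_ 0 J).
    by rewrite !mxE.
  rewrite -[LHS]/(Y * _) /Y mulr_suml.
  under eq_bigr => I _ do rewrite -scalerAl ex /rowsum scaler_sumr.
  rewrite exchange_big scaler_sumr; apply: eq_bigr => J _ /=.
  rewrite scalerA -kR scaler_suml; apply: eq_bigr => I _.
  by rewrite scalerA.
have [i [j Yij]] := matrix0Pn _ Y0.
exists (row i Y); last by rewrite -row_mul YX linearZ.
by apply: contra Yij => /eqP /matrixP /(_ 0 j); rewrite !mxE => ->.
Qed.

End MatrixModel.

(** * From central values to points of D *)

Section Points.
Variable R : realType.
Local Notation C := R[i].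

Lemma normc_phase (c : C) : exists2 w, normc w = 1 & c = (normc c)%:C * w.
Proof.
have [->|c0] := eqVneq c 0.
  by exists 1; rewrite ?ComplexField.Normc.normc1 // ComplexField.Normc.normc0 mul0r.
have n0 : normc c != 0 by apply: contra c0 => /eqP/ComplexField.Normc.eq0_normc ->.
exists (c / (normc c)%:C).
  rewrite ComplexField.Normc.normcM ComplexField.Normc.normcV normc_real.
  by rewrite ger0_norm ?normc_ge0 // divff.
by rewrite mulrC divfK // eq_complex /= eqxx andbT.
Qed.

Lemma normcX (c : C) n : normc (c ^+ n) = normc c ^+ n.
Proof.
elim: n => [|n IH]; first by rewrite !expr0 ComplexField.Normc.normc1.
by rewrite !exprS ComplexField.Normc.normcM IH.
Qed.

Lemma normc_conj (c : C) : normc (conjc c) = normc c.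
Proof. by case: c => a b; rewrite /normc /= sqrrN. Qed.

Lemma mulc_conj (c : C) : c * conjc c = (normc c ^+ 2)%:C.
Proof.
rewrite normc_sqr; case: c => a b; apply/eqP; rewrite eq_complex /=.
by apply/andP; split; apply/eqP; ring.
Qed.

Lemma quad_bound (a : R) (m : C) :
  (forall b : C, 0 <= a * normc b ^+ 2 + 2 * complex.Re (b ^+ 2 * m)) ->
  2 * normc m <= a.
Proof.
move=> h; have a0 : 0 <= a.
  have h1 := h 1; have hi := h 'i%C.
  rewrite expr1n ComplexField.Normc.normc1 expr1n mul1r in h1.
  rewrite sqr_i mulN1r in hi.
  have ni : normc 'i%C ^+ 2 = 1 :> R by rewrite normc_sqr /=; ring.
  by rewrite ni raddfN /= in hi; lra.
(* The worst phase: with this b, b ^+ 2 * m is minus the squared modulus of m. *)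
have := h (sqrtc (- conjc m)); rewrite -normcX sqr_sqrtc normcN normc_conj.
rewrite mulNr mulrC [conjc m * m]mulrC mulc_conj raddfN /=.
have := normc_ge0 m; set n := normc m; rewrite le_eqVlt => /predU1P[<-|n0].
  by rewrite mulr0.
rewrite mulrN subr_ge0 expr2 mulrA [n * a]mulrC => h2.
by rewrite -(ler_pM2r n0).
Qed.

(* The minimum over [al] of the left-hand side, attained at the given [al]. *)
Lemma schur_complement (z g : C) : let W := 1 - 4 * normc z ^+ 2 in W != 0 ->
  let al := - (conjc g - 2 * conjc z * g) * (W^-1)%:C in
  normc al ^+ 2 + 2 * complex.Re (al ^+ 2 * z + al * g) =
  - (normc g ^+ 2 - 2 * complex.Re (conjc z * g ^+ 2)) / W.
Proof.
move=> W W0 al; rewrite /al; move: W0; rewrite /W !normc_sqr.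
by case: z g {W al} => [u v] [g h] /= W0; field.
Qed.

Lemma half_disc_polar (z : C) : normc z < 2^-1 -> exists (x : R) (w : C),
  [/\ 0 <= x < 2^-1, normc w = 1, z = w * csqrt x * csqrt (1 - x)
    & (1 - 2 * x) ^+ 2 = 1 - 4 * normc z ^+ 2].
Proof.
move=> z2; have z0 := normc_ge0 z.
pose W := 1 - 4 * normc z ^+ 2.
have W0 : 0 < W.
  rewrite /W subr_gt0 (_ : 4 * _ = (2 * normc z) ^+ 2); last by ring.
  by rewrite expr_lt1 ?mulr_ge0 //; lra.
pose o := Num.sqrt W; have o0 : 0 < o by rewrite sqrtr_gt0.
have o_sqr : o ^+ 2 = W by rewrite sqr_sqrtr // ltW.
have o1 : o <= 1.
  rewrite -(ler_pXn2r (n := 2)) ?nnegrE ?(ltW o0) // expr1n o_sqr /W.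
  by rewrite gerBl mulr_ge0 // sqr_ge0.
(* The smaller root of x (1 - x) = |z|^2; thus 1 - 2 x = [o]. *)
pose x := (1 - o) / 2.
have [w w1 zw] := normc_phase z.
have x0 : 0 <= x by rewrite /x; lra.
have x1 : 0 <= 1 - x by rewrite /x; lra.
exists x, w; split=> //.
- by rewrite x0 /= /x; lra.
- rewrite {1}zw -mulrA [RHS]mulrC; congr (_ * w).
  rewrite /csqrt -rmorphM -sqrtrM //; congr _%:C.
  have -> : x * (1 - x) = normc z ^+ 2.
    rewrite (_ : x * (1 - x) = (1 - o ^+ 2) / 4); last by rewrite /x; field.
    by rewrite o_sqr /W; field.
  by rewrite sqrtr_sqr ger0_norm.
- by rewrite -/W -o_sqr /x; field.
Qed.

Definition mgens (p : domD R) (i st : bool) : 'M[C]_4 :=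
  let a := if i then mat_a2 R p else mat_a1 R p in if st then mxstar a else a.

Lemma csqrt_conj (x : R) : conjc (csqrt x) = csqrt x.
Proof. exact: conjc_real. Qed.

Lemma csqrt_sqr (x : R) : 0 <= x -> csqrt x ^+ 2 = x%:C.
Proof. by move=> x0; rewrite -rmorphXn /= sqr_sqrtr. Qed.

Definition evm (p : domD R) (t : wterm C) : 'M[C]_4 :=
  weval (fun c => c%:A) (mgens p) t.

(** The margin e makes all inequalities strict. Setting be = 0 puts [z1] in the open half-disc,
    hence x1 and its phase; then 1 - 2 x1 > 0 can be divided out of [t] to give [rho]; minimizing
    over al leaves a quadratic condition in be that confines the rest. *)
Lemma psd_point (e : R) (z1 z2 t : C) : 0 < e ->
  (forall al be : C, e * (normc al ^+ 2 + normc be ^+ 2) <=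
    normc al ^+ 2 + normc be ^+ 2
    + 2 * complex.Re (al ^+ 2 * z1 + be ^+ 2 * z2 + al * be * t)) ->
  exists (p : domD R) (al be al2 be2 s rho : C),
  [/\ [/\ conjc al = al, conjc al2 = al2, conjc s = s, al ^+ 2 + be * conjc be = 1
        & al2 ^+ 2 + be2 * conjc be2 = 1 ],
      [/\ s ^+ 2 + rho * conjc rho = 1, al ^+ 2 != be * conjc be,
          al2 ^+ 2 != be2 * conjc be2 & s != 0],
      mgens p = model al be al2 be2 s rho
    & [/\ al * be = z1, s * s * (al2 * be2) - rho * rho * (al * conjc be) = z2
        & rho * (al ^+ 2 - be * conjc be) = t]].
Proof.
move=> e0 h.
have z1h : normc z1 < 2^-1.
  have : 2 * normc z1 <= 1 - e; last by lra.
  apply: quad_bound => b; have := h b 0.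
  have [e1 e2] : (0 : R) ^+ 2 = 0 /\ (0 : C) ^+ 2 = 0 by rewrite !expr0n.
  rewrite ComplexField.Normc.normc0 e1 e2 mulr0 !mul0r !addr0.
  lra.
have [x1 [w1 [/andP[x10 x12] nw1 z1E W1]]] := half_disc_polar z1h.
set W := 1 - 4 * _ in W1.
have o0 : 0 < 1 - 2 * x1 by lra.
have W0 : 0 < W by rewrite -W1 exprn_gt0.
have [rho tE] : exists rho, t = rho * (1 - 2 * x1)%:C.
  exists (t * ((1 - 2 * x1)^-1)%:C).
  by rewrite -mulrA -rmorphM mulVf ?mulr1 // gt_eqF.
(* Since z2 = s^2 al2 be2 - rho^2 conj(z1) is wanted, [m] has to be (1 - r^2) al2 be2. *)
pose m := z2 + conjc z1 * rho ^+ 2.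
pose r := normc rho.
have mh : 2 * normc m <= 1 - r ^+ 2 - e.
  apply: quad_bound => b.
  (* The minimizing al for this b, from [schur_complement] with g = b t. *)
  have := h (- (conjc (b * t) - 2 * conjc z1 * (b * t)) * (W^-1)%:C) b.
  set al := - _ * _ => hab.
  have := @schur_complement z1 (b * t) (lt0r_neq0 W0); rewrite -/W -/al => sc.
  have n1 : normc (b * t) ^+ 2 / W = normc b ^+ 2 * r ^+ 2.
    rewrite tE !ComplexField.Normc.normcM normc_real gtr0_norm // -W1 -/r.
    by field; rewrite gt_eqF.
  have n2 : complex.Re (conjc z1 * (b * t) ^+ 2) / W =
            complex.Re (b ^+ 2 * (conjc z1 * rho ^+ 2)).
    rewrite tE -W1.
    have -> : conjc z1 * (b * (rho * (1 - 2 * x1)%:C)) ^+ 2 =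
       ((1 - 2 * x1) ^+ 2)%:C * (b ^+ 2 * (conjc z1 * rho ^+ 2)).
      by rewrite rmorphXn /=; ring.
    case: (b ^+ 2 * _) => p q /=; rewrite mul0r subr0 mulrAC mulfV ?mul1r //.
    by rewrite gt_eqF // exprn_gt0.
  have ReD (u v : C) : complex.Re (u + v) = complex.Re u + complex.Re v by exact: raddfD.
  have e1 : al ^+ 2 * z1 + b ^+ 2 * z2 + al * b * t =
            (al ^+ 2 * z1 + al * (b * t)) + b ^+ 2 * z2 by ring.
  have e2 : b ^+ 2 * m = b ^+ 2 * z2 + b ^+ 2 * (conjc z1 * rho ^+ 2).
    by rewrite /m mulrDr.
  have a0 : 0 <= e * normc al ^+ 2 by rewrite mulr_ge0 ?sqr_ge0 // ltW.
  rewrite e1 ReD mulrDr in hab; rewrite e2 ReD -n2.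
  move: sc => /=; rewrite mulNr mulrBl n1 -[2 * _ / W]mulrA => sc.
  lra.
have r0 : 0 <= r by exact: normc_ge0.
have m0 := normc_ge0 m.
have r1 : r ^+ 2 < 1 by lra.
have r1' : r < 1 by rewrite -(ltr_pXn2r (n := 2)) ?nnegrE // expr1n.
have s0 : 0 < 1 - r ^+ 2 by lra.
pose z2' := m * ((1 - r ^+ 2)^-1)%:C.
have z2h : normc z2' < 2^-1.
  rewrite /z2' ComplexField.Normc.normcM normc_real ger0_norm ?invr_ge0 ?(ltW s0) //.
  rewrite ltr_pdivrMr //; lra.
have [x2 [w2 [/andP[x20 x22] nw2 z2E _]]] := half_disc_polar z2h.
have [w nw rhoE] := normc_phase rho.
have pD : domD R (r, x1, x2, w, w1, w2).
  split; split; rewrite ?normc_normE ?nw ?nw1 ?nw2 ?rmorph1 //; first by rewrite r0 ltW.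
  - by rewrite x10 ltW.
  - by rewrite x20 ltW.
have nn (x : R) (u : C) : 0 <= x -> normc u = 1 ->
    u * csqrt x * conjc (u * csqrt x) = x%:C.
  move=> x0 u1; rewrite mulc_conj ComplexField.Normc.normcM u1 mul1r.
  by rewrite normc_real ger0_norm ?sqrtr_ge0 // sqr_sqrtr.
have x11 : 0 <= 1 - x1 by lra.
have x21 : 0 <= 1 - x2 by lra.
have sE : csqrt (1 - r ^+ 2) ^+ 2 = (1 - r ^+ 2)%:C by rewrite csqrt_sqr // ltW.
exists (SigSub (mem_set pD)).
exists (csqrt (1 - x1)), (w1 * csqrt x1), (csqrt (1 - x2)), (w2 * csqrt x2).
exists (csqrt (1 - r ^+ 2)), rho; split.
- by rewrite !csqrt_conj !csqrt_sqr // !nn // -!rmorphD !subrK rmorph1.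
- rewrite !csqrt_sqr ?(ltW s0) // !nn // mulc_conj -rmorphD subrK rmorph1; split=> //.
  + by rewrite (inj_eq (@complexI R)); apply/eqP; lra.
  + by rewrite (inj_eq (@complexI R)); apply/eqP; lra.
  + by rewrite eq_complex /= eqxx andbT sqrtr_eq0 -ltNge.
- have a1E : mat_a1 R (SigSub (mem_set pD)) = model_a1 (csqrt (1 - x1)) (w1 * csqrt x1).
    by [].
  have a2E : mat_a2 R (SigSub (mem_set pD)) =
      model_a2 (csqrt (1 - x1)) (w1 * csqrt x1) (csqrt (1 - x2)) (w2 * csqrt x2)
        (csqrt (1 - r ^+ 2)) rho.
    by rewrite /model_a2 rhoE conjcM csqrt_conj.
  apply/funext => i; apply/funext => st.
  by rewrite /mgens /model a1E a2E.
- rewrite csqrt_sqr // nn // -rmorphB; split.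
  + by rewrite z1E mulrC.
  + rewrite -expr2 sE.
    have -> : csqrt (1 - x2) * (w2 * csqrt x2) = z2' by rewrite z2E mulrC.
    have -> : csqrt (1 - x1) * conjc (w1 * csqrt x1) = conjc z1.
      by rewrite z1E !conjcM !csqrt_conj mulrC.
    rewrite /z2' mulrCA -rmorphM mulfV ?gt_eqF // mulr1 /m; ring.
  + by rewrite tE; congr (_ * _%:C); ring.
Qed.

End Points.

(** * Euclidean norm of vectors and adjoint matrices *)

Section VectorNorm.
Variables (R : realType) (n : nat).
Local Notation C := R[i].
Implicit Types (u v : 'cV[C]_n) (X : 'M[C]_n).

Lemma cauchy_schwarz_sum (I : finType) (a b : I -> R) :
  \sum_i a i * b i <=
  Num.sqrt (\sum_i a i ^+ 2) * Num.sqrt (\sum_i b i ^+ 2).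
Proof.
set D := \sum_i _ * _; set A := \sum_i a i ^+ 2; set B := \sum_i b i ^+ 2.
have A0 : 0 <= A by apply: sumr_ge0 => i _; exact: sqr_ge0.
have B0 : 0 <= B by apply: sumr_ge0 => i _; exact: sqr_ge0.
have AB : D ^+ 2 <= A * B.
  have : 0 <= \sum_i (a i * B - b i * D) ^+ 2.
    by apply: sumr_ge0 => i _; exact: sqr_ge0.
  have -> : \sum_i (a i * B - b i * D) ^+ 2 = B * (A * B - D ^+ 2).
    have e (x y : R) : \sum_i (a i * x - b i * y) ^+ 2 =
        x ^+ 2 * A - 2 * x * y * D + y ^+ 2 * B.
      rewrite /A /D /B !mulr_sumr -sumrB -big_split.
      by apply: eq_bigr => i _ /=; ring.
    by rewrite e; ring.
  move: B0; rewrite le_eqVlt => /predU1P[B0 _|B0].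
    have b0 i : b i = 0.
      apply/eqP; rewrite -sqrf_eq0; apply/eqP.
      by apply: (@psumr_eq0P _ _ predT (fun i => b i ^+ 2)) => // j _; exact: sqr_ge0.
    by rewrite /D big1 ?expr0n ?mulr_ge0 -?B0 //= => i _; rewrite b0 mulr0.
  by rewrite pmulr_rge0 // subr_ge0.
rewrite -sqrtrM //; apply: le_trans (ler_norm _) _.
by rewrite -sqrtr_sqr ler_sqrt // mulr_ge0.
Qed.

Definition vnorm v : R := Num.sqrt (\sum_i normc (v i 0) ^+ 2).

Definition vdot u v : C := \sum_i conjc (u i 0) * v i 0.

Lemma vnorm_ge0 v : 0 <= vnorm v. Proof. exact: sqrtr_ge0. Qed.

Lemma vnorm_sqr v : vnorm v ^+ 2 = \sum_i normc (v i 0) ^+ 2.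
Proof. by rewrite sqr_sqrtr // sumr_ge0 // => i _; exact: sqr_ge0. Qed.

Lemma vdot_norm v : vdot v v = (vnorm v ^+ 2)%:C.
Proof.
rewrite vnorm_sqr rmorph_sum; apply: eq_bigr => i _.
by rewrite mulrC mulc_conj.
Qed.

Lemma normc_sum (I : finType) (f : I -> C) : normc (\sum_i f i) <= \sum_i normc (f i).
Proof.
apply: (big_ind2 (fun x y => normc x <= y)) => //.
  by rewrite ComplexField.Normc.normc0.
move=> x1 x2 y1 y2 h1 h2; apply: le_trans (lerD h1 h2).
exact: le_normcD.
Qed.

Lemma vdot_le u v : normc (vdot u v) <= vnorm u * vnorm v.
Proof.
apply: le_trans (normc_sum _) _; apply: le_trans (cauchy_schwarz_sum _ _).
by apply: ler_sum => i _; rewrite ComplexField.Normc.normcM normc_conj.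
Qed.

Lemma vnormD u v : vnorm (u + v) <= vnorm u + vnorm v.
Proof.
rewrite -(ler_pXn2r (n := 2)) ?nnegrE ?addr_ge0 ?vnorm_ge0 // sqrrD !vnorm_sqr.
have cs := cauchy_schwarz_sum (fun i => normc (u i 0)) (fun i => normc (v i 0)).
rewrite -/(vnorm u) -/(vnorm v) in cs.
apply: (@le_trans _ _ (\sum_i (normc (u i 0) + normc (v i 0)) ^+ 2)).
  apply: ler_sum => i _; rewrite mxE.
  by apply: lerXn2r; rewrite ?nnegrE ?addr_ge0 ?normc_ge0 // le_normcD.
under eq_bigr do rewrite sqrrD.
rewrite !big_split /= lerD2r lerD2l.
by rewrite mulr2n lerD.
Qed.

Lemma vnormZ c v : vnorm (c *: v) = normc c * vnorm v.
Proof.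
apply/eqP; rewrite -(eqrXn2 (n := 2)) ?mulr_ge0 ?normc_ge0 ?vnorm_ge0 //.
rewrite exprMn !vnorm_sqr mulr_sumr; apply/eqP; apply: eq_bigr => i _.
by rewrite mxE ComplexField.Normc.normcM exprMn.
Qed.

Lemma vnorm0 : vnorm 0 = 0.
Proof. by rewrite -(scale0r 0) vnormZ ComplexField.Normc.normc0 mul0r. Qed.

Lemma vnorm_eq0 v : vnorm v = 0 -> v = 0.
Proof.
move=> v0; apply/matrixP => i j; rewrite ord1 mxE.
apply/ComplexField.Normc.eq0_normc/eqP; rewrite -sqrf_eq0; apply/eqP.
apply: (@psumr_eq0P _ _ predT (fun i => normc (v i 0) ^+ 2)) => //.
  by move=> k _; exact: sqr_ge0.
by rewrite -vnorm_sqr v0 expr0n.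
Qed.

Lemma vdot_mulmx X u v : vdot u (X *m v) = vdot (mxstar X *m u) v.
Proof.
rewrite /vdot; under eq_bigr do rewrite mxE mulr_sumr.
rewrite exchange_big; apply: eq_bigr => j _ /=.
rewrite mxE (big_morph conjc (@conjcD R) (@conjc0 _)) mulr_suml.
apply: eq_bigr => i _; rewrite !mxE conjcM conjcK; ring.
Qed.

Lemma mxstarK X : mxstar (mxstar X) = X.
Proof. by apply/matrixP => i j; rewrite !mxE conjcK. Qed.

Lemma mxstarM X (Y : 'M[C]_n) : mxstar (X *m Y) = mxstar Y *m mxstar X.
Proof.
apply/matrixP => i j; rewrite !mxE (big_morph conjc (@conjcD R) (@conjc0 _)).
by apply: eq_bigr => k _; rewrite !mxE conjcM mulrC.
Qed.

(** The adjoint v of the left eigenvector is a right eigenvector of the self-adjoint X* X, so |X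
    v|^2 = mu |v|^2. *)
Lemma eigen_bound X (M : R) (mu : C) (y : 'rV[C]_n) : 0 <= M ->
  (forall v, vnorm (X *m v) <= M * vnorm v) -> y != 0 ->
  y *m (mxstar X *m X) = mu *: y -> normc mu <= M ^+ 2.
Proof.
move=> M0 hX y0 yX; pose v : 'cV[C]_n := map_mx conjc y^T.
have v0 : 0 < vnorm v.
  rewrite lt_neqAle vnorm_ge0 andbT eq_sym; apply: contra y0 => /eqP/vnorm_eq0 v0.
  apply/eqP/matrixP => i j; have /matrixP /(_ j i) := v0; rewrite !mxE => h.
  by rewrite -[y i j]conjcK h conjc0.
have Xv : mxstar X *m X *m v = conjc mu *: v.
  apply/matrixP => i j; have /matrixP /(_ j i) := yX; rewrite !mxE => h.
  rewrite -conjcM -h (big_morph conjc (@conjcD R) (@conjc0 _)).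
  apply: eq_bigr => k _; rewrite !mxE conjcM mulrC; congr (_ * _).
  rewrite (big_morph conjc (@conjcD R) (@conjc0 _)).
  by apply: eq_bigr => l _; rewrite !mxE conjcM conjcK mulrC.
have e : (vnorm (X *m v) ^+ 2)%:C = mu * (vnorm v ^+ 2)%:C.
  rewrite -!vdot_norm vdot_mulmx mulmxA Xv /vdot mulr_sumr.
  by apply: eq_bigr => i _; rewrite mxE conjcM conjcK mulrA.
have := congr1 (@ComplexField.Normc.normc R) e; rewrite ComplexField.Normc.normcM !normc_real.
rewrite !ger0_norm ?sqr_ge0 // => e2.
rewrite -(ler_pM2r (exprn_gt0 2 v0)) -e2 -exprMn.
by apply: lerXn2r; rewrite ?nnegrE ?mulr_ge0 ?vnorm_ge0.
Qed.

End VectorNorm.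

(** * The norm inequality *)

Section MainInequality.
Variable R : realType.
Local Notation C := R[i].

Lemma map_rgen (K L : comNzRingType) (f : {rmorphism K -> L}) z t i st :
  map_mx f (rgen z t i st) = rgen (fun i s => f (z i s)) (fun s => f (t s)) i st.
Proof.
have m4 (e : seq (seq int)) : map_mx f (mat4 K e) = mat4 L e.
  by apply/matrixP => k l; rewrite !mxE rmorph_int.
by rewrite /rgen; case: i; rewrite !map_mxD !map_mxZ !map_mxT ?map_mx1 !m4.
Qed.

(** The determinant is the product of the n differences mu - l over the roots l of the
    characteristic polynomial. *)
Lemma det_lower n (A : 'M[C]_n) (mu : C) (d : R) : 0 <= d ->
  (forall l, eigenvalue A l -> d <= normc (mu - l)) ->
  d ^+ n <= normc (\det (mu%:M - A)).
Proof.
move=> d0 h.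
have -> : \det (mu%:M - A) = (char_poly A).[mu].
  rewrite /char_poly -horner_evalE -det_map_mx; congr (\det _).
  by apply/matrixP => i j; rewrite !mxE !rmorphB /= rmorphMn /= !horner_evalE hornerX hornerC.
have [r hr] := closed_field_poly_normal (char_poly A).
have mon := char_poly_monic A; rewrite (monicP mon) scale1r in hr.
have sz : size r = n.
  by apply/eqP; rewrite -eqSS -(size_prod_XsubC r id) -hr size_char_poly.
have hroot l : l \in r -> d <= normc (mu - l).
  by move=> lr; apply: h; rewrite eigenvalue_root_char hr root_prod_XsubC.
rewrite hr -sz; elim: r {hr sz} hroot => [|l r IH] hroot.
  by rewrite big_nil hornerC expr0 ComplexField.Normc.normc1.
rewrite big_cons hornerM ComplexField.Normc.normcM hornerXsubC exprS.
apply: ler_pM => //; [exact: exprn_ge0|by apply: hroot; rewrite mem_head|].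
by apply: IH => k kr; apply: hroot; rewrite in_cons kr orbT.
Qed.

Lemma poly_normc_bound (p : {poly C}) :
  exists2 K : R, 0 <= K & forall x, normc x <= 1 -> normc p.[x] <= K.
Proof.
elim/poly_ind: p => [|p c [K K0 hK]].
  by exists 0 => // x _; rewrite horner0 ComplexField.Normc.normc0.
exists (K + normc c); first by rewrite addr_ge0 ?normc_ge0.
move=> x x1; rewrite hornerD hornerM hornerX hornerC.
apply: le_trans (le_normcD _ _) _; rewrite lerD2r ComplexField.Normc.normcM.
by rewrite -[leRHS]mulr1; apply: ler_pM; rewrite ?normc_ge0 ?hK.
Qed.

(** A zero at 0 would split off a factor X and force |p(e)| <= K e on the unit interval. This
    replaces continuity of eigenvalues in the limit eps to 0. *)
Lemma poly_no_jump (p : {poly C}) (c : R) : 0 < c ->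
  (forall e : R, 0 < e <= 1 -> c <= normc p.[e%:C]) -> p.[0] != 0.
Proof.
move=> c0 h; apply/negP => p0.
have /factor_theorem [q qE] : root p 0 by [].
have [K K0 hK] := poly_normc_bound q.
pose e := Num.min 1 (c / (2 * (K + 1))).
have K1 : 0 < 2 * (K + 1) by rewrite mulr_gt0 // ltr_wpDl.
have e0 : 0 < e by rewrite lt_min ltr01 divr_gt0.
have e1 : e <= 1 by rewrite ge_min lexx.
have ec : e <= c / (2 * (K + 1)) by rewrite ge_min lexx orbT.
have ne : normc e%:C = e by rewrite normc_real gtr0_norm.
have := h e; rewrite e0 e1 => /(_ isT).
rewrite qE hornerM hornerXsubC subr0 ComplexField.Normc.normcM ne leNgt => /negP; apply.
have hq : normc q.[e%:C] <= K by apply: hK; rewrite ne.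
apply: (@le_lt_trans _ _ (K * (c / (2 * (K + 1))))).
  by apply: ler_pM => //; rewrite ?normc_ge0 // ltW.
rewrite mulrA ltr_pdivrMr //; nra.
Qed.

Lemma mgens_star (p : domD R) i st : mxstar (mgens p i st) = mgens p i (~~ st).
Proof. by rewrite /mgens; case: st; rewrite //= mxstarK. Qed.

Lemma evm_star (p : domD R) t : mxstar (evm p t) = evm p (wstar t).
Proof.
elim: t => [c|i s|x IHx y IHy|x IHx y IHy] /=.
- by rewrite /evm /= mxstarZ mxstar1.
- exact: mgens_star.
- by rewrite /evm /= mxstarD -!/(evm p _) IHx IHy.
- by rewrite /evm /= mxstarM -!/(evm p _) IHx IHy.
Qed.

(* [f e] is the characteristic determinant at the shrunken point [(1 - e) z],
   [(1 - e) t]; it vanishes at [e = 0], but stays away from 0 for [0 < e <= 1]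
   if [mu] exceeds all the eigenvalues [l], which are bounded by [M ^+ 2]. *)
Theorem main_inequality (B : cstarAlgType R) (b1 b2 : B) (P : wterm C) (M : R) :
  wcar_rel b1 b2 -> 0 <= M ->
  (forall (p : domD R) v, vnorm (evm p P *m v) <= M * vnorm v) ->
  cnorm (ev b1 b2 P) <= M.
Proof.
move=> bW M0 hM; rewrite -(ler_pXn2r (n := 2)) ?nnegrE ?cnorm_ge0 // -cnorm_star.
pose Q := WMul (wstar P) P.
have QE : star (ev b1 b2 P) * ev b1 b2 P = ev b1 b2 Q by rewrite ev_star.
rewrite QE.
have QS : star (ev b1 b2 Q) = ev b1 b2 Q by rewrite -QE starM starK.
have [z [t [mu [muE [zS tS] psd det0]]]] := exists_fiber bW QS.
rewrite -muE leNgt; apply/negP => muM.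
pose d := normc mu - M ^+ 2; have d0 : 0 < d by rewrite subr_gt0.
pose f : {poly C} := \det ((mu%:P)%:M - reval polyC
  (fun i s => (1 - 'X) * (z i s)%:P) (fun s => (1 - 'X) * (t s)%:P) Q).
have fE (e : C) : f.[e] = \det (mu%:M - reval id
    (fun i s => (1 - e) * z i s) (fun s => (1 - e) * t s) Q).
  rewrite /f -horner_evalE -det_map_mx map_mxB map_scalar_mx; congr (\det (_%:M - _)).
    by rewrite /= horner_evalE hornerC.
  apply: weval_morph => [c|i s].
    by rewrite /= map_scalar_mx /= horner_evalE hornerC.
  rewrite /= map_rgen; congr rgen; apply/funext => j; try (apply/funext => s').
    by rewrite /= horner_evalE hornerM hornerD hornerN hornerX !hornerC.
  by rewrite /= horner_evalE hornerM hornerD hornerN hornerX !hornerC.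
have f0 : f.[0] = 0.
  rewrite fE.
  have -> : (fun i s => (1 - 0) * z i s) = z.
    by apply/funext => i; apply/funext => s; rewrite subr0 mul1r.
  have -> : (fun s => (1 - 0) * t s) = t by apply/funext => s; rewrite subr0 mul1r.
  apply/eqP/det0P; have /eqP/det0P [v v0 hv] := det0; exists v => //.
  by rewrite -opprB mulmxN hv oppr0.
suff : f.[0] != 0 by rewrite f0 eqxx.
(* The exponent is the size 4 * 4 of the matrix of right multiplication. *)
apply: (@poly_no_jump _ (d ^+ 16)); first exact: exprn_gt0.
move=> e /andP[e0 e1]; rewrite fE.
(* Shrinking turns the form N + 2 Re q into e N + (1 - e) (N + 2 Re q), which supplies the margin e
   N required by [psd_point]. *)
have hpsd (al be : C) : e * (normc al ^+ 2 + normc be ^+ 2) <=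
    normc al ^+ 2 + normc be ^+ 2
    + 2 * complex.Re (al ^+ 2 * ((1 - e%:C) * z false false)
       + be ^+ 2 * ((1 - e%:C) * z true false) + al * be * ((1 - e%:C) * t false)).
  have := psd al be; set N := _ + _ ^+ 2; set q := (X in complex.Re X) => h.
  rewrite (_ : al ^+ 2 * _ + _ + _ = (1 - e)%:C * q); last first.
    by rewrite /q rmorphB rmorph1; ring.
  have -> : complex.Re ((1 - e)%:C * q) = (1 - e) * complex.Re q.
    by case: q {h} => a b /=; rewrite mul0r subr0.
  nra.
have [p [al [be [al2 [be2 [s [rho [[c1 c2 c3 h1 h2] [h3 n1 n2 n3] pE [v1 v2 v3]]]]]]]]] :=
  psd_point e0 hpsd.
apply: det_lower; first exact: ltW.
move=> l /eigenvalueP [y yl y0].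
have zE : (fun i s => (1 - e%:C) * z i s) = model_z al be al2 be2 s rho.
  have zc i : (1 - e%:C) * z i true = conjc ((1 - e%:C) * z i false).
    by rewrite conjcM conjcD conjcN conjc1 conjc_real zS.
  apply/funext => -[]; apply/funext => -[]; rewrite /model_z.
  - by rewrite zc -v2 conjcD conjcN !conjcM conjcK c1 c2 c3.
  - by rewrite -v2.
  - by rewrite zc -v1 conjcM c1.
  - by rewrite -v1.
have tE : (fun s => (1 - e%:C) * t s) = model_t al be rho.
  have tc : (1 - e%:C) * t true = conjc ((1 - e%:C) * t false).
    by rewrite conjcM conjcD conjcN conjc1 conjc_real tS.
  apply/funext => -[]; rewrite /model_t.
    rewrite tc -v3 conjcM conjcD conjcN expr2 !conjcM conjcK c1.
    by rewrite [conjc be * be]mulrC.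
  by rewrite -v3.
rewrite zE tE in yl.
have : \det (reval id (model_z al be al2 be2 s rho) (model_t al be rho) Q - l%:M) = 0.
  apply/eqP/det0P; exists y => //.
  by rewrite mulmxBr yl mul_mx_scalar subrr.
move=> /(model_eigenvalue c1 c2 c3 h1 h2 h3 n1 n2 n3) [y' y'0]; rewrite -pE.
rewrite -/(evm p Q).
have -> : evm p Q = mxstar (evm p P) *m evm p P by rewrite evm_star.
move=> /(eigen_bound M0 (hM p) y'0) lM.
rewrite /d lerBlDr; apply: (@le_trans _ _ (normc (mu - l) + normc l)).
  by rewrite -{1}(subrK l mu) le_normcD.
by rewrite lerD2l.
Qed.

End MainInequality.

(** * The C*-algebra of matrix functions *)

Section MatrixFunctions.
Variable R : realType.
Local Notation C := R[i].
Local Notation T := (domD R).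
Local Notation F := (domD R -> 'M[R[i]]_4).
Implicit Types (f g h : F) (c d e : R).

Definition fbound f c := 0 <= c /\ forall p v, vnorm (f p *m v) <= c * vnorm v.

Definition evf t : F := fun p => evm p t.

(** The uniform closure of the *-polynomials in the two matrix functions, in operator-norm terms;
    [approximable_generated] identifies it with the generated C*-algebra. *)
Definition approximable f := forall e, 0 < e -> exists t, fbound (f - evf t) e.

Lemma fboundD f g c d : fbound f c -> fbound g d -> fbound (f + g) (c + d).
Proof.
move=> [c0 hf] [d0 hg]; split; first exact: addr_ge0.
move=> p v; rewrite [(f + g) p]/(f p + g p) mulmxDl mulrDl.
by apply: le_trans (vnormD _ _) _; exact: lerD.
Qed.

Lemma fboundZ f (k : C) c : fbound f c -> fbound (k *: f) (normc k * c).
Proof.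
move=> [c0 hf]; split; first by rewrite mulr_ge0 ?normc_ge0.
move=> p v; rewrite [(k *: f) p]/(k *: f p) -scalemxAl vnormZ -mulrA.
by rewrite ler_wpM2l ?normc_ge0.
Qed.

Lemma fboundN f c : fbound f c -> fbound (- f) c.
Proof.
move=> /(fboundZ (-1)); rewrite scaleN1r normcN ComplexField.Normc.normc1.
by rewrite mul1r.
Qed.

Lemma fboundM f g c d : fbound f c -> fbound g d -> fbound (f * g) (c * d).
Proof.
move=> [c0 hf] [d0 hg]; split; first exact: mulr_ge0.
move=> p v; rewrite [(f * g) p]/(f p *m g p) -mulmxA -mulrA.
by apply: le_trans (hf _ _) _; rewrite ler_wpM2l.
Qed.

Lemma fboundS f c : fbound f c -> fbound (fstar f) c.
Proof.
move=> [c0 hf]; split=> // p v; set u := _ *m v.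
have [->|u0] := eqVneq (vnorm u) 0; first by rewrite mulr_ge0 ?vnorm_ge0.
have up : 0 < vnorm u by rewrite lt_neqAle eq_sym u0 vnorm_ge0.
rewrite -(ler_pM2l up) -expr2.
have -> : vnorm u ^+ 2 = normc (vdot u u).
  by rewrite vdot_norm normc_real ger0_norm ?sqr_ge0.
rewrite {2}/u vdot_mulmx mxstarK.
apply: le_trans (vdot_le _ _) _; rewrite mulrCA mulrA.
by rewrite ler_wpM2r ?vnorm_ge0.
Qed.

Lemma fbound_le f c d : c <= d -> fbound f c -> fbound f d.
Proof.
move=> cd [c0 hf]; split; first exact: le_trans cd.
by move=> p v; apply: le_trans (hf _ _) _; rewrite ler_wpM2r ?vnorm_ge0.
Qed.

Lemma fbound_scal (k : C) : fbound (fun=> k%:A) (normc k).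
Proof.
split=> [|p v]; first exact: normc_ge0.
by rewrite -scalemxAl mul1mx vnormZ.
Qed.

Lemma fbound_sqrt f c : fbound (fstar f * f) c -> fbound f (Num.sqrt c).
Proof.
move=> [c0 hf]; split=> [|p v]; first exact: sqrtr_ge0.
rewrite -(ler_pXn2r (n := 2)) ?nnegrE ?mulr_ge0 ?sqrtr_ge0 ?vnorm_ge0 //.
rewrite exprMn (sqr_sqrtr c0).
have -> : vnorm (f p *m v) ^+ 2 = normc (vdot (f p *m v) (f p *m v)).
  by rewrite vdot_norm normc_real ger0_norm ?sqr_ge0.
rewrite vdot_mulmx mulmxA; apply: le_trans (vdot_le _ _) _.
by rewrite [_ ^+ 2 in leRHS]expr2 mulrA ler_wpM2r ?vnorm_ge0 // hf.
Qed.

Lemma mgens_model (p : T) : exists al be al2 be2 s rho : C,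
  [/\ conjc al = al, conjc al2 = al2, conjc s = s &
  [/\ al ^+ 2 + be * conjc be = 1, al2 ^+ 2 + be2 * conjc be2 = 1,
      s ^+ 2 + rho * conjc rho = 1 & mgens p = model al be al2 be2 s rho]].
Proof.
case: p => [[[[[[r x1] x2] w] w1] w2] pD].
have [[/andP[r0 r1] /andP[x10 x12] /andP[x20 x22]] [nw nw1 nw2]] := set_mem pD.
have n1 (u : C) : `|u| = 1 -> normc u = 1.
  by move=> h; apply: complexI; rewrite -normc_normE h rmorph1.
exists (csqrt (1 - x1)), (w1 * csqrt x1), (csqrt (1 - x2)), (w2 * csqrt x2).
exists (csqrt (1 - r ^+ 2)), (r%:C * w).
have nn (x : R) (u : C) : 0 <= x -> `|u| = 1 ->
    u * csqrt x * conjc (u * csqrt x) = x%:C.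
  move=> x0 /n1 u1; rewrite mulc_conj ComplexField.Normc.normcM u1 mul1r.
  by rewrite normc_real ger0_norm ?sqrtr_ge0 // sqr_sqrtr.
have r21 : r ^+ 2 <= 1 by rewrite expr_le1.
split; [exact: csqrt_conj|exact: csqrt_conj|exact: csqrt_conj|split].
- by rewrite csqrt_sqr ?nn // -?rmorphD ?subrK ?rmorph1 //; lra.
- by rewrite csqrt_sqr ?nn // -?rmorphD ?subrK ?rmorph1 //; lra.
- rewrite csqrt_sqr ?subr_ge0 // mulc_conj ComplexField.Normc.normcM (n1 _ nw).
  by rewrite mulr1 normc_real ger0_norm // -rmorphD subrK rmorph1.
- apply/funext => i; apply/funext => st; rewrite /mgens /model.
  have -> : mat_a1 R (SigSub pD) = model_a1 (csqrt (1 - x1)) (w1 * csqrt x1) by [].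
  have -> : mat_a2 R (SigSub pD) =
      model_a2 (csqrt (1 - x1)) (w1 * csqrt x1) (csqrt (1 - x2)) (w2 * csqrt x2)
        (csqrt (1 - r ^+ 2)) (r%:C * w).
    by rewrite /model_a2 conjcM csqrt_conj.
  by [].
Qed.

Lemma mgens_wcar (p : T) : wcar_central (mgens p).
Proof.
have [al [be [al2 [be2 [s [rho [h1 h2 h3 [h4 h5 h6 ->]]]]]]]] := mgens_model p.
exact: model_wcar.
Qed.

(** The relation a* a + a a* = 1 gives |a v|^2 + |a* v|^2 = |v|^2. *)
Lemma fbound_gen i st : fbound (fun p => mgens p i st) 1.
Proof.
split=> // p v; rewrite mul1r -(ler_pXn2r (n := 2)) ?nnegrE ?vnorm_ge0 //.
rewrite -lecR; have e : (vnorm v ^+ 2)%:C = (vnorm (mgens p i st *m v) ^+ 2)%:C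
    + (vnorm (mgens p i (~~ st) *m v) ^+ 2)%:C.
  rewrite -!vdot_norm !vdot_mulmx !mgens_star negbK !mulmxA.
  have -> : vdot v v = vdot (1%:M *m v) v by rewrite mul1mx.
  have := wc_pair (mgens_wcar p) i => h.
  have -> : 1%:M = mgens p i (~~ st) *m mgens p i st + mgens p i st *m mgens p i (~~ st).
    rewrite -[1%:M]h; case: st => //=; exact: addrC.
  rewrite mulmxDl /vdot -big_split; apply: eq_bigr => k _ /=.
  by rewrite [in LHS]mxE conjcD mulrDl.
by rewrite e lerDl ler0c sqr_ge0.
Qed.

Lemma evf_bound t : exists c, fbound (evf t) c.
Proof.
elim: t => [k|i st|x [c hc] y [d hd]|x [c hc] y [d hd]].
- by exists (normc k); exact: fbound_scal.
- by exists 1; exact: fbound_gen.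
- by exists (c + d); exact: fboundD hc hd.
- by exists (c * d); exact: fboundM hc hd.
Qed.

Lemma evf_star t : fstar (evf t) = evf (wstar t).
Proof. by apply/funext => p; exact: evm_star. Qed.

Lemma approximable_ev t : approximable (evf t).
Proof.
move=> e e0; exists t; rewrite subrr; split; first exact: ltW.
by move=> p v; rewrite mul0mx vnorm0 mulr_ge0 ?vnorm_ge0 // ltW.
Qed.

Lemma approximable_bound f : approximable f -> exists c, fbound f c.
Proof.
move=> /(_ 1 ltr01) [t ht]; have [c hc] := evf_bound t.
by exists (1 + c); have := fboundD ht hc; rewrite subrK.
Qed.

Lemma approximableD f g : approximable f -> approximable g -> approximable (f + g).
Proof.
move=> hf hg e e0; have e20 : 0 < e / 2 by rewrite divr_gt0.
have [t ht] := hf _ e20; have [u hu] := hg _ e20; exists (WAdd t u).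
have := fboundD ht hu; rewrite -splitr.
by rewrite (_ : f - _ + _ = f + g - evf (WAdd t u)) // opprD addrACA.
Qed.

Lemma approximableM f g : approximable f -> approximable g -> approximable (f * g).
Proof.
move=> hf hg e e0; have [c [c0 hc]] := approximable_bound hg.
have c1 : 0 < c + 1 by rewrite ltr_wpDl.
have e10 : 0 < e / 2 / (c + 1) by rewrite !divr_gt0.
have [t ht] := hf _ e10; have [d [d0 hd]] := evf_bound t.
have d1 : 0 < d + 1 by rewrite ltr_wpDl.
have e20 : 0 < e / 2 / (d + 1) by rewrite !divr_gt0.
have [u hu] := hg _ e20; exists (WMul t u).
have -> : f * g - evf (WMul t u) = (f - evf t) * g + evf t * (g - evf u).
  by rewrite mulrBl mulrBr addrA subrK.
apply: fbound_le (fboundD (fboundM ht (conj c0 hc)) (fboundM (conj d0 hd) hu)).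
rewrite [leRHS]splitr lerD //.
  by rewrite -mulrA ler_piMr ?divr_ge0 ?(ltW e0) // mulrC ler_pdivrMr // mul1r lerDl.
by rewrite mulrCA ler_piMr ?divr_ge0 ?(ltW e0) // ler_pdivrMr // mul1r lerDl.
Qed.

Lemma approximableZ (k : C) f : approximable f -> approximable (k *: f).
Proof.
move=> hf; have -> : k *: f = evf (WConst k) * f; last first.
  exact: approximableM (approximable_ev _) hf.
by apply/funext => p; exact/esym/(mulr_algl k (f p)).
Qed.

Lemma approximableS f : approximable f -> approximable (fstar f).
Proof.
move=> hf e e0; have [t ht] := hf _ e0; exists (wstar t).
have := fboundS ht; rewrite (_ : fstar _ = fstar f - evf (wstar t)) //.
rewrite -evf_star; apply/funext => p; rewrite /fstar.
by apply/matrixP => i j; rewrite !mxE conjcD conjcN.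
Qed.

Lemma approximable_lim f :
  (forall e, 0 < e -> exists2 g, approximable g & fbound (f - g) e) ->
  approximable f.
Proof.
move=> h e e0; have e20 : 0 < e / 2 by rewrite divr_gt0.
have [g ag hg] := h _ e20; have [t ht] := ag _ e20; exists t.
by have := fboundD hg ht; rewrite -splitr addrA subrK.
Qed.

(** A crude constant: each coordinate is at most 4 d |v|, so the norm is at most 8 d |v|. *)
Lemma vnorm_entries (X : 'M[C]_4) d v :
  (forall i j, normc (X i j) <= d) -> vnorm (X *m v) <= 16%:R * d * vnorm v.
Proof.
move=> h; have d0 : 0 <= d by apply: le_trans (h 0 0); exact: normc_ge0.
have vk k : normc (v k 0) <= vnorm v.
  rewrite -(ler_pXn2r (n := 2)) ?nnegrE ?normc_ge0 ?vnorm_ge0 // vnorm_sqr.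
  by rewrite (bigD1 k) //= lerDl sumr_ge0 // => j _; exact: sqr_ge0.
have Xk i : normc ((X *m v) i 0) <= 4%:R * d * vnorm v.
  rewrite mxE; apply: le_trans (normc_sum _) _.
  apply: (@le_trans _ _ (\sum_(j < 4) d * vnorm v)).
    apply: ler_sum => j _; rewrite ComplexField.Normc.normcM.
    by apply: ler_pM; rewrite ?normc_ge0.
  by rewrite sumr_const card_ord -mulrA mulr_natl.
rewrite -(ler_pXn2r (n := 2)) ?nnegrE ?mulr_ge0 ?vnorm_ge0 // vnorm_sqr.
apply: (@le_trans _ _ (\sum_(j < 4) (4%:R * d * vnorm v) ^+ 2)).
  by apply: ler_sum => j _; apply: lerXn2r; rewrite ?nnegrE ?mulr_ge0 ?normc_ge0 ?vnorm_ge0.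
rewrite sumr_const card_ord -[_ *+ 4]mulr_natl.
have := sqr_ge0 (d * vnorm v); nra.
Qed.

Lemma entry_le (X : 'M[C]_4) c : (forall v, vnorm (X *m v) <= c * vnorm v) ->
  forall i j, normc (X i j) <= c.
Proof.
move=> h i j; have := h (delta_mx j 0).
have -> : vnorm (delta_mx j 0 : 'cV[C]_4) = 1.
  rewrite /vnorm (bigD1 j) //= mxE !eqxx ComplexField.Normc.normc1 expr1n big1.
    by rewrite addr0 sqrtr1.
  by move=> k kj; rewrite mxE (negbTE kj) ComplexField.Normc.normc0 expr0n.
rewrite mulr1; apply: le_trans.
rewrite -colE -(ler_pXn2r (n := 2)) ?nnegrE ?normc_ge0 ?vnorm_ge0 // vnorm_sqr.
by rewrite (bigD1 i) //= mxE lerDl sumr_ge0 // => k _; exact: sqr_ge0.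
Qed.

(** Meaningful for bounded functions only: an unbounded [f] gets the default infimum of the empty
    set. Approximable functions are bounded, and for them the infimum is attained. *)
Definition fnorm f : R := inf [set c | fbound f c].

Lemma fnorm_le f c : fbound f c -> fnorm f <= c.
Proof. by move=> h; apply: ge_inf => //; exists 0 => d []. Qed.

Lemma fnorm_bound f : approximable f -> fbound f (fnorm f).
Proof.
move=> /approximable_bound [c hc].
have n0 : [set c | fbound f c] !=set0 by exists c.
split; first by apply: lb_le_inf => // d [].
move=> p v; have [v0|v0] := eqVneq (vnorm v) 0.
  by have := hc.2 p v; rewrite v0 !mulr0.
have vp : 0 < vnorm v by rewrite lt_neqAle eq_sym v0 vnorm_ge0.
rewrite -ler_pdivrMr //; apply: lb_le_inf => // d [_ hd].
by rewrite ler_pdivrMr.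
Qed.

Lemma fbound0 f : fbound f 0 -> f = 0.
Proof.
move=> [_ h]; apply/funext => p; apply/matrixP => i j; rewrite mxE.
apply/ComplexField.Normc.eq0_normc/eqP; rewrite eq_le normc_ge0 andbT.
exact: entry_le (h p) _ _.
Qed.

Lemma real_cauchy (x : nat -> R) :
  (forall e, 0 < e -> exists N, forall m n, (N <= m)%N -> (N <= n)%N ->
     `|x m - x n| <= e) ->
  exists l, forall e, 0 < e -> exists N, forall n, (N <= n)%N -> `|x n - l| <= e.
Proof.
move=> h; have /cvg_ex [l xl] : cvg (x @ \oo).
  apply/cauchy_cvgP/cauchy_exP => e e0.
  have [N hN] := h _ (divr_gt0 e0 (ltr0n R 2)).
  exists (x N); exists N => // n Nn; apply: le_lt_trans (hN _ _ (leqnn N) Nn) _.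
  by rewrite ltr_pdivrMr // ltr_pMr // ltr1n.
exists l => e e0; have /cvgrPdist_le /(_ _ e0) [N _ hN] := xl.
by exists N => n Nn; rewrite distrC; exact: hN.
Qed.

Lemma complex_cauchy (x : nat -> C) :
  (forall e, 0 < e -> exists N, forall m n, (N <= m)%N -> (N <= n)%N ->
     normc (x m - x n) <= e) ->
  exists l, forall e, 0 < e -> exists N, forall n, (N <= n)%N -> normc (x n - l) <= e.
Proof.
move=> h.
have Re_le (c : C) : `|complex.Re c| <= normc c.
  by case: c => a b /=; rewrite -sqrtr_sqr ler_sqrt ?addr_ge0 ?sqr_ge0 // lerDl sqr_ge0.
have Im_le (c : C) : `|complex.Im c| <= normc c.
  by case: c => a b /=; rewrite -sqrtr_sqr ler_sqrt ?addr_ge0 ?sqr_ge0 // lerDr sqr_ge0.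
have [|a ha] := @real_cauchy (fun n => complex.Re (x n)).
  move=> e /h [N hN]; exists N => m n Nm Nn.
  by rewrite -raddfB; apply: le_trans (Re_le _) (hN _ _ Nm Nn).
have [|b hb] := @real_cauchy (fun n => complex.Im (x n)).
  move=> e /h [N hN]; exists N => m n Nm Nn.
  by rewrite -raddfB; apply: le_trans (Im_le _) (hN _ _ Nm Nn).
exists (a +i* b) => e e0; have e20 : 0 < e / 2 by rewrite divr_gt0.
have [N1 h1] := ha _ e20; have [N2 h2] := hb _ e20.
exists (maxn N1 N2) => n; rewrite geq_max => /andP[n1 n2].
have nle (c : C) : normc c <= `|complex.Re c| + `|complex.Im c|.
  rewrite -(ler_pXn2r (n := 2)) ?nnegrE ?normc_ge0 ?addr_ge0 // normc_sqr sqrrD.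
  by rewrite !real_normK ?num_real // addrAC lerDl mulrn_wge0 ?mulr_ge0.
apply: le_trans (nle _) _; rewrite [leRHS]splitr.
by case: (x n) (h1 _ n1) (h2 _ n2) => u w /= hu hw; exact: lerD.
Qed.

Lemma fbound_complete (u : nat -> F) :
  (forall e, 0 < e -> exists N, forall m n, (N <= m)%N -> (N <= n)%N ->
     fbound (u m - u n) e) ->
  exists l : F, forall e, 0 < e -> exists N, forall n, (N <= n)%N -> fbound (u n - l) e.
Proof.
move=> h.
have hl p i j : exists l, forall e, 0 < e ->
    exists N, forall n, (N <= n)%N -> normc (u n p i j - l) <= e.
  apply: complex_cauchy => e /h [N hN]; exists N => m n Nm Nn.
  by have := entry_le ((hN _ _ Nm Nn).2 p) i j; rewrite !mxE.
have [l0 hl0] := @choice _ _ (fun (q : T * 'I_4 * 'I_4) l => forall e, 0 < e ->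
    exists N, forall n, (N <= n)%N -> normc (u n q.1.1 q.1.2 q.2 - l) <= e)
    (fun q => hl q.1.1 q.1.2 q.2).
exists (fun p => \matrix_(i, j) l0 (p, i, j)) => e e0.
have [N hN] := h _ e0; exists N => n Nn; split=> [|p v]; first exact: ltW.
set l := fun p => _; apply/ler_addgt0Pr => d d0.
have d1 : 0 < d / (16%:R * (vnorm v + 1)).
  by rewrite divr_gt0 // mulr_gt0 // ltr_wpDl ?vnorm_ge0.
(* [M] may depend on the point p and on v; uniformity in p comes from the Cauchy index [N]. *)
have [M hM] : exists M, forall m, (M <= m)%N -> forall i j,
    normc (u m p i j - l p i j) <= d / (16%:R * (vnorm v + 1)).
  have [M hM] := @choice _ _ (fun (q : 'I_4 * 'I_4) N => forall n, (N <= n)%N ->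
    normc (u n p q.1 q.2 - l0 (p, q.1, q.2)) <= d / (16%:R * (vnorm v + 1)))
    (fun q => hl0 (p, q.1, q.2) _ d1).
  exists (\max_q M q) => m Mm i j; rewrite /l mxE; apply: (hM (i, j)).
  by apply: leq_trans Mm; exact: leq_bigmax.
pose m := maxn N M.
have -> : (u n - l) p *m v = (u n - u m) p *m v + (u m p - l p) *m v.
  by rewrite -mulmxDl; congr (_ *m v); rewrite [RHS]addrA subrK.
apply: le_trans (vnormD _ _) _; apply: lerD.
  by apply: (hN _ _ Nn (leq_maxl _ _)).2.
apply: le_trans (vnorm_entries (d := d / (16%:R * (vnorm v + 1))) _ _) _.
  by move=> i j; have := hM m (leq_maxr _ _) i j; rewrite !mxE.
have v1 : 0 < vnorm v + 1 by rewrite ltr_wpDl ?vnorm_ge0.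
rewrite (_ : _ * _ * _ = d * (vnorm v / (vnorm v + 1))); last by field; rewrite gt_eqF.
by rewrite ler_piMr ?(ltW d0) // ler_pdivrMr // mul1r lerDl.
Qed.

End MatrixFunctions.

(** The boolean reflection makes this a subtype, so that [wval] is injective and algebraic laws can
    be checked on functions. *)
Record wfunctions (R : realType) := WFunctions {
  wval : domD R -> 'M[R[i]]_4;
  _ : `[< approximable wval >]
}.

HB.instance Definition _ (R : realType) := [isSub for @wval R].
HB.instance Definition _ (R : realType) := [Choice of wfunctions R by <:].

Section WFunctions.
Variable R : realType.
Local Notation C := R[i].
Local Notation A := (wfunctions R).
Implicit Types x y z : A.

Definition mkw f (h : approximable f) : A := WFunctions (asboolT h).

Lemma wvalP x : approximable (wval x).
Proof. by case: x => f h; exact: asboolW h. Qed.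

Lemma wval_inj : injective (@wval R).
Proof. exact: val_inj. Qed.

Definition w0 : A := mkw (approximableZ 0 (approximable_ev (WGen _ false false))).
Definition w1 : A := mkw (approximable_ev (WConst 1)).
Definition wadd x y : A := mkw (approximableD (wvalP x) (wvalP y)).
Definition wscale (k : C) x : A := mkw (approximableZ k (wvalP x)).
Definition wopp x : A := wscale (-1) x.
Definition wmul x y : A := mkw (approximableM (wvalP x) (wvalP y)).
Definition wstr x : A := mkw (approximableS (wvalP x)).

Let waddA : associative wadd.
Proof. by move=> x y z; apply: wval_inj; exact: addrA. Qed.
Let waddC : commutative wadd.
Proof. by move=> x y; apply: wval_inj; exact: addrC. Qed.
Let wadd0 : left_id w0 wadd.
Proof. by move=> x; apply: wval_inj; rewrite /= scale0r add0r. Qed.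
Let waddN : left_inverse w0 wopp wadd.
Proof. by move=> x; apply: wval_inj; rewrite /= scale0r scaleN1r addNr. Qed.

HB.instance Definition _ := GRing.isZmodule.Build A waddA waddC wadd0 waddN.

Lemma w1E : wval w1 = 1.
Proof. by apply/funext => p; rewrite /= /evf /evm /= scale1r. Qed.

Let wmulA : associative wmul.
Proof. by move=> x y z; apply: wval_inj; exact: mulrA. Qed.
Let wmul1l : left_id w1 wmul.
Proof. by move=> x; apply: wval_inj; rewrite [LHS]/(wval w1 * wval x) w1E; exact: mul1r. Qed.
Let wmul1r : right_id w1 wmul.
Proof. by move=> x; apply: wval_inj; rewrite [LHS]/(wval x * wval w1) w1E; exact: mulr1. Qed.
Let wmulDl : left_distributive wmul +%R.
Proof. by move=> x y z; apply: wval_inj; exact: mulrDl. Qed.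
Let wmulDr : right_distributive wmul +%R.
Proof. by move=> x y z; apply: wval_inj; exact: mulrDr. Qed.

(** A point of D is needed to separate 1 from 0 in the algebra of functions. *)
Definition dom_point : domD R.
Proof.
apply: (SigSub (x := (0, 0, 0, 1, 1, 1))); apply/mem_set.
by split; split; rewrite ?lexx ?ler01 ?invr_ge0 ?ler0n ?normr1.
Defined.

Let w1_neq0 : w1 != 0.
Proof.
apply/eqP => /(congr1 (fun x => wval x dom_point 0 0)).
rewrite w1E /= [LHS]mxE eqxx /= => /eqP.
by rewrite [X in _ == X]mxE mul0r oner_eq0.
Qed.

HB.instance Definition _ :=
  GRing.Zmodule_isNzRing.Build A wmulA wmul1l wmul1r wmulDl wmulDr w1_neq0.

Let wscaleA k l x : wscale k (wscale l x) = wscale (k * l) x.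
Proof. by apply: wval_inj; exact: scalerA. Qed.
Let wscale1 : left_id 1 wscale.
Proof. by move=> x; apply: wval_inj; exact: scale1r. Qed.
Let wscaleDr : right_distributive wscale +%R.
Proof. by move=> k x y; apply: wval_inj; exact: scalerDr. Qed.
Let wscaleDl x : {morph wscale^~ x : k l / k + l}.
Proof. by move=> k l; apply: wval_inj; exact: scalerDl. Qed.

HB.instance Definition _ :=
  GRing.Zmodule_isLmodule.Build C A wscaleA wscale1 wscaleDr wscaleDl.

Let wscaleAl (k : C) x y : k *: (x * y) = (k *: x) * y.
Proof. by apply: wval_inj; apply/funext => p; exact: scalerAl. Qed.
HB.instance Definition _ := GRing.Lmodule_isLalgebra.Build C A wscaleAl.

Let wscaleAr (k : C) x y : k *: (x * y) = x * (k *: y).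
Proof. by apply: wval_inj; apply/funext => p; exact: scalerAr. Qed.
HB.instance Definition _ := GRing.Lalgebra_isAlgebra.Build C A wscaleAr.

Definition wnorm x : R := fnorm (wval x).

Lemma wnorm_bound x : fbound (wval x) (wnorm x).
Proof. exact: fnorm_bound (wvalP x). Qed.

Let wstrK : involutive wstr.
Proof. by move=> x; apply: wval_inj; apply/funext => p; exact: mxstarK. Qed.
Let wstrD : {morph wstr : x y / x + y}.
Proof. by move=> x y; apply: wval_inj; apply/funext => p; exact: mxstarD. Qed.
Let wstrZ (k : C) x : wstr (k *: x) = (k^*)%C *: wstr x.
Proof. by apply: wval_inj; apply/funext => p; exact: mxstarZ. Qed.
Let wstrM x y : wstr (x * y) = wstr y * wstr x.
Proof. by apply: wval_inj; apply/funext => p; exact: mxstarM. Qed.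

Let wnorm_eq0 x : wnorm x = 0 -> x = 0.
Proof.
move=> x0; apply: wval_inj; have := wnorm_bound x; rewrite x0 => /fbound0 ->.
by apply/esym; exact: scale0r.
Qed.

Let wnormD x y : wnorm (x + y) <= wnorm x + wnorm y.
Proof. by apply: fnorm_le; apply: fboundD; exact: wnorm_bound. Qed.

Let wnormZ (k : C) x : wnorm (k *: x) = normc k * wnorm x.
Proof.
have le (l : C) y : wnorm (l *: y) <= normc l * wnorm y.
  by apply: fnorm_le; apply: fboundZ; exact: wnorm_bound.
apply/eqP; rewrite eq_le le /=; have [->|k0] := eqVneq k 0.
  by rewrite ComplexField.Normc.normc0 mul0r; case: (wnorm_bound (0 *: x)).
have := le k^-1 (k *: x); rewrite scalerA mulVf // scale1r.
rewrite ComplexField.Normc.normcV ler_pdivlMl // lt_neqAle normc_ge0 andbT.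
by rewrite eq_sym; apply: contra k0 => /eqP/ComplexField.Normc.eq0_normc->.
Qed.

Let wnormM x y : wnorm (x * y) <= wnorm x * wnorm y.
Proof. by apply: fnorm_le; apply: fboundM; exact: wnorm_bound. Qed.

Let wnorm_star x : wnorm (wstr x * x) = wnorm x ^+ 2.
Proof.
have x0 : 0 <= wnorm x by case: (wnorm_bound x).
apply/eqP; rewrite eq_le; apply/andP; split.
  rewrite expr2; apply: fnorm_le; apply: fboundM; last exact: wnorm_bound.
  by apply: fboundS; exact: wnorm_bound.
have hs : wnorm x <= Num.sqrt (wnorm (wstr x * x)).
  by apply: fnorm_le; apply: fbound_sqrt; exact: wnorm_bound (wstr x * x).
have [xx0 _] := wnorm_bound (wstr x * x).
rewrite -[leRHS](sqr_sqrtr xx0).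
have [x0' s0] := (x0, sqrtr_ge0 (wnorm (wstr x * x))).
by rewrite -nnegrE in x0' s0; rewrite (ler_sqr x0' s0).
Qed.

Lemma wvalB x y : wval (x - y) = wval x - wval y.
Proof. by rewrite -[- wval y]scaleN1r. Qed.

Let wnorm_complete (u : nat -> A) :
  (forall e : R, 0 < e -> exists N : nat, forall m n : nat,
      (N <= m)%N -> (N <= n)%N -> wnorm (u m - u n) < e) ->
  exists l : A, (fun n => wnorm (u n - l)) @ \oo --> (0 : R).
Proof.
move=> h; have [|l hl] := @fbound_complete R (fun n => wval (u n)).
  move=> e /h [N hN]; exists N => m n Nm Nn; rewrite -wvalB.
  by apply: fbound_le (wnorm_bound _); exact/ltW/hN.
have al : approximable l.
  apply: approximable_lim => e /hl [N hN]; exists (wval (u N)); first exact: wvalP.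
  by have := fboundN (hN N (leqnn N)); rewrite opprB.
exists (mkw al); apply/cvgrPdist_le => e /hl [N hN]; exists N => // n Nn.
rewrite sub0r normrN ger0_norm; last by case: (wnorm_bound (u n - mkw al)).
by apply: fnorm_le; rewrite wvalB; exact: hN.
Qed.

HB.instance Definition _ := Algebra_isCStar.Build R A wstrK wstrD wstrZ wstrM
  wnorm_eq0 wnormD wnormZ wnormM wnorm_star wnorm_complete.

End WFunctions.

Section WvalMorphism.
Variable R : realType.

Lemma wval_linear : linear (@wval R).
Proof. by []. Qed.

Lemma wval_monoid : monoid_morphism (@wval R).
Proof. by split; [exact: w1E|]. Qed.

HB.instance Definition _ :=
  GRing.isLinear.Build R[i] (wfunctions R) (domD R -> 'M[R[i]]_4) *:%R
    (@wval R) wval_linear.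
HB.instance Definition _ :=
  GRing.isMonoidMorphism.Build (wfunctions R) (domD R -> 'M[R[i]]_4)
    (@wval R) wval_monoid.

End WvalMorphism.

Section Generators.
Variable R : realType.
Local Notation A := (wfunctions R).

Definition evw t : A := mkw (approximable_ev t).
Definition wgen1 : A := evw (WGen _ false false).
Definition wgen2 : A := evw (WGen _ true false).

Lemma ev_wgen t : ev wgen1 wgen2 t = evw t.
Proof.
elim: t => [k|i st|x IHx y IHy|x IHx y IHy].
- apply: wval_inj; apply/funext => p; rewrite [LHS]/(k *: (wval 1 p)).
  by rewrite [wval 1]w1E.
- by apply: wval_inj; case: i; case: st.
- by rewrite [LHS]/(ev _ _ x + ev _ _ y) IHx IHy; apply: wval_inj.
- by rewrite [LHS]/(ev _ _ x * ev _ _ y) IHx IHy; apply: wval_inj.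
Qed.

Lemma evwD t u : evw (WAdd t u) = evw t + evw u.
Proof. exact: wval_inj. Qed.

Lemma evwM t u : evw (WMul t u) = evw t * evw u.
Proof. exact: wval_inj. Qed.

Lemma wgen_wcar : wcar_rel wgen1 wgen2.
Proof.
have pair i p : mxstar (mgens p i false) * mgens p i false
    + mgens p i false * mxstar (mgens p i false) = 1.
  by rewrite mgens_star addrC; exact: wc_pair (mgens_wcar p) i.
split.
- by apply: wval_inj; rewrite [RHS]w1E; apply/funext => p; exact: pair.
- by apply: wval_inj; rewrite [RHS]w1E; apply/funext => p; exact: pair.
- apply: wval_inj; apply/funext => p.
  rewrite [LHS]/(mxstar (mgens p false false) * mgens p true false).
  apply/eqP; rewrite -subr_eq0.
  rewrite [_ - _]/(_ - (-1) *: (mgens p true false * mxstar (mgens p false false))).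
  rewrite scaleN1r opprK !mgens_star; apply/eqP.
  exact: wc_cross (mgens_wcar p) true.
Qed.

Lemma cnorm_evw_bound (B : cstarAlgType R) (b1 b2 : B) t : wcar_rel b1 b2 ->
  cnorm (ev b1 b2 t) <= cnorm (evw t).
Proof.
by move=> bW; have [n0 hn] := wnorm_bound (evw t); exact: main_inequality.
Qed.

Lemma evw_approx (x : A) e : 0 < e -> exists t, cnorm (x - evw t) <= e.
Proof.
by move=> /(wvalP x) [t ht]; exists t; apply: fnorm_le; rewrite wvalB.
Qed.

End Generators.

Section StarHom.
Variables (R : realType) (A B : cstarAlgType R) (f : {lrmorphism A -> B}).
Hypothesis fS : {morph f : x / star x}.

Lemma star_hom_ev a1 a2 t : f (ev a1 a2 t) = ev (f a1) (f a2) t.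
Proof.
have fZ k x : f (k *: x) = k *: f x by exact: linearZ.
apply: weval_morph => [k|i st]; first by rewrite -(rmorph1 f); exact: fZ.
by case: i; case: st => //=; exact: fS.
Qed.

End StarHom.

(** * The universal property of the matrix functions *)

Section Universal.
Variables (R : realType) (B : cstarAlgType R) (b1 b2 : B).
Hypothesis bW : wcar_rel b1 b2.
Local Notation A := (wfunctions R).
Implicit Types (x y : A) (b c : B).

(** The closure of the graph P(a1, a2) |-> P(b1, b2): one polynomial approximates on both sides at
    once. By [ev_dist] this closure is again a graph, and each algebraic law follows by combining
    approximants. *)
Definition extends x b := forall e, 0 < e ->
  exists t, cnorm (x - evw t) <= e /\ cnorm (b - ev b1 b2 t) <= e.

Lemma ev_dist t u : cnorm (ev b1 b2 t - ev b1 b2 u) <= cnorm (evw t - evw u).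
Proof.
have -> : ev b1 b2 t - ev b1 b2 u = ev b1 b2 (WAdd t (WMul (WConst (-1)) u)).
  by rewrite [RHS]/(_ + (-1)%:A * ev b1 b2 u) mulr_algl scaleN1r.
apply: le_trans (cnorm_evw_bound _ bW) _; rewrite le_eqVlt; apply/orP; left.
apply/eqP; congr cnorm; rewrite -!ev_wgen.
by rewrite [LHS]/(_ + (-1)%:A * ev _ _ u) mulr_algl scaleN1r.
Qed.

Lemma extends_total x : exists b, extends x b.
Proof.
pose d n : R := n.+1%:R^-1.
have d0 n : 0 < d n by rewrite invr_gt0 ltr0n.
have [t ht] := @choice _ _ (fun n t => cnorm (x - evw t) <= d n)
  (fun n => evw_approx x (d0 n)).
have dN e : 0 < e -> exists N, forall n, (N <= n)%N -> d n <= e.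
  move=> e0; exists (Num.truncn e^-1) => n Nn.
  rewrite /d -[leRHS]invrK lef_pV2 ?posrE ?invr_gt0 ?ltr0n //.
  apply/ltW; apply: lt_le_trans (truncnS_gt _) _; by rewrite ler_nat.
have tt m n : cnorm (ev b1 b2 (t m) - ev b1 b2 (t n)) <= d m + d n.
  apply: le_trans (ev_dist _ _) _.
  have -> : evw (t m) - evw (t n) = (x - evw (t n)) - (x - evw (t m)).
    by rewrite opprB [RHS]addrC addrA subrK.
  by apply: le_trans (cnormB _ _) _; rewrite addrC lerD.
have [|b hb] := @cnorm_complete R B (fun n => ev b1 b2 (t n)).
  move=> e e0; have e40 : 0 < e / 4%:R by rewrite divr_gt0.
  have [N hN] := dN _ e40; exists N => m n /hN hm /hN hn.
  by apply: le_lt_trans (tt m n) _; lra.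
exists b => e e0; have [N1 h1] := dN _ e0.
have /cvgrPdist_le /(_ _ e0) [N2 _ h2] := hb.
exists (t (maxn N1 N2)); split.
  by apply: le_trans (ht _) _; apply: h1; exact: leq_maxl.
have := h2 (maxn N1 N2) (leq_maxr _ _) => /=.
by rewrite sub0r normrN ger0_norm ?cnorm_ge0 // cdistC.
Qed.

Lemma extends_ev t : extends (evw t) (ev b1 b2 t).
Proof. by move=> e e0; exists t; rewrite !subrr !cnorm0 ltW. Qed.

Lemma extends_unique x b c : extends x b -> extends x c -> b = c.
Proof.
move=> hb hc; apply/eqP; rewrite -subr_eq0; apply/eqP/cnorm_eq0/eqP.
rewrite eq_le cnorm_ge0 andbT; apply/ler_addgt0Pr => e e0; rewrite add0r.
have e40 : 0 < e / 4%:R by rewrite divr_gt0.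
have e4E : e / 4%:R + e / 4%:R + (e / 4%:R + e / 4%:R) = e by field.
have [t [t1 t2]] := hb _ e40; have [u [u1 u2]] := hc _ e40.
have -> : b - c = (b - ev b1 b2 t) - (c - ev b1 b2 u)
    + (ev b1 b2 t - ev b1 b2 u).
  rewrite opprB [RHS](AC (2*2*2) ((1*4)*(2*5)*(3*6)))%AC /=.
  by rewrite addNr subrr !addr0.
apply: le_trans (cnormD _ _) _.
have h1 : cnorm (b - ev b1 b2 t - (c - ev b1 b2 u)) <= e / 4%:R + e / 4%:R.
  exact: le_trans (cnormB _ _) (lerD t2 u2).
have h2 : cnorm (ev b1 b2 t - ev b1 b2 u) <= e / 4%:R + e / 4%:R.
  apply: le_trans (ev_dist _ _) _.
  have -> : evw t - evw u = (x - evw u) - (x - evw t).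
    by rewrite opprB [RHS]addrC addrA subrK.
  exact: le_trans (cnormB _ _) (lerD u1 t1).
by apply: le_trans (lerD h1 h2) _; rewrite e4E.
Qed.

Lemma extendsD x y b c : extends x b -> extends y c -> extends (x + y) (b + c).
Proof.
move=> hb hc e e0; have e20 : 0 < e / 2 by rewrite divr_gt0.
have [t [t1 t2]] := hb _ e20; have [u [u1 u2]] := hc _ e20.
exists (WAdd t u); rewrite evwD.
rewrite [ev _ _ _]/(ev b1 b2 t + ev b1 b2 u) !opprD.
rewrite [x + y + _]addrACA [b + c + _]addrACA [e]splitr.
by split; apply: le_trans (cnormD _ _) _; [exact: lerD t1 u1|exact: lerD t2 u2].
Qed.

Lemma prod_approx (D : cstarAlgType R) (x y u v : D) (e : R) : 0 <= e <= 1 ->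
  cnorm (x - u) <= e -> cnorm (y - v) <= e ->
  cnorm (x * y - u * v) <= e * (cnorm x + cnorm y + 1).
Proof.
move=> /andP[e0 e1] hx hy.
have -> : x * y - u * v = (x - u) * y + u * (y - v).
  by rewrite mulrBl mulrBr addrA subrK.
have hu : cnorm u <= cnorm x + 1.
  rewrite -[u](subKr x); apply: le_trans (cnormB _ _) _.
  by rewrite lerD2l; exact: le_trans e1.
apply: le_trans (cnormD _ _) _.
apply: le_trans (lerD (cnormM _ _) (cnormM _ _)) _.
have h1 : cnorm (x - u) * cnorm y <= e * cnorm y by rewrite ler_wpM2r ?cnorm_ge0.
have h2 : cnorm u * cnorm (y - v) <= (cnorm x + 1) * e.
  by apply: ler_pM; rewrite ?cnorm_ge0.
by lra.
Qed.

Lemma add1_bounds (p q r s : R) : 0 <= p -> 0 <= q -> 0 <= r -> 0 <= s ->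
  [/\ 0 < p + q + 1 + (r + s + 1), p + q + 1 <= p + q + 1 + (r + s + 1)
    & r + s + 1 <= p + q + 1 + (r + s + 1)].
Proof. by move=> p0 q0 r0 s0; split; lra. Qed.

Lemma extendsM x y b c : extends x b -> extends y c -> extends (x * y) (b * c).
Proof.
move=> hb hc e e0.
pose K := cnorm x + cnorm y + 1 + (cnorm b + cnorm c + 1).
have [K0 hK1 hK2] : [/\ 0 < K, cnorm x + cnorm y + 1 <= K & cnorm b + cnorm c + 1 <= K].
  exact: add1_bounds (cnorm_ge0 _) (cnorm_ge0 _) (cnorm_ge0 _) (cnorm_ge0 _).
pose d := Num.min 1 (e / K).
have d0 : 0 < d by rewrite lt_min ltr01 divr_gt0.
have d1 : 0 <= d <= 1 by rewrite ltW //= ge_min lexx.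
have dK : d * K <= e by rewrite -ler_pdivlMr // ge_min lexx orbT.
have [t [t1 t2]] := hb _ d0; have [u [u1 u2]] := hc _ d0.
exists (WMul t u); rewrite evwM.
rewrite [ev _ _ _]/(ev b1 b2 t * ev b1 b2 u).
have dp : 0 <= d by exact: ltW.
split.
  apply: le_trans (prod_approx d1 t1 u1) _; apply: le_trans dK.
  by rewrite ler_wpM2l.
apply: le_trans (prod_approx d1 t2 u2) _; apply: le_trans dK.
by rewrite ler_wpM2l.
Qed.

Lemma extendsZ (k : R[i]) x b : extends x b -> extends (k *: x) (k *: b).
Proof.
move=> h; have := extendsM (extends_ev (WConst k)) h.
by rewrite -ev_wgen ![ev _ _ (WConst k)]/(k%:A) !mulr_algl.
Qed.

Lemma extendsS x b : extends x b -> extends (star x) (star b).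
Proof.
move=> h e /h [t [t1 t2]]; exists (wstar t).
by rewrite -ev_wgen -!ev_star -!starB !cnormS ev_wgen.
Qed.

Definition wext x : B := sval (cid (extends_total x)).

Lemma wextP x : extends x (wext x).
Proof. exact: svalP (cid (extends_total x)). Qed.

Lemma wextE x b : extends x b -> wext x = b.
Proof. by move=> h; exact: extends_unique (wextP x) h. Qed.

Lemma wext_linear : linear wext.
Proof. by move=> k x y; apply: wextE; apply: extendsD (extendsZ _ (wextP x)) (wextP y). Qed.

Lemma wext1 : wext 1 = 1.
Proof.
have e (D : cstarAlgType R) (d1 d2 : D) : ev d1 d2 (WConst 1) = 1.
  by rewrite /ev /= scale1r.
by apply: wextE; have := extends_ev (WConst 1); rewrite -ev_wgen !e.
Qed.

Lemma wext_monoid : monoid_morphism wext.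
Proof. by split=> [|x y]; [exact: wext1|apply: wextE; apply: extendsM; exact: wextP]. Qed.

HB.instance Definition _ := GRing.isLinear.Build R[i] A B *:%R wext wext_linear.
HB.instance Definition _ := GRing.isMonoidMorphism.Build A B wext wext_monoid.

Lemma wext_star : {morph wext : x / star x}.
Proof. by move=> x; apply: wextE; apply: extendsS; exact: wextP. Qed.

Lemma wext_ev t : wext (evw t) = ev b1 b2 t.
Proof. exact: wextE (extends_ev t). Qed.

(** The values on *-polynomials determine [f] because *-homomorphisms are contractive. *)
Lemma wext_unique (f : {lrmorphism A -> B}) : {morph f : x / star x} ->
  f (wgen1 R) = b1 -> f (wgen2 R) = b2 -> f =1 wext.
Proof.
move=> fS f1 f2 x; apply/esym; apply: wextE => e /(evw_approx x) [t ht].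
exists t; split=> //; rewrite -f1 -f2 -(star_hom_ev fS) ev_wgen -rmorphB.
by apply: le_trans (star_hom_contractive fS _) ht.
Qed.

End Universal.

Lemma wfunctions_enveloping (R : realType) :
  is_enveloping_wcar (wgen1 R) (wgen2 R).
Proof.
split; first exact: wgen_wcar.
move=> B b1 b2 bW; exists (wext bW); split.
- exact: wext_star.
- exact: wext_ev (WGen _ false false).
- exact: wext_ev (WGen _ true false).
- exact: wext_unique.
Qed.

(** * Uniform closure and the generated C*-algebra *)

Section UniformClosure.
Variable R : realType.
Local Notation C := R[i].
Local Notation F := (domD R -> 'M[C]_4).
Local Notation U := {uniform domD R -> 'M[R[i]^o]_4}.

Lemma uniform_closureP (S : set F) (f : F) :
  closure (S : set U) f <-> forall e : R, 0 < e ->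
    exists2 g, S g & forall p i j, normc (f p i j - g p i j) <= e.
Proof.
split=> [fS e e0|h B].
  have ec0 : 0 < e%:C :> C by rewrite ltcR.
  have [|g [Sg fg]] := fS [set g : U | forall p, ball (f p : 'M[R[i]^o]_4) e%:C (g p)].
    apply/uniform_nbhs; exists [set xy | ball xy.1 e%:C xy.2]; split.
      by rewrite -entourage_ballE; exists e%:C.
    by move=> g /= hg p; exact: hg.
  exists g => // p i j; have [_ /(_ i j)] := fg p.
  by rewrite -ball_normE /= normc_normE ltcR => /ltW.
move=> /uniform_nbhs [E [entE EB]]; move: entE; rewrite -entourage_ballE => -[e /= e0 eE].
(* Radii of balls are complex numbers here; a positive one has zero imaginary part. *)
move: e0; rewrite ltcE /= => /andP[/eqP ei er].
have e20 : 0 < complex.Re e / 2 by rewrite divr_gt0.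
have [g Sg fg] := h _ e20; exists g; split=> //; apply: EB => p _; apply: eE => /=.
have ee : e = (complex.Re e)%:C by case: (e) ei => a b /= ->.
split; first by rewrite ee ltcR.
move=> i j; rewrite -ball_normE /= normc_normE ee ltcR.
by apply: le_lt_trans (fg p i j) _; rewrite ltr_pdivrMr // ltr_pMr // ltr1n.
Qed.

End UniformClosure.

Section Generated.
Variable R : realType.
Local Notation F := (domD R -> 'M[R[i]]_4).
Local Notation G := [set mat_a1 R; mat_a2 R].

Lemma approximable_cstar : cstar_subalgebra (@approximable R).
Proof.
split.
- move=> c f g hf hg; exact: approximableD (approximableZ c hf) hg.
- by move=> f g; exact: approximableM.
- by move=> f; exact: approximableS.
- move=> f /uniform_closureP h; apply: approximable_lim => e e0.
  have e160 : 0 < e / 16%:R by rewrite divr_gt0.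
  have [g ag fg] := h _ e160; exists g => //; split=> [|p v]; first exact: ltW.
  apply: le_trans (vnorm_entries (d := e / 16%:R) _ _) _.
    by move=> i j; rewrite !mxE.
  by rewrite [16%:R * _]mulrC divfK ?pnatr_eq0.
Qed.

Lemma evf_generated (S : set F) t : cstar_subalgebra S -> G `<=` S -> S (evf t).
Proof.
case=> Slin SM Sst _ GS.
have S1 : S (mat_a1 R) by apply: GS; left.
have S0 : S 0 by rewrite -(addNr (mat_a1 R)) -scaleN1r; exact: Slin.
have SZ k f : S f -> S (k *: f) by move=> Sf; rewrite -[_ *: _]addr0; exact: Slin.
have SD f g : S f -> S g -> S (f + g).
  by move=> Sf Sg; rewrite -[f]scale1r; exact: Slin.
elim: t => [k|i st|x Sx y Sy|x Sx y Sy].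
(* [cstar_subalgebra] does not include the unit; it is recovered from the relation a1* a1 + a1 a1* =
   1. *)
- have -> : evf (WConst k) = k *:
      (fstar (mat_a1 R) * mat_a1 R + mat_a1 R * fstar (mat_a1 R)).
    apply/funext => p; rewrite [LHS]/(k *: 1); congr (_ *: _).
    by rewrite -(wc_pair (mgens_wcar p) false) addrC.
  by apply: SZ; apply: SD; apply: SM => //; exact: Sst.
- have Sa : S (if i then mat_a2 R else mat_a1 R) by case: i => //; apply: GS; right.
  case: st; last by case: i Sa.
  by case: i Sa => /Sst.
- exact: SD.
- exact: SM.
Qed.

Lemma approximable_generated :
  [set f | approximable f] = cstar_generated G.
Proof.
apply/seteqP; split=> f.
  move=> af S [Sc GS]; have [_ _ _ Scl] := Sc; apply: Scl; apply/uniform_closureP => e e0.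
  have [t [_ ht]] := af _ e0; exists (evf t); first exact: evf_generated Sc GS.
  move=> p i j; have := entry_le (X := f p - evf t p) (ht p) i j.
  by rewrite mxE [X in normc (_ + X)]mxE.
apply; split; first exact: approximable_cstar.
by move=> _ [->|->]; [exact: approximable_ev (WGen _ false false)|
                      exact: approximable_ev (WGen _ true false)].
Qed.

End Generated.

(* The first conjunct says that the enveloping algebra exists, so that the
   second one, which is about every model of it, is not vacuous. *)
Theorem theorem4p3 (R : realType) :
  (exists (E : cstarAlgType R) (e1 e2 : E), is_enveloping_wcar e1 e2) /\
  (forall (E : cstarAlgType R) (e1 e2 : E), is_enveloping_wcar e1 e2 ->
    exists f : {lrmorphism E -> (domD R -> 'M[R[i]]_4)},
      [/\ {morph f : x / star x >-> fstar x},
          injective f,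
          range f = cstar_generated [set mat_a1 R; mat_a2 R],
          f e1 = mat_a1 R
        & f e2 = mat_a2 R]).
Proof.
split; first by exists (wfunctions R), (wgen1 R), (wgen2 R); exact: wfunctions_enveloping.
move=> E e1 e2 [eW eU].
have [wW wU] := wfunctions_enveloping R.
have [f [fS f1 f2 _]] := eU _ _ _ wW.
have [g [gS g1 g2 _]] := wU _ _ _ eW.
have gf : cancel f g.
  have [h [_ _ _ hU]] := eU _ _ _ eW.
  have e := hU (g \o f : {lrmorphism E -> E}); have i := hU (idfun : {lrmorphism E -> E}).
  move=> x; rewrite -[LHS]/((g \o f) x) e /= ?f1 ?f2 //.
    by rewrite -[LHS]i.
  by move=> y /=; rewrite fS gS.
have fg : cancel g f.
  have [h [_ _ _ hU]] := wU _ _ _ wW.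
  have e := hU (f \o g : {lrmorphism wfunctions R -> wfunctions R}).
  have i := hU (idfun : {lrmorphism wfunctions R -> wfunctions R}).
  move=> x; rewrite -[LHS]/((f \o g) x) e /= ?g1 ?g2 //.
    by rewrite -[LHS]i.
  by move=> y /=; rewrite gS fS.
exists (@wval R \o f : {lrmorphism E -> (domD R -> 'M[R[i]]_4)}); split.
- by move=> x; rewrite /= fS.
- exact: inj_comp (@wval_inj R) (can_inj gf).
- rewrite -approximable_generated; apply/seteqP; split=> [_ [x _ <-]|h ah].
    exact: wvalP.
  by exists (g (mkw ah)) => //=; rewrite fg.
- by rewrite /= f1.
- by rewrite /= f2.
Qed.
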